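(* Let $R$ be a commutative ring with identity and $k\ge 1$. There is an isomorphism of groups $$e\colon K_n^R(k)\longrightarrow \mathrm{Coalg}(C(-)^{\otimes n},T(-^{\wedge k}))$$ for $1\le n\le\infty$.
   Context: For finite $n$, $K_n^R(k)$ is the quotient of the free product $\coprod R_{\{x_{i_1}|x_{i_2}|\cdots|x_{i_k}\}}$ over all words $\{x_{i_1}|\cdots|x_{i_k}\}$ with $1\le i_j\le n$ for $1\le j\le k$, where $R_w$ is a copy of the additive group of $R$ labelled by the word $w$ and $w^r$ denotes $r\in R_w=R$, by the following relations (for all $l$ and all $r,r_j,r_j'\in R$): (1) $\{x_{i_1}|\cdots|x_{i_k}\}^r=1$ if $i_s=i_t$ for some $1\le s<t\le k$; (2) $[[\{x_{i_1}|\cdots|x_{i_k}\}^{r_1},\{x_{i_{k+1}}|\cdots|x_{i_{2k}}\}^{r_2},\dots,\{x_{i_{(l-1)k+1}}|\cdots|x_{i_{lk}}\}^{r_l}]=1$ if $i_s=i_t$ for some $1\le s<t\le kl$; (3) $[[\{x_{i_1}|\cdots|x_{i_k}\}^{r_1},\dots,\{x_{i_{(l-1)k+1}}|\cdots|x_{i_{lk}}\}^{r_l}]=[[\{x_{i_1}|\cdots|x_{i_k}\}^{r_1'},\dots,\{x_{i_{(l-1)k+1}}|\cdots|x_{i_{lk}}\}^{r_l'}]$ if $r_1\cdots r_l=r_1'\cdots r_l'$. Here $[x,y]=x^{-1}y^{-1}xy$ and $[[a_1,a_2,\dots,a_l]=[\cdots[[a_1,a_2],a_3],\dots,a_l]$.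 For a free $R$-module $V$, $C(V)=R\oplus V$ is the coalgebra in which the elements of $V$ are primitive, and $C(V)^{\otimes n}$ has the tensor product coalgebra structure. The smash product is $C\wedge D=(C\otimes D)/(C\otimes_R R\oplus R\otimes_R D)$; $V^{\wedge k}$ denotes the $k$-fold smash product of $C(V)$, which as an $R$-module is $V^{\otimes k}$. $T(V^{\wedge k})$ is the tensor algebra on $V^{\wedge k}=V^{\otimes k}$, a Hopf algebra in which the elements of $V^{\wedge k}$ are primitive. $\mathrm{Coalg}(C(-)^{\otimes n},T(-^{\wedge k}))$ is the group of families of $R$-coalgebra maps $f_V\colon C(V)^{\otimes n}\to T(V^{\wedge k})$ natural in the free $R$-module $V$, with multiplication the convolution product $f*g=\mu\circ(f\otimes g)\circ\psi$, where $\psi$ is the comultiplication of $C(V)^{\otimes n}$ and $\mu$ the multiplication of $T(V^{\wedge k})$. For $n=\infty$ the two sides are read as limits: $K_\infty^R(k)=\lim_n K_n^R(k)$ along the projections $K_n^R(k)\to K_{n-1}^R(k)$ that send every word containing $x_n$ to $1$ and fix the other words, and $C(V)^{\otimes\infty}$ is the colimit of the $C(V)^{\otimes n}$ along the inclusions $C(V)^{\otimes (n-1)}=C(V)^{\otimes (n-1)}\otimes R\subseteq C(V)^{\otimes n}$, so that $\mathrm{Coalg}(C(-)^{\otimes\infty},T(-^{\wedge k}))=\lim_n\mathrm{Coalg}(C(-)^{\otimes n},T(-^{\wedge k}))$. *)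

(* Defs.v *)
From HB Require Import structures.
From mathcomp Require Import all_boot ssralg boolp.

Set Implicit Arguments.
Unset Strict Implicit.
Unset Printing Implicit Defensive.

Import GRing.Theory.
Local Open Scope quotient_scope.
Local Open Scope ring_scope.

Record equivalence (T : Type) := Equivalence {
  eqv :> T -> T -> Prop;
  eqv_refl : forall x, eqv x x;
  eqv_sym : forall x y, eqv x y -> eqv y x;
  eqv_trans : forall x y z, eqv x y -> eqv y z -> eqv x z }.

Section Quotient.
Variables (T : Type) (e : equivalence T).

Definition eqvb : rel {classic T} := fun x y => `[< e x y >].

Lemma eqvb_refl : reflexive eqvb.
Proof. by move=> x; apply/asboolP; exact: eqv_refl. Qed.

Lemma eqvb_sym : symmetric eqvb.
Proof.
by move=> x y; apply/asboolP/asboolP => h; exact: eqv_sym h.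
Qed.

Lemma eqvb_trans : transitive eqvb.
Proof.
by move=> y x z /asboolP xy /asboolP yz; apply/asboolP; apply: eqv_trans yz.
Qed.

Definition eqvb_rel := EquivRel eqvb eqvb_refl eqvb_sym eqvb_trans.

Definition quot := {eq_quot eqvb_rel}.
HB.instance Definition _ := Choice.on quot.

Definition cls (x : T) : quot := \pi_({eq_quot eqvb_rel}) x.
Definition rep (q : quot) : T := repr (q : {eq_quot eqvb_rel}).

Lemma repK q : cls (rep q) = q.
Proof. exact: reprK. Qed.

Lemma clsP x y : cls x = cls y <-> e x y.
Proof.
split=> [h|h]; last by apply/eqmodP/asboolP.
by apply/asboolP; apply/(@eqmodP _ eqvb_rel).
Qed.

Lemma rep_cls x : e (rep (cls x)) x.
Proof. by apply/clsP; rewrite repK. Qed.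

Lemma quotW (P : quot -> Prop) : (forall x, P (cls x)) -> forall q, P q.
Proof. by move=> h q; rewrite -(repK q). Qed.

Definition qlift (Z : Type) (f : T -> Z) (q : quot) : Z := f (rep q).

Lemma qliftE (Z : Type) (f : T -> Z) :
  (forall x y, e x y -> f x = f y) -> forall x, qlift f (cls x) = f x.
Proof. by move=> h x; apply: h; exact: rep_cls. Qed.

End Quotient.

(* The families of maps indexed by all free modules form a type that is too
   large (universe-wise) to carry a [groupType] structure, since the latter
   requires a [choiceType]. *)
Record abstractGroup := AbstractGroup {
  gcarrier :> Type;
  gmul : gcarrier -> gcarrier -> gcarrier;
  gone : gcarrier;
  ginv : gcarrier -> gcarrier;
  gmulA : associative gmul;
  gmul1 : left_id gone gmul;
  gmulV : left_inverse gone ginv gmul }.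

Definition group_of (G : groupType) : abstractGroup :=
  @AbstractGroup G (@mul G) (@one G) (@inv G) (@mulgA G) (@mul1g G) (@mulVg G).
Coercion group_of : Group.type >-> abstractGroup.

Definition group_isomorphic (G H : abstractGroup) : Prop :=
  exists e : G -> H, bijective e /\ forall x y, e (gmul x y) = gmul (e x) (e y).

Inductive gterm (X : Type) :=
| GGen of X | GOne | GMul of gterm X & gterm X | GInv of gterm X.
Arguments GOne {X}.

HB.instance Definition _ X := hasMul.Build (gterm X) (@GMul X).
HB.instance Definition _ X := hasOne.Build (gterm X) (@GOne X).
HB.instance Definition _ X := hasInv.Build (gterm X) (@GInv X).

Section Presentation.
Local Open Scope group_scope.
Variables (X : Type) (rel : gterm X -> gterm X -> Prop).

Inductive geq : gterm X -> gterm X -> Prop :=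
| geq_rel a b : rel a b -> geq a b
| geq_refl a : geq a a
| geq_sym a b : geq a b -> geq b a
| geq_trans a b c : geq a b -> geq b c -> geq a c
| geq_mul a a' b b' : geq a a' -> geq b b' -> geq (a * b) (a' * b')
| geq_inv a a' : geq a a' -> geq a^-1 a'^-1
| geq_mulA a b c : geq (a * (b * c)) (a * b * c)
| geq_mul1 a : geq (1 * a) a
| geq_mulg1 a : geq (a * 1) a
| geq_mulV a : geq (a^-1 * a) 1
| geq_mulgV a : geq (a * a^-1) 1.

Definition geq_equiv := Equivalence geq_refl geq_sym geq_trans.

Definition presgroup := quot geq_equiv.
HB.instance Definition _ := Choice.on presgroup.

Definition pgcls (a : gterm X) : presgroup := cls geq_equiv a.
Definition pgmul (x y : presgroup) : presgroup := pgcls (rep x * rep y).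
Definition pginv (x : presgroup) : presgroup := pgcls (rep x)^-1.

Lemma pgmulE a b : pgmul (pgcls a) (pgcls b) = pgcls (a * b).
Proof. by apply/clsP; apply: geq_mul; exact: (rep_cls geq_equiv). Qed.

Lemma pginvE a : pginv (pgcls a) = pgcls a^-1.
Proof. by apply/clsP; apply: geq_inv; exact: (rep_cls geq_equiv). Qed.

Lemma pgmulA : associative pgmul.
Proof.
elim/quotW=> a; elim/quotW=> b; elim/quotW=> c; rewrite -!/(pgcls _) !pgmulE.
by apply/clsP; exact: geq_mulA.
Qed.

Lemma pgmul1 : left_id (pgcls 1) pgmul.
Proof.
by elim/quotW=> a; rewrite -!/(pgcls _) !pgmulE; apply/clsP; exact: geq_mul1.
Qed.

Lemma pgmulg1 : right_id (pgcls 1) pgmul.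
Proof.
by elim/quotW=> a; rewrite -!/(pgcls _) !pgmulE; apply/clsP; exact: geq_mulg1.
Qed.

Lemma pgmulV : left_inverse (pgcls 1) pginv pgmul.
Proof.
elim/quotW=> a; rewrite -!/(pgcls _) pginvE !pgmulE.
by apply/clsP; exact: geq_mulV.
Qed.

Lemma pgmulgV : right_inverse (pgcls 1) pginv pgmul.
Proof.
elim/quotW=> a; rewrite -!/(pgcls _) pginvE !pgmulE.
by apply/clsP; exact: geq_mulgV.
Qed.

HB.instance Definition _ :=
  isGroup.Build presgroup pgmulA pgmul1 pgmulg1 pgmulV pgmulgV.

Definition pggen (x : X) : presgroup := pgcls (GGen x).

Fixpoint geval (G : groupType) (phi : X -> G) (a : gterm X) : G :=
  match a with
  | GGen x => phi x
  | GOne => 1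
  | GMul a b => geval phi a * geval phi b
  | GInv a => (geval phi a)^-1
  end.

Lemma geval_pggen a : geval pggen a = pgcls a.
Proof.
elim: a => [x||a IHa b IHb|a IHa] //=.
  by rewrite IHa IHb [LHS]pgmulE.
by rewrite IHa [LHS]pginvE.
Qed.

Definition pglift (G : groupType) (phi : X -> G) : presgroup -> G :=
  qlift (geval phi).

Section Lift.
Variables (G : groupType) (phi : X -> G).
Hypothesis phi_rel : forall a b, rel a b -> geval phi a = geval phi b.

Lemma geval_geq a b : geq a b -> geval phi a = geval phi b.
Proof.
elim=> //=.
- by move=> {}a {}b c _ -> _ ->.
- by move=> {}a a' {}b b' _ -> _ ->.
- by move=> {}a a' _ ->.
- by move=> {}a {}b c; rewrite mulgA.
- by move=> {}a; rewrite mul1g.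
- by move=> {}a; rewrite mulg1.
- by move=> {}a; rewrite mulVg.
- by move=> {}a; rewrite mulgV.
Qed.

Lemma pgliftE a : pglift phi (pgcls a) = geval phi a.
Proof. by apply: qliftE; exact: geval_geq. Qed.

Lemma pglift_gen x : pglift phi (pggen x) = phi x.
Proof. exact: pgliftE. Qed.

Lemma pgliftM : {morph pglift phi : x y / x * y}.
Proof.
elim/quotW=> a; elim/quotW=> b; rewrite -!/(pgcls _).
by rewrite [_ * _]pgmulE !pgliftE.
Qed.

End Lift.
End Presentation.

(* [[ a, a_2, ..., a_l ] with a_2, ..., a_l the elements of s. *)
Definition itercomm (G : baseGroupType) (a : G) (s : seq G) : G :=
  foldl (@commg G) a s.

(* The groups K_n^R(k).  The letters x_1, ..., x_n are indexed by 'I_n, and the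
   generator (w, r) stands for w^r. *)

Section KGroup.
Local Open Scope group_scope.
Variables (R : comPzRingType) (k : nat).

Section FixedN.
Variable n : nat.

Definition Kword := k.-tuple 'I_n.

Definition Kgen (p : Kword * R) : gterm (Kword * R) := GGen p.

(* [Krel_add] presents the free product of the copies R_w of (R, +). *)
Inductive Krel : gterm (Kword * R) -> gterm (Kword * R) -> Prop :=
| Krel_add (w : Kword) (r s : R) :
    Krel (Kgen (w, r) * Kgen (w, s)) (Kgen (w, (r + s)%R))
| Krel_repeat1 (w : Kword) (r : R) : ~~ uniq w -> Krel (Kgen (w, r)) 1
| Krel_repeat (p : Kword * R) (s : seq (Kword * R)) :
    ~~ uniq (flatten [seq tval q.1 | q <- p :: s]) ->
    Krel (itercomm (Kgen p) (map Kgen s)) 1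
| Krel_coef (p p' : Kword * R) (s s' : seq (Kword * R)) :
    [seq q.1 | q <- p :: s] = [seq q.1 | q <- p' :: s'] ->
    (\prod_(q <- p :: s) q.2 = \prod_(q <- p' :: s') q.2)%R ->
    Krel (itercomm (Kgen p) (map Kgen s)) (itercomm (Kgen p') (map Kgen s')).

Definition Kgroup : groupType := presgroup Krel.

Definition Kpow (w : Kword) (r : R) : Kgroup := pggen Krel (w, r).

End FixedN.

Section Projection.
Variable n : nat.

Definition widen_word (w : Kword n) : Kword n.+1 :=
  map_tuple (widen_ord (leqnSn n)) w.

(* The last letter of 'I_n.+1 is the only one outside the image of
   [widen_ord]. *)
Definition Kproj_gen (p : Kword n.+1 * R) : Kgroup n :=
  if [pick v | widen_word v == p.1] is Some v then Kpow v p.2 else 1.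

Definition Kproj : Kgroup n.+1 -> Kgroup n := pglift Kproj_gen.

Lemma widen_word_inj : injective widen_word.
Proof.
move=> v w /(congr1 val)/= h; apply/val_inj/(inj_map _ h).
by move=> i j /(congr1 val)/= /val_inj.
Qed.

Lemma Kproj_widen v r : Kproj_gen (widen_word v, r) = Kpow v r.
Proof.
rewrite /Kproj_gen; case: pickP => [w /eqP/widen_word_inj->//|/(_ v)].
by rewrite eqxx.
Qed.

Lemma Kproj_last w r : ord_max \in w -> Kproj_gen (w, r) = 1.
Proof.
move=> wn; rewrite /Kproj_gen; case: pickP => // v /eqP/= ewv.
move: wn; rewrite -ewv => /mapP[i _ /(congr1 val)/= en].
by move: (ltn_ord i); rewrite -en ltnn.
Qed.

Lemma Kproj_genP (p : Kword n.+1 * R) :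
  (exists2 v, widen_word v = p.1 & forall r, Kproj_gen (p.1, r) = Kpow v r) \/
  (forall r, Kproj_gen (p.1, r) = 1).
Proof.
case: p => w r /=; case: (pickP (fun v => widen_word v == w)) => [v /eqP ev|h].
  by left; exists v => // s; rewrite -ev Kproj_widen.
right=> s; rewrite /Kproj_gen /=.
by case: pickP => // v; rewrite h.
Qed.

Lemma geval_itercomm X (G : groupType) (phi : X -> G) a s :
  geval phi (itercomm a s) = itercomm (geval phi a) (map (geval phi) s).
Proof. by elim: s a => [//|b s IH] a; rewrite [LHS]IH. Qed.

Lemma itercomm1 (G : groupType) (s : seq G) : itercomm 1 s = 1.
Proof.
by rewrite /itercomm; elim: s => //= a s; rewrite /commg /conjg invg1 !mul1g mulVg.
Qed.

Lemma itercomm_mem1 (G : groupType) (a : G) (s : seq G) :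
  1 \in a :: s -> itercomm a s = 1.
Proof.
elim: s a => [a|b s IH a]; first by rewrite inE => /eqP.
rewrite inE => /predU1P[<-|].
  exact: itercomm1.
rewrite inE => /predU1P[<-|h]; last by apply: IH; rewrite inE h orbT.
apply: IH; rewrite inE /commg /conjg invg1 mulg1 mul1g mulVg eqxx //.
Qed.

Lemma Kproj_split (s : seq (Kword n.+1 * R)) :
  (exists t : seq (Kword n * R),
     s = [seq (widen_word q.1, q.2) | q <- t]) \/
  (forall s', [seq q.1 | q <- s'] = [seq q.1 | q <- s] ->
     1 \in [seq Kproj_gen q | q <- s']).
Proof.
elim: s => [|p s IH]; first by left; exists [::].
have [[v ev _]|h] := Kproj_genP p; last first.
  right; case=> [//|[w r] s'] /= [ew _]; rewrite inE.
  by rewrite [w]ew h eqxx.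
case: IH => [[t ->]|h].
  by left; exists ((v, p.2) :: t); rewrite /= ev; case: (p).
by right; case=> [//|p' s'] /= [_ /h]; rewrite inE => ->; rewrite orbT.
Qed.

Lemma uniq_widen (t : seq (Kword n * R)) :
  uniq (flatten [seq tval q.1 | q <- [seq (widen_word q.1, q.2) | q <- t]]) =
  uniq (flatten [seq tval q.1 | q <- t]).
Proof.
rewrite -map_comp -(map_inj_uniq (f := widen_ord (leqnSn n))).
  by rewrite map_flatten -map_comp.
by move=> i j /(congr1 val)/= /val_inj.
Qed.

Lemma Kproj_itercomm p s :
  geval Kproj_gen (itercomm (Kgen p) (map (@Kgen n.+1) s)) =
  itercomm (Kproj_gen p) (map Kproj_gen s).
Proof. by rewrite geval_itercomm -map_comp. Qed.

Lemma pgcls_itercomm p s :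
  pgcls (@Krel n) (itercomm (Kgen p) (map (@Kgen n) s)) =
  itercomm (Kpow p.1 p.2) [seq Kpow q.1 q.2 | q <- s].
Proof.
rewrite -!geval_pggen geval_itercomm -map_comp; case: p => w r.
by congr itercomm; apply: eq_map => -[].
Qed.

Lemma Kproj_rel a b : Krel a b -> geval Kproj_gen a = geval Kproj_gen b.
Proof.
case=> {a b}.
- move=> w r s /=; have [[v /= _ h]|h] := Kproj_genP (w, r); rewrite !h.
    rewrite [LHS]pgmulE; apply/clsP/geq_rel; exact: Krel_add.
  exact: mulg1.
- move=> w r uw /=; have [[v /= ev h]|->//] := Kproj_genP (w, r).
  rewrite h; apply/clsP/geq_rel; apply: Krel_repeat1.
  apply: contra uw => uv; rewrite -ev map_inj_uniq //.
  by move=> i j /(congr1 val)/= /val_inj.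
- move=> p s u; rewrite Kproj_itercomm [RHS]/=.
  have [[[//|[v r] t]]|] := Kproj_split (p :: s); last first.
    by move=> /(_ _ erefl) /itercomm_mem1.
  move=> e; rewrite e uniq_widen in u; case: e => -> ->.
  rewrite Kproj_widen -map_comp (eq_map (g := fun q => Kpow q.1 q.2)).
    rewrite -(pgcls_itercomm (v, r)); apply/clsP/geq_rel/Krel_repeat.
    exact: u.
  by move=> q; rewrite /= Kproj_widen.
- move=> p p' s s' ew er; rewrite !Kproj_itercomm.
  have [[[//|[v r] t]] e|h] := Kproj_split (p :: s); last first.
    by rewrite !itercomm_mem1 //; [exact: (h (p' :: s')) | exact: (h (p :: s))].
  have [[[//|[v' r'] t']] e'|h] := Kproj_split (p' :: s'); last first.
    by rewrite !itercomm_mem1 //; [exact: (h (p' :: s')) | exact: (h (p :: s))].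
  move: ew er; rewrite e e' !big_map -!map_comp => ew er.
  have {}ew : [seq q.1 | q <- (v, r) :: t] = [seq q.1 | q <- (v', r') :: t'].
    apply: (inj_map widen_word_inj); rewrite -!map_comp.
    exact: ew.
  case: e => -> ->; case: e' => -> ->.
  rewrite !Kproj_widen -!map_comp.
  rewrite (eq_map (g := fun q => Kpow q.1 q.2)); last first.
    by move=> q; rewrite /= Kproj_widen.
  rewrite [in RHS](eq_map (g := fun q => Kpow q.1 q.2)); last first.
    by move=> q; rewrite /= Kproj_widen.
  rewrite -(pgcls_itercomm (v, r)) -(pgcls_itercomm (v', r')).
  by apply/clsP/geq_rel/Krel_coef.
Qed.

Lemma KprojM : {morph Kproj : x y / x * y}.
Proof. exact: pgliftM Kproj_rel. Qed.

Lemma Kproj1 : Kproj 1 = 1.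
Proof. exact: pgliftE Kproj_rel 1. Qed.

Lemma Kproj_pow w r : Kproj (Kpow w r) = Kproj_gen (w, r).
Proof. exact: pglift_gen Kproj_rel _. Qed.

End Projection.

(* Including the term n = 0 does not change the limit. *)
Record Kinf := KInf {
  kinf_val :> forall n, Kgroup n;
  kinf_compat : forall n, Kproj (kinf_val n.+1) = kinf_val n }.

HB.instance Definition _ := gen_eqMixin Kinf.
HB.instance Definition _ := gen_choiceMixin Kinf.

Lemma kinf_ext (x y : Kinf) : (forall n, x n = y n) -> x = y.
Proof.
case: x y => [x hx] [y hy] /= h.
have e : x = y by apply: functional_extensionality_dep.
by subst y; congr KInf; exact: Prop_irrelevance.
Qed.

Fact kinf_mul_compat (x y : Kinf) n : Kproj (x n.+1 * y n.+1) = x n * y n.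
Proof. by rewrite KprojM !kinf_compat. Qed.

Fact kinf_inv_compat (x : Kinf) n : Kproj (x n.+1)^-1 = (x n)^-1.
Proof.
apply: (mulgI (x n)); rewrite mulgV -{1}(kinf_compat x) -KprojM mulgV.
exact: Kproj1.
Qed.

Definition kinf_mul (x y : Kinf) : Kinf :=
  @KInf (fun n => x n * y n) (kinf_mul_compat x y).
Definition kinf_one : Kinf := @KInf (fun n => 1) Kproj1.
Definition kinf_inv (x : Kinf) : Kinf :=
  @KInf (fun n => (x n)^-1) (kinf_inv_compat x).

Lemma kinf_mulA : associative kinf_mul.
Proof. by move=> x y z; apply: kinf_ext => n; exact: mulgA. Qed.
Lemma kinf_mul1 : left_id kinf_one kinf_mul.
Proof. by move=> x; apply: kinf_ext => n; exact: mul1g. Qed.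
Lemma kinf_mulg1 : right_id kinf_one kinf_mul.
Proof. by move=> x; apply: kinf_ext => n; exact: mulg1. Qed.
Lemma kinf_mulV : left_inverse kinf_one kinf_inv kinf_mul.
Proof. by move=> x; apply: kinf_ext => n; exact: mulVg. Qed.
Lemma kinf_mulgV : right_inverse kinf_one kinf_inv kinf_mul.
Proof. by move=> x; apply: kinf_ext => n; exact: mulgV. Qed.

HB.instance Definition _ := isGroup.Build Kinf
  kinf_mulA kinf_mul1 kinf_mulg1 kinf_mulV kinf_mulgV.

Definition KinfGroup : groupType := Kinf.

End KGroup.

(* A function packed with a proof of its linearity, locked so that
   simplification does not unfold it. *)
HB.lock Definition mklin (R : comPzRingType) (U V : lmodType R) (f : U -> V)
    (f_lin : linear f) : {linear U -> V} :=
  HB.pack f (GRing.isLinear.Build R U V *:%R f f_lin).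

Section Linear.
Variable R : comPzRingType.

Lemma mklinE (U V : lmodType R) (f : U -> V) (f_lin : linear f) :
  mklin f_lin =1 f.
Proof. by rewrite mklin.unlock. Qed.

Lemma linear_ext (U V : lmodType R) (f g : {linear U -> V}) : f =1 g -> f = g.
Proof.
case: f g => [f [[hf] [hf']]] [g [[hg] [hg']]] /= /funext fg.
subst g; congr (GRing.Linear.Pack (GRing.Linear.Class _ _)).
  by congr Algebra.isNmodMorphism.Axioms_; exact: Prop_irrelevance.
by congr GRing.isScalable.Axioms_; exact: Prop_irrelevance.
Qed.

Record bilin (M N P : lmodType R) := Bilin {
  bilin_fun :> M -> N -> P;
  bilin_l : forall n, linear (bilin_fun^~ n);
  bilin_r : forall m, linear (bilin_fun m) }.

Section BilinTheory.
Variables (M N P : lmodType R) (b : bilin M N P).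

Lemma bilinDl m m' n : b (m + m') n = b m n + b m' n.
Proof. by have := bilin_l b n 1 m m'; rewrite /= !scale1r. Qed.
Lemma bilinDr m n n' : b m (n + n') = b m n + b m n'.
Proof. by have := bilin_r b m 1 n n'; rewrite /= !scale1r. Qed.
Lemma bilin0l n : b 0 n = 0.
Proof. by apply: (addrI (b 0 n)); rewrite -bilinDl !addr0. Qed.
Lemma bilin0r m : b m 0 = 0.
Proof. by apply: (addrI (b m 0)); rewrite -bilinDr !addr0. Qed.
Lemma bilinZl r m n : b (r *: m) n = r *: b m n.
Proof. by have := bilin_l b n r m 0; rewrite /= bilin0l !addr0. Qed.
Lemma bilinZr r m n : b m (r *: n) = r *: b m n.
Proof. by have := bilin_r b m r n 0; rewrite /= bilin0r !addr0. Qed.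

End BilinTheory.
End Linear.

Section Tensor.
Variables (R : comPzRingType) (M N : lmodType R).

Inductive tterm :=
| TPure of M & N | TZero | TAdd of tterm & tterm | TOpp of tterm
| TScale of R & tterm.

Inductive teq : tterm -> tterm -> Prop :=
| teq_refl a : teq a a
| teq_sym a b : teq a b -> teq b a
| teq_trans a b c : teq a b -> teq b c -> teq a c
| teq_add a a' b b' : teq a a' -> teq b b' -> teq (TAdd a b) (TAdd a' b')
| teq_opp a a' : teq a a' -> teq (TOpp a) (TOpp a')
| teq_scale r a a' : teq a a' -> teq (TScale r a) (TScale r a')
| teq_addA a b c : teq (TAdd a (TAdd b c)) (TAdd (TAdd a b) c)
| teq_addC a b : teq (TAdd a b) (TAdd b a)
| teq_add0 a : teq (TAdd TZero a) a
| teq_addN a : teq (TAdd (TOpp a) a) TZero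
| teq_scaleA r s a : teq (TScale r (TScale s a)) (TScale (r * s) a)
| teq_scale1 a : teq (TScale 1 a) a
| teq_scaleDr r a b : teq (TScale r (TAdd a b)) (TAdd (TScale r a) (TScale r b))
| teq_scaleDl r s a : teq (TScale (r + s) a) (TAdd (TScale r a) (TScale s a))
| teq_pureDl m m' n : teq (TPure (m + m') n) (TAdd (TPure m n) (TPure m' n))
| teq_pureDr m n n' : teq (TPure m (n + n')) (TAdd (TPure m n) (TPure m n'))
| teq_pureZl r m n : teq (TPure (r *: m) n) (TScale r (TPure m n))
| teq_pureZr r m n : teq (TPure m (r *: n)) (TScale r (TPure m n)).

Definition teq_equiv := Equivalence teq_refl teq_sym teq_trans.

(* M (x) N: the free R-module on the symbols m (x) n modulo bilinearity. *)
Definition tens := quot teq_equiv.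
HB.instance Definition _ := Choice.on tens.

Definition tcls (a : tterm) : tens := cls teq_equiv a.
Definition tadd (x y : tens) : tens := tcls (TAdd (rep x) (rep y)).
Definition topp (x : tens) : tens := tcls (TOpp (rep x)).
Definition tscale r (x : tens) : tens := tcls (TScale r (rep x)).

Lemma taddE a b : tadd (tcls a) (tcls b) = tcls (TAdd a b).
Proof. by apply/clsP; apply: teq_add; exact: (rep_cls teq_equiv). Qed.
Lemma toppE a : topp (tcls a) = tcls (TOpp a).
Proof. by apply/clsP; apply: teq_opp; exact: (rep_cls teq_equiv). Qed.
Lemma tscaleE r a : tscale r (tcls a) = tcls (TScale r a).
Proof. by apply/clsP; apply: teq_scale; exact: (rep_cls teq_equiv). Qed.

Lemma taddA : associative tadd.
Proof.
elim/quotW=> a; elim/quotW=> b; elim/quotW=> c; rewrite -!/(tcls _) !taddE.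
by apply/clsP; exact: teq_addA.
Qed.
Lemma taddC : commutative tadd.
Proof.
elim/quotW=> a; elim/quotW=> b; rewrite -!/(tcls _) !taddE.
by apply/clsP; exact: teq_addC.
Qed.
Lemma tadd0 : left_id (tcls TZero) tadd.
Proof.
by elim/quotW=> a; rewrite -!/(tcls _) !taddE; apply/clsP; exact: teq_add0.
Qed.
Lemma taddN : left_inverse (tcls TZero) topp tadd.
Proof.
elim/quotW=> a; rewrite -!/(tcls _) toppE taddE.
by apply/clsP; exact: teq_addN.
Qed.

HB.instance Definition _ := GRing.isZmodule.Build tens taddA taddC tadd0 taddN.

Lemma tscaleA r s x : tscale r (tscale s x) = tscale (r * s) x.
Proof.
elim/quotW: x => a; rewrite -!/(tcls _) !tscaleE.
by apply/clsP; exact: teq_scaleA.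
Qed.
Lemma tscale1 : left_id 1 tscale.
Proof.
elim/quotW=> a; rewrite -!/(tcls _) !tscaleE.
by apply/clsP; exact: teq_scale1.
Qed.
Lemma tscaleDr : right_distributive tscale +%R.
Proof.
move=> r; elim/quotW=> a; elim/quotW=> b; rewrite -!/(tcls _).
rewrite [tcls a + tcls b]taddE !tscaleE [RHS]taddE.
by apply/clsP; exact: teq_scaleDr.
Qed.
Lemma tscaleDl x : {morph tscale^~ x : r s / r + s}.
Proof.
move=> r s; elim/quotW: x => a; rewrite -!/(tcls _) !tscaleE [RHS]taddE.
by apply/clsP; exact: teq_scaleDl.
Qed.

HB.instance Definition _ := GRing.Zmodule_isLmodule.Build R tens
  tscaleA tscale1 tscaleDr tscaleDl.

Lemma tclsD a b : tcls (TAdd a b) = tcls a + tcls b.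
Proof. by rewrite [RHS]taddE. Qed.
Lemma tclsN a : tcls (TOpp a) = - tcls a.
Proof. by rewrite [RHS]toppE. Qed.
Lemma tclsZ r a : tcls (TScale r a) = r *: tcls a.
Proof. by rewrite [RHS]tscaleE. Qed.

Definition tpure (m : M) (n : N) : tens := tcls (TPure m n).

Lemma tpureDl m m' n : tpure (m + m') n = tpure m n + tpure m' n.
Proof. by rewrite [RHS]taddE; apply/clsP; exact: teq_pureDl. Qed.
Lemma tpureDr m n n' : tpure m (n + n') = tpure m n + tpure m n'.
Proof. by rewrite [RHS]taddE; apply/clsP; exact: teq_pureDr. Qed.
Lemma tpureZl r m n : tpure (r *: m) n = r *: tpure m n.
Proof. by rewrite [RHS]tscaleE; apply/clsP; exact: teq_pureZl. Qed.
Lemma tpureZr r m n : tpure m (r *: n) = r *: tpure m n.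
Proof. by rewrite [RHS]tscaleE; apply/clsP; exact: teq_pureZr. Qed.

Fact tpure_linl n : linear (tpure^~ n).
Proof. by move=> r m m'; rewrite tpureDl tpureZl. Qed.
Fact tpure_linr m : linear (tpure m).
Proof. by move=> r n n'; rewrite tpureDr tpureZr. Qed.
Definition tpureb : bilin M N tens := Bilin tpure_linl tpure_linr.

Lemma tensW (P : tens -> Prop) :
  P 0 -> (forall x y, P x -> P y -> P (x + y)) ->
  (forall m n, P (tpure m n)) -> forall x, P x.
Proof.
move=> P0 PD PP; elim/quotW=> a; rewrite -/(tcls a) -[tcls a]scale1r.
elim: a (1 : R) => [m n|| a IHa b IHb|a IHa|s a IHa] r.
- by rewrite -/(tpure m n) -tpureZl; exact: PP.
- by rewrite -[tcls TZero]/(0 : tens) scaler0.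
- by rewrite tclsD scalerDr; exact: PD.
- by rewrite tclsN scalerN -scaleNr.
- by rewrite tclsZ scalerA.
Qed.

Section Lift.
Variables (P : lmodType R) (b : bilin M N P).

Fixpoint teval (a : tterm) : P :=
  match a with
  | TPure m n => b m n
  | TZero => 0
  | TAdd a b => teval a + teval b
  | TOpp a => - teval a
  | TScale r a => r *: teval a
  end.

Lemma teval_teq a a' : teq a a' -> teval a = teval a'.
Proof.
elim=> //=.
- by move=> {}a c {}a' _ -> _ ->.
- by move=> {}a {}a' c c' _ -> _ ->.
- by move=> {}a {}a' _ ->.
- by move=> r {}a {}a' _ ->.
- by move=> *; rewrite addrA.
- by move=> *; rewrite addrC.
- by move=> *; rewrite add0r.
- by move=> *; rewrite addNr.
- by move=> *; rewrite scalerA.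
- by move=> *; rewrite scale1r.
- by move=> *; rewrite scalerDr.
- by move=> *; rewrite scalerDl.
- by move=> *; rewrite bilinDl.
- by move=> *; rewrite bilinDr.
- by move=> *; rewrite bilinZl.
- by move=> *; rewrite bilinZr.
Qed.

Definition tlift_fun : tens -> P := qlift teval.

Lemma tlift_cls a : tlift_fun (tcls a) = teval a.
Proof. by apply: qliftE; exact: teval_teq. Qed.

Fact tlift_linear : linear tlift_fun.
Proof.
move=> r; elim/quotW=> a; elim/quotW=> a'; rewrite -!/(tcls _).
by rewrite -tclsZ -tclsD !tlift_cls.
Qed.

Definition tlift : {linear tens -> P} := mklin tlift_linear.

Lemma tliftE m n : tlift (tpure m n) = b m n.
Proof. by rewrite mklinE; exact: (tlift_cls (TPure m n)). Qed.

End Lift.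

Lemma tens_ext (P : lmodType R) (f g : {linear tens -> P}) :
  (forall m n, f (tpure m n) = g (tpure m n)) -> f =1 g.
Proof.
move=> fg; elim/tensW => [|x y hx hy|m n]; first by rewrite !linear0.
  by rewrite !linearD hx hy.
exact: fg.
Qed.

End Tensor.

Section Structural.
Variable R : comPzRingType.
Implicit Types M N P Q : lmodType R.

Lemma tlift_param M N P Q (b : P -> bilin M N Q) :
  (forall m n, linear (fun p => b p m n)) ->
  forall x, linear (fun p => tlift (b p) x).
Proof.
move=> hb; elim/tensW => [|x y hx hy|m n] r p p' /=; last by rewrite !tliftE hb.
  by rewrite !linear0 ?scaler0 addr0.
by rewrite !linearD hx hy ?scalerDr addrACA.
Qed.

Definition bilin_param M N P Q (b : P -> bilin M N Q)
    (hb : forall m n, linear (fun p => b p m n)) : bilin (tens M N) P Q :=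
  @Bilin R _ _ _ (fun x p => tlift (b p) x)
    (fun p => linearP (tlift (b p))) (tlift_param hb).

Definition bilin_comp M N P Q (f : {linear P -> Q}) (b : bilin M N P) :
  bilin M N Q.
Proof.
exists (fun m n => f (b m n)).
- by move=> n r m m'; rewrite bilinDl bilinZl linearP.
- by move=> m r n n'; rewrite bilinDr bilinZr linearP.
Defined.

Definition bilin_pre M N M' N' P (b : bilin M' N' P)
    (f : {linear M -> M'}) (g : {linear N -> N'}) : bilin M N P.
Proof.
exists (fun m n => b (f m) (g n)).
- by move=> n r m m'; rewrite linearP bilinDl bilinZl.
- by move=> m r n n'; rewrite linearP bilinDr bilinZr.
Defined.

Definition bilin_swap M N P (b : bilin M N P) : bilin N M P :=
  @Bilin R _ _ _ (fun n m => b m n) (bilin_r b) (bilin_l b).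

Definition bilin_scale M : bilin R^o M M.
Proof.
exists (fun (r : R) m => r *: m).
- by move=> m r s s'; rewrite scalerDl scalerA.
- by move=> s r m m'; rewrite scalerDr !scalerA mulrC.
Defined.

Definition tmap M M' N N' (f : {linear M -> M'}) (g : {linear N -> N'}) :
  {linear tens M N -> tens M' N'} := tlift (bilin_pre (tpureb M' N') f g).

Lemma tmapE M M' N N' (f : {linear M -> M'}) (g : {linear N -> N'}) m n :
  tmap f g (tpure m n) = tpure (f m) (g n).
Proof. exact: tliftE. Qed.

Definition tswap M N : {linear tens M N -> tens N M} :=
  tlift (bilin_swap (tpureb N M)).

Lemma tswapE M N m n : tswap M N (tpure m n) = tpure n m.
Proof. exact: tliftE. Qed.

(* The canonical isomorphism R (x) M -> M. *)
Definition tunitl M : {linear tens R^o M -> M} := tlift (bilin_scale M).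

Lemma tunitlE M r m : tunitl M (tpure r m) = r *: m.
Proof. exact: tliftE. Qed.

Definition tunitr M : {linear tens M R^o -> M} :=
  tlift (bilin_swap (bilin_scale M)).

Lemma tunitrE M r m : tunitr M (tpure m r) = r *: m.
Proof. exact: tliftE. Qed.

Section Assoc.
Variables M N P : lmodType R.

Definition assoc_bilin (p : P) : bilin M N (tens M (tens N P)).
Proof.
exists (fun m n => tpure m (tpure n p)).
- by move=> n r m m'; rewrite tpureDl tpureZl.
- by move=> m r n n'; rewrite tpureDl tpureZl tpureDr tpureZr.
Defined.

Fact assoc_bilin_param m n : linear (fun p => assoc_bilin p m n).
Proof. by move=> r p p'; rewrite /= !(tpureDr, tpureZr). Qed.

Definition tassoc : {linear tens (tens M N) P -> tens M (tens N P)} :=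
  tlift (bilin_param assoc_bilin_param).

Lemma tassocE m n p : tassoc (tpure (tpure m n) p) = tpure m (tpure n p).
Proof. by rewrite tliftE /= tliftE. Qed.

End Assoc.

Section Interchange.
Variables M N P Q : lmodType R.

Definition inter_bilin2 (m : M) (n : N) :
  bilin P Q (tens (tens M P) (tens N Q)).
Proof.
exists (fun p q => tpure (tpure m p) (tpure n q)).
- by move=> q r p p'; rewrite tpureDr tpureZr tpureDl tpureZl.
- by move=> p r q q'; rewrite [tpure n _]tpureDr !tpureZr tpureDr tpureZr.
Defined.

Definition inter_bilin (y : tens P Q) :
  bilin M N (tens (tens M P) (tens N Q)).
Proof.
exists (fun m n => tlift (inter_bilin2 m n) y).
- move=> n; apply: tlift_param => p q r m m'.
  by rewrite /= [tpure _ p]tpureDl !tpureZl tpureDl tpureZl.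
- move=> m; apply: tlift_param => p q r n n'.
  by rewrite /= [tpure _ q]tpureDl !tpureZl tpureDr tpureZr.
Defined.

Fact inter_bilin_param m n : linear (fun y => inter_bilin y m n).
Proof. exact: (linearP (tlift (inter_bilin2 m n))). Qed.

(* The interchange (M (x) N) (x) (P (x) Q) -> (M (x) P) (x) (N (x) Q). *)
Definition tinter :
    {linear tens (tens M N) (tens P Q) -> tens (tens M P) (tens N Q)} :=
  tlift (bilin_param inter_bilin_param).

Lemma tinterE m n p q :
  tinter (tpure (tpure m n) (tpure p q)) = tpure (tpure m p) (tpure n q).
Proof. by rewrite tliftE /= tliftE /= tliftE. Qed.

End Interchange.

Lemma tmap_comp M M' M'' N N' N'' (f : {linear M -> M'})
    (f' : {linear M' -> M''}) (g : {linear N -> N'}) (g' : {linear N' -> N''}) x :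
  tmap f' g' (tmap f g x) =
  tmap (f' \o f : {linear _ -> _}) (g' \o g : {linear _ -> _}) x.
Proof.
by elim/tensW: x => [|x y hx hy|m n]; rewrite ?linear0 ?linearD ?hx ?hy ?tmapE.
Qed.

Lemma eq_tmap M M' N N' (f f' : {linear M -> M'}) (g g' : {linear N -> N'}) :
  f =1 f' -> g =1 g' -> tmap f g =1 tmap f' g'.
Proof. by move=> /linear_ext-> /linear_ext->. Qed.

Lemma tmap_id M N x : tmap (idfun : {linear M -> M}) (idfun : {linear N -> N}) x = x.
Proof.
by elim/tensW: x => [|x y hx hy|m n]; rewrite ?linear0 ?linearD ?hx ?hy ?tmapE.
Qed.

Lemma tlift_map M M' N N' P (b : bilin M' N' P)
    (f : {linear M -> M'}) (g : {linear N -> N'}) x :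
  tlift b (tmap f g x) = tlift (bilin_pre b f g) x.
Proof.
by elim/tensW: x => [|x y hx hy|m n]; rewrite ?linear0 ?linearD ?hx ?hy // tmapE !tliftE.
Qed.

End Structural.

(* Unlike [algType R], an algebra may be zero, which happens over the zero
   ring. *)
Record algebra (R : comPzRingType) := MkAlgebra {
  alg_mod :> lmodType R;
  amul : bilin alg_mod alg_mod alg_mod;
  aone : alg_mod;
  amulA : associative amul;
  amul1l : left_id aone amul;
  amul1r : right_id aone amul }.

Definition is_algmap (R : comPzRingType) (A B : algebra R) (f : A -> B) : Prop :=
  f (aone A) = aone B /\ forall x y, f (amul A x y) = amul B (f x) (f y).

Record coalgebra (R : comPzRingType) := MkCoalgebra {
  coalg_mod :> lmodType R;
  comul : {linear coalg_mod -> tens coalg_mod coalg_mod};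
  counit : {linear coalg_mod -> R^o};
  comulA : forall x, tassoc _ _ _ (tmap comul idfun (comul x)) =
                     tmap idfun comul (comul x);
  comul1l : forall x, tunitl _ (tmap counit idfun (comul x)) = x;
  comul1r : forall x, tunitr _ (tmap idfun counit (comul x)) = x }.

Definition is_coalgmap (R : comPzRingType) (C D : coalgebra R)
    (f : {linear C -> D}) : Prop :=
  (forall x, comul D (f x) = tmap f f (comul C x)) /\
  (forall x, counit D (f x) = counit C x).

Definition cocommutative (R : comPzRingType) (C : coalgebra R) : Prop :=
  forall x, tswap C C (comul C x) = comul C x.

Section Algebras.
Variable R : comPzRingType.
Implicit Types A B : algebra R.

Definition mulmap A : {linear tens A A -> A} := tlift (amul A).

Lemma mulmapE A x y : mulmap A (tpure x y) = amul A x y.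
Proof. exact: tliftE. Qed.

Definition base_alg : algebra R :=
  @MkAlgebra R R^o (bilin_scale R^o) (1 : R) (@mulrA R) (@mul1r R) (@mulr1 R).

Definition op_alg A : algebra R :=
  @MkAlgebra R A (bilin_swap (amul A)) (aone A)
    (fun x y z => esym (amulA z y x)) (@amul1r R A) (@amul1l R A).

Section TensAlgebra.
Variables A B : algebra R.

Definition tmul : bilin (tens A B) (tens A B) (tens A B) :=
  bilin_comp (tmap (mulmap A) (mulmap B) \o tinter A B A B : {linear _ -> _})
    (tpureb (tens A B) (tens A B)).

Lemma tmulE a b a' b' :
  tmul (tpure a b) (tpure a' b') = tpure (amul A a a') (amul B b b').
Proof. by rewrite /= tinterE tmapE !mulmapE. Qed.

Fact tmulA : associative tmul.
Proof.
elim/tensW => [|x x' hx hx'|a b] y z; first by rewrite !bilin0l.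
  by rewrite !bilinDl hx hx'.
elim/tensW: y => [|y y' hy hy'|a' b']; first by rewrite ?(bilin0l, bilin0r).
  by rewrite !(bilinDl, bilinDr) hy hy'.
elim/tensW: z => [|z z' hz hz'|a'' b'']; first by rewrite !bilin0r.
  by rewrite !bilinDr hz hz'.
by rewrite !tmulE !amulA.
Qed.

Fact tmul1l : left_id (tpure (aone A) (aone B)) tmul.
Proof.
elim/tensW => [|x x' hx hx'|a b]; rewrite ?bilin0r ?bilinDr ?hx ?hx' //.
by rewrite tmulE !amul1l.
Qed.

Fact tmul1r : right_id (tpure (aone A) (aone B)) tmul.
Proof.
elim/tensW => [|x x' hx hx'|a b]; rewrite ?bilin0l ?bilinDl ?hx ?hx' //.
by rewrite tmulE !amul1r.
Qed.

Definition tens_alg : algebra R := MkAlgebra tmulA tmul1l tmul1r.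

End TensAlgebra.

Lemma tmap_algmap A A' B B' (f : {linear A -> A'}) (g : {linear B -> B'}) :
  is_algmap f -> is_algmap g ->
  @is_algmap R (tens_alg A B) (tens_alg A' B') (tmap f g).
Proof.
move=> [f1 fM] [g1 gM]; split; first by rewrite tmapE f1 g1.
elim/tensW => [|x x' hx hx'|a b] y; first by rewrite !(linear0, bilin0l).
  by rewrite !(linearD, bilinDl) hx hx'.
elim/tensW: y => [|y y' hy hy'|a' b']; first by rewrite !(linear0, bilin0r).
  by rewrite !(linearD, bilinDr) hy hy'.
by rewrite tmulE !tmapE tmulE fM gM.
Qed.

Lemma tassoc_algmap A B A' :
  @is_algmap R (tens_alg (tens_alg A B) A') (tens_alg A (tens_alg B A'))
    (tassoc A B A').
Proof.
split; first by rewrite tassocE.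
elim/tensW => [|x x' hx hx'|u c] y; first by rewrite !(linear0, bilin0l).
  by rewrite !(linearD, bilinDl) hx hx'.
elim/tensW: u => [|u u' hu hu'|a b].
- by rewrite -[tpure _ _]/(tpureb _ _ _ _) ?(linear0, bilin0l).
- rewrite -[tpure _ _]/(tpureb _ _ _ _) !(linearD, bilinDl) /=.
  by rewrite hu hu'.
elim/tensW: y => [|y y' hy hy'|u' c']; first by rewrite !(linear0, bilin0r).
  by rewrite !(linearD, bilinDr) hy hy'.
elim/tensW: u' => [|u u' hu hu'|a' b'].
- by rewrite -[tpure 0 _]/(tpureb _ _ _ _) !(linear0, bilin0l, bilin0r).
- rewrite -[tpure (_ + _) _]/(tpureb _ _ _ _) !(linearD, bilinDl, bilinDr) /=.
  by rewrite hu hu'.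
by rewrite !(tmulE, tassocE).
Qed.

Lemma comp_algmap A B A' (f : A -> B) (g : B -> A') :
  is_algmap f -> is_algmap g -> is_algmap (g \o f).
Proof.
by move=> [f1 fM] [g1 gM]; split=> [|x y] /=; rewrite ?f1 ?fM ?g1 ?gM.
Qed.

End Algebras.

Section TensorAlgebra.
Variables (R : comPzRingType) (W : lmodType R).

Inductive aterm :=
| AGen of W | AZero | AAdd of aterm & aterm | AOpp of aterm
| AScale of R & aterm | AOne | AMul of aterm & aterm.

Inductive aeq : aterm -> aterm -> Prop :=
| aeq_refl a : aeq a a
| aeq_sym a b : aeq a b -> aeq b a
| aeq_trans a b c : aeq a b -> aeq b c -> aeq a c
| aeq_add a a' b b' : aeq a a' -> aeq b b' -> aeq (AAdd a b) (AAdd a' b')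
| aeq_opp a a' : aeq a a' -> aeq (AOpp a) (AOpp a')
| aeq_scale r a a' : aeq a a' -> aeq (AScale r a) (AScale r a')
| aeq_mul a a' b b' : aeq a a' -> aeq b b' -> aeq (AMul a b) (AMul a' b')
| aeq_addA a b c : aeq (AAdd a (AAdd b c)) (AAdd (AAdd a b) c)
| aeq_addC a b : aeq (AAdd a b) (AAdd b a)
| aeq_add0 a : aeq (AAdd AZero a) a
| aeq_addN a : aeq (AAdd (AOpp a) a) AZero
| aeq_scaleA r s a : aeq (AScale r (AScale s a)) (AScale (r * s) a)
| aeq_scale1 a : aeq (AScale 1 a) a
| aeq_scaleDr r a b : aeq (AScale r (AAdd a b)) (AAdd (AScale r a) (AScale r b))
| aeq_scaleDl r s a : aeq (AScale (r + s) a) (AAdd (AScale r a) (AScale s a))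
| aeq_mulA a b c : aeq (AMul a (AMul b c)) (AMul (AMul a b) c)
| aeq_mul1l a : aeq (AMul AOne a) a
| aeq_mul1r a : aeq (AMul a AOne) a
| aeq_mulDl a b c : aeq (AMul (AAdd a b) c) (AAdd (AMul a c) (AMul b c))
| aeq_mulDr a b c : aeq (AMul a (AAdd b c)) (AAdd (AMul a b) (AMul a c))
| aeq_mulZl r a b : aeq (AMul (AScale r a) b) (AScale r (AMul a b))
| aeq_mulZr r a b : aeq (AMul a (AScale r b)) (AScale r (AMul a b))
| aeq_genD v w : aeq (AGen (v + w)) (AAdd (AGen v) (AGen w))
| aeq_genZ r w : aeq (AGen (r *: w)) (AScale r (AGen w)).

Definition aeq_equiv := Equivalence aeq_refl aeq_sym aeq_trans.

(* T(W): the free R-algebra on the elements of W modulo the linearity of the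
   inclusion of W. *)
Definition tensalg := quot aeq_equiv.
HB.instance Definition _ := Choice.on tensalg.

Definition acls (a : aterm) : tensalg := cls aeq_equiv a.
Definition aadd (x y : tensalg) : tensalg := acls (AAdd (rep x) (rep y)).
Definition aopp (x : tensalg) : tensalg := acls (AOpp (rep x)).
Definition ascale r (x : tensalg) : tensalg := acls (AScale r (rep x)).
Definition atmul (x y : tensalg) : tensalg := acls (AMul (rep x) (rep y)).

Lemma aaddE a b : aadd (acls a) (acls b) = acls (AAdd a b).
Proof. by apply/clsP; apply: aeq_add; exact: (rep_cls aeq_equiv). Qed.
Lemma aoppE a : aopp (acls a) = acls (AOpp a).
Proof. by apply/clsP; apply: aeq_opp; exact: (rep_cls aeq_equiv). Qed.
Lemma ascaleE r a : ascale r (acls a) = acls (AScale r a).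
Proof. by apply/clsP; apply: aeq_scale; exact: (rep_cls aeq_equiv). Qed.
Lemma atmulE a b : atmul (acls a) (acls b) = acls (AMul a b).
Proof. by apply/clsP; apply: aeq_mul; exact: (rep_cls aeq_equiv). Qed.

Lemma aaddA : associative aadd.
Proof.
elim/quotW=> a; elim/quotW=> b; elim/quotW=> c; rewrite -!/(acls _) !aaddE.
by apply/clsP; exact: aeq_addA.
Qed.
Lemma aaddC : commutative aadd.
Proof.
elim/quotW=> a; elim/quotW=> b; rewrite -!/(acls _) !aaddE.
by apply/clsP; exact: aeq_addC.
Qed.
Lemma aadd0 : left_id (acls AZero) aadd.
Proof.
by elim/quotW=> a; rewrite -!/(acls _) !aaddE; apply/clsP; exact: aeq_add0.
Qed.
Lemma aaddN : left_inverse (acls AZero) aopp aadd.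
Proof.
elim/quotW=> a; rewrite -!/(acls _) aoppE aaddE.
by apply/clsP; exact: aeq_addN.
Qed.

HB.instance Definition _ :=
  GRing.isZmodule.Build tensalg aaddA aaddC aadd0 aaddN.

Lemma ascaleA r s x : ascale r (ascale s x) = ascale (r * s) x.
Proof.
elim/quotW: x => a; rewrite -!/(acls _) !ascaleE.
by apply/clsP; exact: aeq_scaleA.
Qed.
Lemma ascale1 : left_id 1 ascale.
Proof.
elim/quotW=> a; rewrite -!/(acls _) !ascaleE.
by apply/clsP; exact: aeq_scale1.
Qed.
Lemma ascaleDr : right_distributive ascale +%R.
Proof.
move=> r; elim/quotW=> a; elim/quotW=> b; rewrite -!/(acls _).
rewrite [acls a + acls b]aaddE !ascaleE [RHS]aaddE.
by apply/clsP; exact: aeq_scaleDr.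
Qed.
Lemma ascaleDl x : {morph ascale^~ x : r s / r + s}.
Proof.
move=> r s; elim/quotW: x => a; rewrite -!/(acls _) !ascaleE [RHS]aaddE.
by apply/clsP; exact: aeq_scaleDl.
Qed.

HB.instance Definition _ := GRing.Zmodule_isLmodule.Build R tensalg
  ascaleA ascale1 ascaleDr ascaleDl.

Lemma aclsD a b : acls (AAdd a b) = acls a + acls b.
Proof. by rewrite [RHS]aaddE. Qed.
Lemma aclsN a : acls (AOpp a) = - acls a.
Proof. by rewrite [RHS]aoppE. Qed.
Lemma aclsZ r a : acls (AScale r a) = r *: acls a.
Proof. by rewrite [RHS]ascaleE. Qed.

Lemma atmul_linl y : linear (atmul^~ y).
Proof.
elim/quotW: y => c r; elim/quotW=> a; elim/quotW=> b; rewrite -!/(acls _).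
rewrite -aclsZ -aclsD !atmulE -aclsZ -aclsD; apply/clsP.
apply: aeq_trans (aeq_mulDl _ _ _) _; apply: aeq_add; last exact: aeq_refl.
exact: aeq_mulZl.
Qed.
Lemma atmul_linr x : linear (atmul x).
Proof.
elim/quotW: x => c r; elim/quotW=> a; elim/quotW=> b; rewrite -!/(acls _).
rewrite -aclsZ -aclsD !atmulE -aclsZ -aclsD; apply/clsP.
apply: aeq_trans (aeq_mulDr _ _ _) _; apply: aeq_add; last exact: aeq_refl.
exact: aeq_mulZr.
Qed.

Definition atmulb : bilin tensalg tensalg tensalg :=
  Bilin atmul_linl atmul_linr.

Lemma atmulA : associative atmulb.
Proof.
elim/quotW=> a; elim/quotW=> b; elim/quotW=> c; rewrite /= -!/(acls _) !atmulE.
by apply/clsP; exact: aeq_mulA.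
Qed.
Lemma atmul1l : left_id (acls AOne) atmulb.
Proof.
elim/quotW=> a; rewrite /= -!/(acls _) !atmulE.
by apply/clsP; exact: aeq_mul1l.
Qed.
Lemma atmul1r : right_id (acls AOne) atmulb.
Proof.
elim/quotW=> a; rewrite /= -!/(acls _) !atmulE.
by apply/clsP; exact: aeq_mul1r.
Qed.

Definition tens_algebra : algebra R := MkAlgebra atmulA atmul1l atmul1r.

Local Notation T := tens_algebra.

Fact agen_linear : linear (fun w => acls (AGen w) : T).
Proof.
move=> r v w; rewrite -aclsZ -aclsD; apply/clsP.
apply: aeq_trans (aeq_genD _ _) _.
by apply: aeq_add; [exact: aeq_genZ|exact: aeq_refl].
Qed.

Definition agen : {linear W -> T} := mklin agen_linear.

Lemma tens_algebraW (P : T -> Prop) :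
  (forall w, P (agen w)) -> P (aone T) ->
  P 0 -> (forall x y, P x -> P y -> P (x + y)) -> (forall r x, P x -> P (r *: x)) ->
  (forall x y, P x -> P y -> P (amul T x y)) -> forall x, P x.
Proof.
move=> Pg P1 P0 PD PZ PM; elim/quotW; rewrite -!/(acls _).
elim=> [w||||||] //.
- by have := Pg w; rewrite mklinE.
- by move=> a Pa b Pb; rewrite -/(acls _) aclsD; exact: PD.
- by move=> a Pa; rewrite -/(acls _) aclsN -scaleN1r; exact: PZ.
- by move=> r a Pa; rewrite -/(acls _) aclsZ; exact: PZ.
- by move=> a Pa b Pb; rewrite -/(acls _) -atmulE; exact: PM.
Qed.

Section Lift.
Variables (A : algebra R) (f : {linear W -> A}).

Fixpoint aeval (a : aterm) : A :=
  match a with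
  | AGen w => f w
  | AZero => 0
  | AAdd a b => aeval a + aeval b
  | AOpp a => - aeval a
  | AScale r a => r *: aeval a
  | AOne => aone A
  | AMul a b => amul A (aeval a) (aeval b)
  end.

Lemma aeval_aeq a a' : aeq a a' -> aeval a = aeval a'.
Proof.
elim=> //=.
- by move=> {}a c {}a' _ -> _ ->.
- by move=> {}a {}a' c c' _ -> _ ->.
- by move=> {}a {}a' _ ->.
- by move=> r {}a {}a' _ ->.
- by move=> {}a {}a' c c' _ -> _ ->.
- by move=> *; rewrite addrA.
- by move=> *; rewrite addrC.
- by move=> *; rewrite add0r.
- by move=> *; rewrite addNr.
- by move=> *; rewrite scalerA.
- by move=> *; rewrite scale1r.
- by move=> *; rewrite scalerDr.
- by move=> *; rewrite scalerDl.
- by move=> *; rewrite amulA.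
- by move=> *; rewrite amul1l.
- by move=> *; rewrite amul1r.
- by move=> *; rewrite bilinDl.
- by move=> *; rewrite bilinDr.
- by move=> *; rewrite bilinZl.
- by move=> *; rewrite bilinZr.
- by move=> *; rewrite linearD.
- by move=> *; rewrite linearZ.
Qed.

Definition alift_fun : T -> A := qlift aeval.

Lemma alift_cls a : alift_fun (acls a) = aeval a.
Proof. by apply: qliftE; exact: aeval_aeq. Qed.

Fact alift_linear : linear alift_fun.
Proof.
move=> r; elim/quotW=> a; elim/quotW=> a'; rewrite -!/(acls _).
by rewrite -aclsZ -aclsD !alift_cls.
Qed.

Definition alift : {linear T -> A} := mklin alift_linear.

Lemma alift_gen w : alift (agen w) = f w.
Proof. by rewrite !mklinE alift_cls. Qed.

Lemma alift_algmap : is_algmap alift.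
Proof.
split; first by rewrite mklinE [LHS]alift_cls.
elim/quotW=> a; elim/quotW=> b; rewrite -!/(acls _).
by rewrite !mklinE /= atmulE !alift_cls.
Qed.

End Lift.

Lemma algmap_ext (A : algebra R) (f g : {linear T -> A}) :
  is_algmap f -> is_algmap g -> (forall w, f (agen w) = g (agen w)) -> f =1 g.
Proof.
move=> [f1 fM] [g1 gM] fg; elim/tens_algebraW => //.
- by rewrite f1 g1.
- by rewrite !linear0.
- by move=> x y hx hy; rewrite !linearD hx hy.
- by move=> r x hx; rewrite !linearZ hx.
- by move=> x y hx hy; rewrite fM gM hx hy.
Qed.

(* The Hopf algebra structure for which the elements of W are primitive. *)

Fact aprim_linear :
  linear (fun w => tpure (agen w) (aone T) + tpure (aone T) (agen w)).
Proof.
move=> r v w; rewrite linearP tpureDl tpureZl tpureDr tpureZr scalerDr.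
exact: addrACA.
Qed.

Definition aprim : {linear W -> tens_alg T T} := mklin aprim_linear.
Definition acomul : {linear T -> tens T T} := alift aprim.
Definition acounit : {linear T -> R^o} := @alift (base_alg R) \0.

Lemma acomul_algmap : @is_algmap R T (tens_alg T T) acomul.
Proof. exact: alift_algmap. Qed.

Lemma acounit_algmap : @is_algmap R T (base_alg R) acounit.
Proof. exact: alift_algmap. Qed.

Lemma acomul_gen w :
  acomul (agen w) = tpure (agen w) (aone T) + tpure (aone T) (agen w).
Proof. by rewrite alift_gen mklinE. Qed.

Lemma acomul1 : acomul (aone T) = tpure (aone T) (aone T).
Proof. exact: (proj1 acomul_algmap). Qed.

Lemma acomulM x y : acomul (amul T x y) = tmul T T (acomul x) (acomul y).
Proof. exact: (proj2 acomul_algmap). Qed.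

Lemma acounit_gen w : acounit (agen w) = 0.
Proof. by rewrite [LHS](@alift_gen (base_alg R)). Qed.

Lemma acounit1 : acounit (aone T) = 1.
Proof. exact: (proj1 acounit_algmap). Qed.

Lemma acounitM x y : acounit (amul T x y) = acounit x * acounit y.
Proof. exact: (proj2 acounit_algmap). Qed.

Lemma idfun_algmap (A : algebra R) : @is_algmap R A A idfun.
Proof. by []. Qed.

Lemma acomulA x : tassoc _ _ _ (tmap acomul idfun (acomul x)) =
                  tmap idfun acomul (acomul x).
Proof.
have hl : @is_algmap R T (tens_alg T (tens_alg T T))
    (tassoc _ _ _ \o (tmap acomul idfun \o acomul)).
  apply: (@comp_algmap _ _ (tens_alg (tens_alg T T) T)); last first.
    exact: tassoc_algmap.
  apply: (@comp_algmap _ _ (tens_alg T T)); first exact: acomul_algmap.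
  by apply: tmap_algmap; [exact: acomul_algmap|exact: idfun_algmap].
have hr : @is_algmap R T (tens_alg T (tens_alg T T))
    (tmap idfun acomul \o acomul).
  apply: (@comp_algmap _ _ (tens_alg T T)); first exact: acomul_algmap.
  by apply: tmap_algmap; [exact: idfun_algmap|exact: acomul_algmap].
apply: (algmap_ext hl hr) => w /=.
rewrite acomul_gen !linearD /= !tmapE !acomul_gen !acomul1 /=.
by rewrite !(tpureDl, tpureDr) linearD /= !tassocE addrA.
Qed.

Lemma tunitl_algmap (A : algebra R) :
  @is_algmap R (tens_alg (base_alg R) A) A (tunitl A).
Proof.
split; first by rewrite tunitlE scale1r.
elim/tensW => [|x x' hx hx'|a b] y; first by rewrite !(linear0, bilin0l).
  by rewrite !(linearD, bilinDl) hx hx'.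
elim/tensW: y => [|y y' hy hy'|a' b']; first by rewrite !(linear0, bilin0r).
  by rewrite !(linearD, bilinDr) hy hy'.
by rewrite tmulE !tunitlE bilinZl bilinZr scalerA.
Qed.

Lemma tunitr_algmap (A : algebra R) :
  @is_algmap R (tens_alg A (base_alg R)) A (tunitr A).
Proof.
split; first by rewrite tunitrE scale1r.
elim/tensW => [|x x' hx hx'|a b] y; first by rewrite !(linear0, bilin0l).
  by rewrite !(linearD, bilinDl) hx hx'.
elim/tensW: y => [|y y' hy hy'|a' b']; first by rewrite !(linear0, bilin0r).
  by rewrite !(linearD, bilinDr) hy hy'.
by rewrite tmulE !tunitrE bilinZl bilinZr scalerA.
Qed.

Lemma acomul1l x : tunitl _ (tmap acounit idfun (acomul x)) = x.
Proof.
have h : @is_algmap R T T (tunitl _ \o (tmap acounit idfun \o acomul)).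
  apply: (@comp_algmap _ _ (tens_alg (base_alg R) T)); last first.
    exact: tunitl_algmap.
  apply: (@comp_algmap _ _ (tens_alg T T)); first exact: acomul_algmap.
  by apply: tmap_algmap; [exact: acounit_algmap|exact: idfun_algmap].
apply: (algmap_ext h (idfun_algmap T)) => w /=.
rewrite acomul_gen !linearD /= !tmapE !tunitlE acounit_gen acounit1 /=.
by rewrite scale0r scale1r add0r.
Qed.

Lemma acomul1r x : tunitr _ (tmap idfun acounit (acomul x)) = x.
Proof.
have h : @is_algmap R T T (tunitr _ \o (tmap idfun acounit \o acomul)).
  apply: (@comp_algmap _ _ (tens_alg T (base_alg R))); last first.
    exact: tunitr_algmap.
  apply: (@comp_algmap _ _ (tens_alg T T)); first exact: acomul_algmap.
  by apply: tmap_algmap; [exact: idfun_algmap|exact: acounit_algmap].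
apply: (algmap_ext h (idfun_algmap T)) => w /=.
rewrite acomul_gen !linearD /= !tmapE !tunitrE acounit_gen acounit1 /=.
by rewrite scale0r scale1r addr0.
Qed.

Definition tens_coalgebra : coalgebra R :=
  @MkCoalgebra R T acomul acounit acomulA acomul1l acomul1r.

Definition antipode : {linear T -> T} := @alift (op_alg T) (\- agen).

End TensorAlgebra.

Section Coalgebras.
Variable R : comPzRingType.
Implicit Types C D : coalgebra R.

Lemma tpure0l (M N : lmodType R) (n : N) : tpure (0 : M) n = 0.
Proof. exact: (bilin0l (tpureb M N)). Qed.
Lemma tpure0r (M N : lmodType R) (m : M) : tpure m (0 : N) = 0.
Proof. exact: (bilin0r (tpureb M N)). Qed.

Fact base_comul_linear : linear (fun r : R^o => (r : R) *: tpure (1 : R^o) (1 : R^o)).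
Proof. by move=> r s t; rewrite scalerDl -scalerA. Qed.

Definition base_comul : {linear R^o -> tens R^o R^o} := mklin base_comul_linear.

Lemma base_comulE (r : R) :
  base_comul r = r *: tpure (1 : R^o) (1 : R^o).
Proof. exact: mklinE. Qed.

Fact base_comulA x : tassoc _ _ _ (tmap base_comul idfun (base_comul x)) =
                     tmap idfun base_comul (base_comul x).
Proof.
rewrite base_comulE !(linearZ, tmapE) /= base_comulE scale1r.
by rewrite ?linearZ ?tassocE.
Qed.

Fact base_comul1l x : tunitl _ (tmap idfun idfun (base_comul x)) = x.
Proof. by rewrite tmap_id base_comulE linearZ /= tunitlE scale1r [LHS]mulr1. Qed.

Fact base_comul1r x : tunitr _ (tmap idfun idfun (base_comul x)) = x.
Proof. by rewrite tmap_id base_comulE linearZ /= tunitrE scale1r [LHS]mulr1. Qed.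

Definition base_coalg : coalgebra R :=
  @MkCoalgebra R R^o base_comul idfun base_comulA base_comul1l base_comul1r.

Section CotensDef.
Variables C D : coalgebra R.

Definition cotens_comul :
    {linear tens C D -> tens (tens C D) (tens C D)} :=
  tinter C C D D \o tmap (comul C) (comul D).

Definition cotens_counit : {linear tens C D -> R^o} :=
  tunitl R^o \o tmap (counit C) (counit D).

Lemma cotens_comulE c d :
  cotens_comul (tpure c d) = tinter C C D D (tpure (comul C c) (comul D d)).
Proof. by rewrite /= tmapE. Qed.

Lemma cotens_counitE c d :
  cotens_counit (tpure c d) = counit C c * counit D d.
Proof. by rewrite /= tmapE tunitlE. Qed.

Fact cotens_assoc1 (U : tens C C) (U' : tens D D) c c' :
  tassoc (tens C D) (tens C D) (tens C D) (tpure (tinter C C D D (tpure U U')) (tpure c c')) =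
  tmap idfun (tinter C C D D) (tinter C (tens C C) D (tens D D)
     (tpure (tassoc C C C (tpure U c)) (tassoc D D D (tpure U' c')))).
Proof.
elim/tensW: U => [|x y hx hy|p q]; first by rewrite !(tpure0l, linear0).
  by rewrite !(tpureDl, linearD) /= hx hy.
elim/tensW: U' => [|x y hx hy|p' q'].
- by rewrite tpure0r tpure0l !linear0 tpure0l tpure0r !linear0.
- by rewrite tpureDr !linearD /= !tpureDl !linearD /= tpureDr !linearD /= hx hy.
by rewrite !tassocE !tinterE tmapE tassocE tinterE.
Qed.

Fact cotens_assoc2 (X : tens C C) (Y : tens D D) :
  tassoc _ _ _ (tmap cotens_comul idfun (tinter C C D D (tpure X Y))) =
  tmap idfun (tinter C C D D) (tinter C (tens C C) D (tens D D)
     (tpure (tassoc _ _ _ (tmap (comul C) idfun X))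
            (tassoc _ _ _ (tmap (comul D) idfun Y)))).
Proof.
elim/tensW: X => [|x y hx hy|a c]; first by rewrite !(tpure0l, linear0).
  by rewrite !(tpureDl, linearD) /= hx hy.
elim/tensW: Y => [|x y hx hy|a' c'].
- by rewrite !(linear0, tpure0r).
- by rewrite !(tpureDr, linearD) /= hx hy.
by rewrite tinterE !tmapE cotens_comulE cotens_assoc1.
Qed.

Fact cotens_assoc3 (X : tens C C) (Y : tens D D) :
  tmap idfun cotens_comul (tinter C C D D (tpure X Y)) =
  tmap idfun (tinter C C D D) (tinter C (tens C C) D (tens D D)
     (tpure (tmap idfun (comul C) X) (tmap idfun (comul D) Y))).
Proof.
elim/tensW: X => [|x y hx hy|a c]; first by rewrite !(tpure0l, linear0).
  by rewrite !(tpureDl, linearD) /= hx hy.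
elim/tensW: Y => [|x y hx hy|a' c'].
- by rewrite !(linear0, tpure0r).
- by rewrite !(tpureDr, linearD) /= hx hy.
by rewrite tinterE !tmapE cotens_comulE tinterE tmapE.
Qed.

Fact cotens_comulA x :
  tassoc _ _ _ (tmap cotens_comul idfun (cotens_comul x)) =
  tmap idfun cotens_comul (cotens_comul x).
Proof.
elim/tensW: x => [|x y hx hy|c d]; first by rewrite !linear0.
  by rewrite !linearD hx hy.
by rewrite cotens_comulE cotens_assoc2 !comulA cotens_assoc3.
Qed.

Fact cotens_counit_l (X : tens C C) (Y : tens D D) :
  tunitl _ (tmap cotens_counit idfun (tinter C C D D (tpure X Y))) =
  tpure (tunitl _ (tmap (counit C) idfun X)) (tunitl _ (tmap (counit D) idfun Y)).
Proof.
elim/tensW: X => [|x y hx hy|a c]; first by rewrite !(tpure0l, linear0).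
  by rewrite !(tpureDl, linearD) /= hx hy.
elim/tensW: Y => [|x y hx hy|a' c'].
- by rewrite !(linear0, tpure0r).
- by rewrite !(tpureDr, linearD) /= hx hy.
by rewrite tinterE !tmapE cotens_counitE !tunitlE tpureZl tpureZr scalerA.
Qed.

Fact cotens_counit_r (X : tens C C) (Y : tens D D) :
  tunitr _ (tmap idfun cotens_counit (tinter C C D D (tpure X Y))) =
  tpure (tunitr _ (tmap idfun (counit C) X)) (tunitr _ (tmap idfun (counit D) Y)).
Proof.
elim/tensW: X => [|x y hx hy|a c]; first by rewrite !(tpure0l, linear0).
  by rewrite !(tpureDl, linearD) /= hx hy.
elim/tensW: Y => [|x y hx hy|a' c'].
- by rewrite !(linear0, tpure0r).
- by rewrite !(tpureDr, linearD) /= hx hy.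
by rewrite tinterE !tmapE cotens_counitE !tunitrE tpureZl tpureZr scalerA.
Qed.

Fact cotens_comul1l x :
  tunitl _ (tmap cotens_counit idfun (cotens_comul x)) = x.
Proof.
elim/tensW: x => [|x y hx hy|c d]; first by rewrite !linear0.
  by rewrite !linearD hx hy.
by rewrite cotens_comulE cotens_counit_l !comul1l.
Qed.

Fact cotens_comul1r x :
  tunitr _ (tmap idfun cotens_counit (cotens_comul x)) = x.
Proof.
elim/tensW: x => [|x y hx hy|c d]; first by rewrite !linear0.
  by rewrite !linearD hx hy.
by rewrite cotens_comulE cotens_counit_r !comul1r.
Qed.

Definition cotens : coalgebra R :=
  @MkCoalgebra R (tens C D) cotens_comul cotens_counit
    cotens_comulA cotens_comul1l cotens_comul1r.

Fact tswap_tinter (X : tens C C) (Y : tens D D) :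
  tswap _ _ (tinter C C D D (tpure X Y)) =
  tinter C C D D (tpure (tswap _ _ X) (tswap _ _ Y)).
Proof.
elim/tensW: X => [|x y hx hy|a c]; first by rewrite !(tpure0l, linear0).
  by rewrite !(tpureDl, linearD) /= hx hy.
elim/tensW: Y => [|x y hx hy|a' c'].
- by rewrite !(linear0, tpure0r).
- by rewrite !(tpureDr, linearD) /= hx hy.
by rewrite !tswapE !tinterE tswapE.
Qed.

Lemma cotens_cocommutative :
  cocommutative C -> cocommutative D -> cocommutative cotens.
Proof.
move=> hC hD; elim/tensW=> [|x y hx hy|c d]; first by rewrite !linear0.
  by rewrite !linearD hx hy.
by rewrite [comul cotens _]cotens_comulE tswap_tinter hC hD.
Qed.

End CotensDef.

Lemma tmap_coalgmap C C' D D' (f : {linear C -> C'}) (g : {linear D -> D'}) :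
  is_coalgmap f -> is_coalgmap g ->
  @is_coalgmap R (cotens C D) (cotens C' D') (tmap f g).
Proof.
move=> [fM f1] [gM g1]; split; last first.
  elim/tensW=> [|x y hx hy|c d]; first by rewrite !linear0.
    by rewrite !linearD hx hy.
  by rewrite tmapE [LHS]cotens_counitE [RHS]cotens_counitE f1 g1.
elim/tensW=> [|x y hx hy|c d]; first by rewrite !linear0.
  by rewrite !linearD hx hy.
rewrite tmapE [LHS]cotens_comulE [X in tmap _ _ X]cotens_comulE fM gM.
elim/tensW: (comul C c) => [|x y hx hy|a b].
- by rewrite !(tpure0l, linear0).
- by rewrite !(tpureDl, linearD) /= hx hy.
elim/tensW: (comul D d) => [|x y hx hy|a' b'].
- by rewrite !(tpure0r, linear0).
- by rewrite !(tpureDr, linearD) /= hx hy.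
by rewrite !tmapE !tinterE !tmapE.
Qed.

Lemma idfun_coalgmap C : @is_coalgmap R C C idfun.
Proof. by split=> // x; rewrite tmap_id. Qed.

Lemma base_cocommutative : cocommutative base_coalg.
Proof. by move=> x; rewrite /= base_comulE linearZ /= tswapE. Qed.

Fixpoint cotens_pow C (n : nat) : coalgebra R :=
  if n is n'.+1 then cotens (cotens_pow C n') C else base_coalg.

Fixpoint cotens_pow_map C D (f : {linear C -> D}) (n : nat) :
    {linear cotens_pow C n -> cotens_pow D n} :=
  match n with
  | 0 => idfun
  | n'.+1 => tmap (cotens_pow_map f n') f
  end.

Lemma cotens_pow_cocommutative C n :
  cocommutative C -> cocommutative (cotens_pow C n).
Proof.
move=> hC; elim: n => [|n IH]; first exact: base_cocommutative.
exact: cotens_cocommutative.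
Qed.

Lemma cotens_pow_map_coalgmap C D (f : {linear C -> D}) n :
  is_coalgmap f -> is_coalgmap (cotens_pow_map f n).
Proof.
move=> hf; elim: n => [|n IH]; first exact: (idfun_coalgmap base_coalg).
exact: tmap_coalgmap.
Qed.

(* C(V) = R (+) V with the elements of V primitive *)
Section PrimitiveCoalgebra.
Variable V : lmodType R.

Local Notation C := (R^o * V)%type.

Definition pone : C := (1 : R^o, 0).
Definition pinj (v : V) : C := (0, v).

Fact prim_comul_linear : linear (fun x : C =>
  (x.1 : R) *: tpure pone pone + (tpure (pinj x.2) pone + tpure pone (pinj x.2))).
Proof.
move=> r x y /=.
have -> : pinj (r *: x.2 + y.2) = r *: pinj x.2 + pinj y.2.
  by congr pair; rewrite /= scaler0 addr0.
rewrite tpureDl tpureZl tpureDr tpureZr scalerDl -scalerA !scalerDr.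
by rewrite (addrACA (r *: tpure (pinj x.2) pone)) [LHS]addrACA.
Qed.

Definition prim_comul : {linear C -> tens C C} := mklin prim_comul_linear.

Fact prim_counit_linear : linear (fun x : C => x.1).
Proof. by []. Qed.

Definition prim_counit : {linear C -> R^o} := mklin prim_counit_linear.

Lemma prim_comul1 : prim_comul pone = tpure pone pone.
Proof. by rewrite mklinE /= scale1r -[pinj 0]/(0 : C) tpure0l tpure0r !addr0. Qed.

Lemma prim_comul_inj v :
  prim_comul (pinj v) = tpure (pinj v) pone + tpure pone (pinj v).
Proof. by rewrite mklinE /= scale0r add0r. Qed.

Lemma prim_counit1 : prim_counit pone = 1.
Proof. by rewrite mklinE. Qed.

Lemma prim_counit_inj v : prim_counit (pinj v) = 0.
Proof. by rewrite mklinE. Qed.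

Lemma prim_split (x : C) : x = (x.1 : R) *: pone + pinj x.2.
Proof.
by case: x => r v; congr pair; rewrite /= ?scaler0 ?add0r // [_ *: _]mulr1 addr0.
Qed.

Lemma prim_ext (M : lmodType R) (f g : {linear C -> M}) :
  f pone = g pone -> (forall v, f (pinj v) = g (pinj v)) -> f =1 g.
Proof. by move=> h1 h x; rewrite (prim_split x) !linearP h1 h. Qed.

Fact prim_comulA x : tassoc _ _ _ (tmap prim_comul idfun (prim_comul x)) =
                     tmap idfun prim_comul (prim_comul x).
Proof.
apply: (@prim_ext _ (tassoc _ _ _ \o (tmap prim_comul idfun \o prim_comul))
  (tmap idfun prim_comul \o prim_comul)) => [|v] /=.
  by rewrite prim_comul1 !tmapE prim_comul1 tassocE.
rewrite prim_comul_inj !linearD /= !tmapE prim_comul_inj prim_comul1 /=.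
by rewrite tpureDl tpureDr linearD /= !tassocE addrA.
Qed.

Fact prim_comul1l x : tunitl _ (tmap prim_counit idfun (prim_comul x)) = x.
Proof.
apply: (@prim_ext _ (tunitl _ \o (tmap prim_counit idfun \o prim_comul))
  idfun) => [|v] /=.
  by rewrite prim_comul1 tmapE tunitlE prim_counit1 scale1r.
rewrite prim_comul_inj !linearD /= !tmapE !tunitlE prim_counit1 prim_counit_inj.
by rewrite scale0r scale1r add0r.
Qed.

Fact prim_comul1r x : tunitr _ (tmap idfun prim_counit (prim_comul x)) = x.
Proof.
apply: (@prim_ext _ (tunitr _ \o (tmap idfun prim_counit \o prim_comul))
  idfun) => [|v] /=.
  by rewrite prim_comul1 tmapE tunitrE prim_counit1 scale1r.
rewrite prim_comul_inj !linearD /= !tmapE !tunitrE prim_counit1 prim_counit_inj.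
by rewrite scale0r scale1r addr0.
Qed.

Definition prim_coalg : coalgebra R :=
  @MkCoalgebra R C prim_comul prim_counit prim_comulA prim_comul1l prim_comul1r.

Lemma prim_cocommutative : cocommutative prim_coalg.
Proof.
apply: (@prim_ext _ (tswap _ _ \o prim_comul) prim_comul) => [|v] /=.
  by rewrite prim_comul1 tswapE.
by rewrite prim_comul_inj linearD /= !tswapE addrC.
Qed.

End PrimitiveCoalgebra.

Section PrimitiveMap.
Variables (V W : lmodType R) (phi : {linear V -> W}).

Fact prim_map_linear :
  linear (fun x : prim_coalg V => (x.1, phi x.2) : prim_coalg W).
Proof. by move=> r x y; congr pair; rewrite linearP. Qed.

Definition prim_map : {linear prim_coalg V -> prim_coalg W} :=
  mklin prim_map_linear.

Lemma prim_map1 : prim_map (pone V) = pone W.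
Proof. by rewrite mklinE /= linear0. Qed.

Lemma prim_map_inj v : prim_map (pinj v) = pinj (phi v).
Proof. by rewrite mklinE. Qed.

Lemma prim_map_coalgmap : is_coalgmap prim_map.
Proof.
split; last by move=> x; rewrite /= !mklinE.
apply: (@prim_ext V _ (prim_comul W \o prim_map)
  (tmap prim_map prim_map \o prim_comul V)) => [|v] /=.
  by rewrite prim_comul1 tmapE prim_map1 prim_comul1.
rewrite prim_map_inj !prim_comul_inj linearD /= !tmapE.
by rewrite prim_map1 prim_map_inj.
Qed.

End PrimitiveMap.

(* V^{(x) k}, which is the module underlying V^{/\ k}. *)
Fixpoint tens_pow (V : lmodType R) (k : nat) : lmodType R :=
  if k is k'.+1 then tens (tens_pow V k') V else R^o.

Fixpoint tens_pow_map (V W : lmodType R) (phi : {linear V -> W}) (k : nat) :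
    {linear tens_pow V k -> tens_pow W k} :=
  match k with
  | 0 => idfun
  | k'.+1 => tmap (tens_pow_map phi k') phi
  end.

Definition tens_algebra_map (V W : lmodType R) (phi : {linear V -> W}) :
    {linear tens_algebra V -> tens_algebra W} :=
  @alift _ _ (tens_algebra W) (agen W \o phi).

Lemma tens_algebra_map_algmap (V W : lmodType R) (phi : {linear V -> W}) :
  is_algmap (tens_algebra_map phi).
Proof. exact: alift_algmap. Qed.

Lemma tens_algebra_map_gen (V W : lmodType R) (phi : {linear V -> W}) v :
  tens_algebra_map phi (agen V v) = agen W (phi v).
Proof. exact: (alift_gen (A := tens_algebra W)). Qed.

End Coalgebras.

Section Convolution.
Variables (R : comPzRingType) (C : coalgebra R).

Definition conv (A : algebra R) (f g : {linear C -> A}) : {linear C -> A} :=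
  mulmap A \o (tmap f g \o comul C).

Fact conv_one_linear (A : algebra R) :
  linear (fun x : C => (counit C x : R) *: aone A).
Proof. by move=> r x y; rewrite linearP scalerDl -scalerA. Qed.

Definition conv_one (A : algebra R) : {linear C -> A} :=
  mklin (conv_one_linear A).

Lemma conv_oneE (A : algebra R) x : conv_one A x = (counit C x : R) *: aone A.
Proof. exact: mklinE. Qed.

Lemma convA (A : algebra R) : associative (@conv A).
Proof.
move=> f g h; apply: linear_ext => x /=; symmetry.
have e (X : tens (tens C C) C) :
    mulmap A (tmap (mulmap A \o tmap f g) h X) =
    mulmap A (tmap f (mulmap A \o tmap g h) (tassoc C C C X)).
  elim/tensW: X => [|y z hy hz|U c]; first by rewrite !linear0.
    by rewrite !linearD hy hz.
  elim/tensW: U => [|y z hy hz|a b]; first by rewrite !(tpure0l, linear0).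
    by rewrite !(tpureDl, linearD) /= hy hz.
  by rewrite tassocE !tmapE /= !tmapE !mulmapE amulA.
have := e (tmap (comul C) idfun (comul C x)).
rewrite comulA !tmap_comp => {}e.
transitivity (mulmap A (tmap ((mulmap A \o tmap f g) \o comul C) (h \o idfun)
  (comul C x))).
  by congr (mulmap A _); apply: eq_tmap.
by rewrite e; congr (mulmap A _); apply: eq_tmap.
Qed.

Lemma conv1l (A : algebra R) : left_id (conv_one A) (@conv A).
Proof.
move=> f; apply: linear_ext => x; rewrite -[in RHS](comul1l x) /=.
elim/tensW: (comul C x) => [|y z hy hz|a b]; first by rewrite !linear0.
  by rewrite !linearD hy hz.
by rewrite !tmapE mulmapE tunitlE conv_oneE bilinZl amul1l linearZ.
Qed.

Lemma conv1r (A : algebra R) : right_id (conv_one A) (@conv A).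
Proof.
move=> f; apply: linear_ext => x; rewrite -[in RHS](comul1r x) /=.
elim/tensW: (comul C x) => [|y z hy hz|a b]; first by rewrite !linear0.
  by rewrite !linearD hy hz.
by rewrite !tmapE mulmapE tunitrE conv_oneE bilinZr amul1r linearZ.
Qed.

Lemma conv_comm (A : algebra R) (f g : {linear C -> A}) :
  cocommutative C -> (forall a b, amul A (f a) (g b) = amul A (g b) (f a)) ->
  conv f g = conv g f.
Proof.
move=> hC fg; apply: linear_ext => x; rewrite /= -[in RHS]hC.
elim/tensW: (comul C x) => [|y z hy hz|a b]; first by rewrite !linear0.
  by rewrite !linearD hy hz.
by rewrite tswapE !tmapE !mulmapE fg.
Qed.

Lemma conv_postcomp (A B : algebra R) (phi : {linear A -> B})
    (f g : {linear C -> A}) :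
  is_algmap phi ->
  (phi \o conv f g : {linear C -> B}) =
  conv (phi \o f : {linear C -> B}) (phi \o g : {linear C -> B}).
Proof.
move=> [_ phiM]; apply: linear_ext => x /=.
elim/tensW: (comul C x) => [|y z hy hz|a b]; first by rewrite !linear0.
  by rewrite !linearD hy hz.
by rewrite !tmapE !mulmapE phiM.
Qed.

Lemma conv_one_postcomp (A B : algebra R) (phi : {linear A -> B}) :
  is_algmap phi -> (phi \o conv_one A : {linear C -> B}) = conv_one B.
Proof.
by move=> [phi1 _]; apply: linear_ext => x; rewrite /= !conv_oneE linearZ phi1.
Qed.

End Convolution.

Lemma conv_precomp (R : comPzRingType) (C D : coalgebra R) (A : algebra R)
    (h : {linear C -> D}) (f g : {linear D -> A}) :
  is_coalgmap h ->
  (conv f g \o h : {linear C -> A}) =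
  conv (f \o h : {linear C -> A}) (g \o h : {linear C -> A}).
Proof.
move=> [hM _]; apply: linear_ext => x; rewrite /= hM tmap_comp //.
Qed.

Section ConvolutionGroup.
Variables (R : comPzRingType) (C : coalgebra R) (W : lmodType R).
Hypothesis hC : cocommutative C.

Local Notation T := (tens_algebra W).
Local Notation TT := (tens_alg T T).
Implicit Types f g : {linear C -> T}.

Definition inj1 : {linear T -> TT} := mklin (tpure_linl (aone T)).
Definition inj2 : {linear T -> TT} := mklin (tpure_linr (aone T)).

Lemma inj1E x : inj1 x = tpure x (aone T). Proof. exact: mklinE. Qed.
Lemma inj2E x : inj2 x = tpure (aone T) x. Proof. exact: mklinE. Qed.

Lemma inj1_algmap : is_algmap inj1.
Proof. by split=> [|x y]; rewrite !inj1E // tmulE amul1l. Qed.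
Lemma inj2_algmap : is_algmap inj2.
Proof. by split=> [|x y]; rewrite !inj2E // tmulE amul1l. Qed.

Definition double f : {linear C -> TT} :=
  conv (inj1 \o f : {linear C -> TT}) (inj2 \o f : {linear C -> TT}).

Lemma doubleE f x : double f x = tmap f f (comul C x).
Proof.
rewrite /=; elim/tensW: (comul C x) => [|y z hy hz|a b]; first by rewrite !linear0.
  by rewrite !linearD hy hz.
rewrite !tmapE mulmapE [X in amul _ X _]inj1E [X in amul _ _ X]inj2E.
by rewrite [LHS]tmulE amul1l amul1r.
Qed.

Lemma coalgmapP f : @is_coalgmap R C (tens_coalgebra W) f <->
  (acomul W \o f : {linear C -> TT}) = double f /\
  (acounit W \o f : {linear C -> base_alg R}) = conv_one C (base_alg R).
Proof.
split=> [[fM f1]|[fM f1]]; split.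
- by apply: linear_ext => x; rewrite doubleE -fM.
- apply: linear_ext => x; rewrite conv_oneE [LHS]/= [LHS]f1.
  by rewrite [RHS]mulr1.
- by move=> x; rewrite -doubleE -fM.
- move=> x; have /= := congr1 (fun h : {linear C -> base_alg R} => h x) f1.
  by rewrite conv_oneE => ->; rewrite [LHS]mulr1.
Qed.

Lemma inj12_comm (a b : T) :
  amul TT (inj2 a) (inj1 b) = amul TT (inj1 b) (inj2 a).
Proof. by rewrite inj1E inj2E !tmulE !amul1l !amul1r. Qed.

Lemma double_conv f g : double (conv f g) = conv (double f) (double g).
Proof.
rewrite /double (conv_postcomp _ _ inj1_algmap) (conv_postcomp _ _ inj2_algmap).
rewrite -!convA; congr conv; rewrite !convA; congr conv.
by apply: conv_comm => // a b; exact: esym (inj12_comm _ _).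
Qed.

Lemma conv_coalgmap f g :
  @is_coalgmap R C (tens_coalgebra W) f ->
  @is_coalgmap R C (tens_coalgebra W) g ->
  @is_coalgmap R C (tens_coalgebra W) (conv f g).
Proof.
move=> /coalgmapP[fM f1] /coalgmapP[gM g1]; apply/coalgmapP; split.
  by rewrite (conv_postcomp _ _ (acomul_algmap W)) fM gM double_conv.
by rewrite (conv_postcomp _ _ (acounit_algmap W)) f1 g1 conv1l.
Qed.

Lemma double_one : double (conv_one C T) = conv_one C TT.
Proof.
rewrite /double (conv_one_postcomp _ inj1_algmap).
by rewrite (conv_one_postcomp _ inj2_algmap) conv1l.
Qed.

Lemma conv_one_coalgmap :
  @is_coalgmap R C (tens_coalgebra W) (conv_one C T).
Proof.
apply/coalgmapP; split; last exact: (conv_one_postcomp _ (acounit_algmap W)).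
by rewrite double_one (conv_one_postcomp _ (acomul_algmap W)).
Qed.

Lemma antipode_gen w : antipode W (agen W w) = - agen W w.
Proof. exact: (alift_gen (A := op_alg T)). Qed.

Lemma antipode_algmap : @is_algmap R T (op_alg T) (antipode W).
Proof. exact: alift_algmap. Qed.

Lemma antipode1 : antipode W (aone T) = aone T.
Proof. exact: (proj1 antipode_algmap). Qed.

Lemma antipodeM x y :
  antipode W (amul T x y) = amul T (antipode W y) (antipode W x).
Proof. exact: (proj2 antipode_algmap). Qed.

Lemma antipodel (x : T) :
  mulmap T (tmap (antipode W) idfun (acomul W x)) = (acounit W x : R) *: aone T.
Proof.
elim/tens_algebraW: x => [w|||x y hx hy|r x hx|x y hx hy].
- rewrite acomul_gen linearD linearD /= !tmapE !mulmapE antipode_gen antipode1.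
  by rewrite amul1l amul1r acounit_gen scale0r addNr.
- by rewrite acomul1 tmapE mulmapE antipode1 amul1l acounit1 scale1r.
- by rewrite !linear0 scale0r.
- by rewrite !linearD hx hy scalerDl.
- by rewrite !linearZ /= hx scalerA.
rewrite acomulM acounitM -scalerA -{}hy.
elim/tensW: (acomul W y) => [|z t hz ht|a b].
- by rewrite bilin0r !linear0 ?scaler0.
- by rewrite bilinDr !linearD hz ht ?scalerDr.
have e X : mulmap T (tmap (antipode W) idfun (tmul T T X (tpure a b))) =
    amul T (antipode W a) (amul T (mulmap T (tmap (antipode W) idfun X)) b).
  elim/tensW: X => [|z t hz ht|c d].
  - by rewrite bilin0l !linear0 bilin0l bilin0r.
  - by rewrite bilinDl !linearD hz ht bilinDl bilinDr.
  by rewrite tmulE !tmapE !mulmapE antipodeM /idfun !amulA.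
by rewrite e hx bilinZl amul1l bilinZr tmapE mulmapE.
Qed.

Lemma antipoder (x : T) :
  mulmap T (tmap idfun (antipode W) (acomul W x)) = (acounit W x : R) *: aone T.
Proof.
elim/tens_algebraW: x => [w|||x y hx hy|r x hx|x y hx hy].
- rewrite acomul_gen linearD linearD /= !tmapE !mulmapE antipode_gen antipode1.
  by rewrite amul1l amul1r acounit_gen scale0r addrN.
- by rewrite acomul1 tmapE mulmapE antipode1 amul1l acounit1 scale1r.
- by rewrite !linear0 scale0r.
- by rewrite !linearD hx hy scalerDl.
- by rewrite !linearZ /= hx scalerA.
rewrite acomulM acounitM mulrC -scalerA -{}hx.
elim/tensW: (acomul W x) => [|z t hz ht|a b].
- by rewrite bilin0l !linear0 ?scaler0.
- by rewrite bilinDl !linearD hz ht ?scalerDr.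
have e X : mulmap T (tmap idfun (antipode W) (tmul T T (tpure a b) X)) =
    amul T a (amul T (mulmap T (tmap idfun (antipode W) X)) (antipode W b)).
  elim/tensW: X => [|z t hz ht|c d].
  - by rewrite bilin0r !linear0 bilin0l bilin0r.
  - by rewrite bilinDr !linearD hz ht bilinDl bilinDr.
  by rewrite tmulE !tmapE !mulmapE antipodeM /idfun !amulA.
by rewrite e hy bilinZl amul1l bilinZr tmapE mulmapE.
Qed.

Definition conv_inv f : {linear C -> T} := antipode W \o f.

Lemma conv_invl f : @is_coalgmap R C (tens_coalgebra W) f ->
  conv (conv_inv f) f = conv_one C T.
Proof.
move=> [fM f1]; apply: linear_ext => x; rewrite conv_oneE -f1 -[RHS]antipodel.
by rewrite [acomul W _]fM tmap_comp /=; congr (mulmap T _); apply: eq_tmap.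
Qed.

Lemma conv_invr f : @is_coalgmap R C (tens_coalgebra W) f ->
  conv f (conv_inv f) = conv_one C T.
Proof.
move=> [fM f1]; apply: linear_ext => x; rewrite conv_oneE -f1 -[RHS]antipoder.
by rewrite [acomul W _]fM tmap_comp /=; congr (mulmap T _); apply: eq_tmap.
Qed.

Lemma conv_inv_uniq (A : algebra R) (f g h : {linear C -> A}) :
  conv g f = conv_one C A -> conv f h = conv_one C A -> g = h.
Proof. by move=> gf fh; rewrite -[g]conv1r -fh convA gf conv1l. Qed.

Lemma conv_inv_coalgmap f : @is_coalgmap R C (tens_coalgebra W) f ->
  @is_coalgmap R C (tens_coalgebra W) (conv_inv f).
Proof.
move=> hf; have /coalgmapP[fM f1] := hf; apply/coalgmapP; split.
  apply: (@conv_inv_uniq _ (acomul W \o f : {linear C -> TT})).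
    rewrite -(conv_postcomp _ _ (acomul_algmap W)) conv_invl //.
    exact: (conv_one_postcomp _ (acomul_algmap W)).
  by rewrite fM -double_conv conv_invr // double_one.
apply: (@conv_inv_uniq _ (acounit W \o f : {linear C -> base_alg R})).
  rewrite -(conv_postcomp _ _ (acounit_algmap W)) conv_invl //.
  exact: (conv_one_postcomp _ (acounit_algmap W)).
by rewrite f1 conv1l.
Qed.

End ConvolutionGroup.

Lemma antipode_natural (R : comPzRingType) (V W : lmodType R)
    (phi : {linear V -> W}) x :
  antipode W (tens_algebra_map phi x) = tens_algebra_map phi (antipode V x).
Proof.
have [p1 pM] := tens_algebra_map_algmap phi.
apply: (@algmap_ext _ _ (op_alg (tens_algebra W))
  (antipode W \o tens_algebra_map phi) (tens_algebra_map phi \o antipode V)).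
- by split=> [|y z] /=; rewrite ?p1 ?antipode1 // pM antipodeM.
- by split=> [|y z] /=; rewrite ?antipode1 ?p1 // antipodeM pM.
by move=> v /=; rewrite tens_algebra_map_gen !antipode_gen linearN /= tens_algebra_map_gen.
Qed.

Definition is_basis (R : comPzRingType) (V : lmodType R) (B : pred V) : Prop :=
  (forall v, exists (s : seq V) (c : V -> R),
     all B s /\ v = \sum_(b <- s) c b *: b) /\
  (forall (s : seq V) (c : V -> R), uniq s -> all B s ->
     \sum_(b <- s) c b *: b = 0 -> {in s, forall b, c b = 0}).

Record freeModType (R : comPzRingType) := FreeMod {
  free_sort :> lmodType R;
  free_basis : exists B : pred free_sort, is_basis B }.

Section NaturalCoalgebraMaps.
Variables (R : comPzRingType) (k : nat).
Implicit Types V W : freeModType R.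

Definition CVpow (V : lmodType R) (n : nat) : coalgebra R :=
  cotens_pow (prim_coalg V) n.
Definition CVpow_map (V W : lmodType R) (phi : {linear V -> W}) (n : nat) :
  {linear CVpow V n -> CVpow W n} := cotens_pow_map (prim_map phi) n.

Definition TVwedge (V : lmodType R) : coalgebra R :=
  tens_coalgebra (tens_pow V k).
Definition TVwedge_map (V W : lmodType R) (phi : {linear V -> W}) :
  {linear TVwedge V -> TVwedge W} := tens_algebra_map (tens_pow_map phi k).

Lemma CVpow_cocommutative V n : cocommutative (CVpow V n).
Proof. by apply: cotens_pow_cocommutative; exact: prim_cocommutative. Qed.

Lemma CVpow_map_coalgmap V W (phi : {linear V -> W}) n :
  is_coalgmap (CVpow_map phi n).
Proof. by apply: cotens_pow_map_coalgmap; exact: prim_map_coalgmap. Qed.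

Record Coalg (n : nat) := MkCoalg {
  coalg_fun :> forall V, {linear CVpow V n -> TVwedge V};
  coalg_coalgmap : forall V, is_coalgmap (coalg_fun V);
  coalg_natural : forall V W (phi : {linear V -> W}) x,
    coalg_fun W (CVpow_map phi n x) = TVwedge_map phi (coalg_fun V x) }.

Section FixedN.
Variable n : nat.

Lemma Coalg_ext (f g : Coalg n) : (forall V, f V =1 g V) -> f = g.
Proof.
case: f g => [f hf nf] [g hg ng] /= fg.
have e : f = g.
  by apply: functional_extensionality_dep => V; exact: linear_ext (fg V).
by subst g; congr MkCoalg; exact: Prop_irrelevance.
Qed.

Fact Coalg_mul_coalgmap (f g : Coalg n) V :
  @is_coalgmap R (CVpow V n) (TVwedge V)
    (@conv R (CVpow V n) (tens_algebra (tens_pow V k)) (f V) (g V)).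
Proof.
by apply: (conv_coalgmap (@CVpow_cocommutative V n)); exact: coalg_coalgmap.
Qed.

Fact Coalg_mul_natural (f g : Coalg n) V W (phi : {linear V -> W}) x :
  @conv R (CVpow W n) (tens_algebra (tens_pow W k)) (f W) (g W)
    (CVpow_map phi n x) =
  TVwedge_map phi
    (@conv R (CVpow V n) (tens_algebra (tens_pow V k)) (f V) (g V) x).
Proof.
have hphi := tens_algebra_map_algmap (tens_pow_map phi k).
have hs := CVpow_map_coalgmap phi n.
pose A := tens_algebra (tens_pow W k).
have := congr1 (fun h : {linear CVpow V n -> A} => h x)
  (@conv_precomp R _ _ A _ (f W) (g W) hs).
have := congr1 (fun h : {linear CVpow V n -> A} => h x)
  (@conv_postcomp R _ _ A _ (f V) (g V) hphi).
move=> /= e1 e2; rewrite [RHS]e1 [LHS]e2 /=; congr (mulmap A _).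
by apply: eq_tmap => y /=; rewrite coalg_natural.
Qed.

Definition Coalg_mul (f g : Coalg n) : Coalg n :=
  @MkCoalg n
    (fun V => @conv R (CVpow V n) (tens_algebra (tens_pow V k)) (f V) (g V))
    (Coalg_mul_coalgmap f g) (Coalg_mul_natural f g).

Fact Coalg_one_natural V W (phi : {linear V -> W}) x :
  conv_one (CVpow W n) (tens_algebra (tens_pow W k)) (CVpow_map phi n x) =
  TVwedge_map phi (conv_one (CVpow V n) (tens_algebra (tens_pow V k)) x).
Proof.
rewrite !conv_oneE /TVwedge_map linearZ.
have [-> _] := tens_algebra_map_algmap (tens_pow_map phi k).
by have [_ ->] := CVpow_map_coalgmap phi n.
Qed.

Definition Coalg_one : Coalg n :=
  @MkCoalg n (fun V => conv_one (CVpow V n) (tens_algebra (tens_pow V k)))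
    (fun V => conv_one_coalgmap (CVpow V n) (tens_pow V k)) Coalg_one_natural.

Fact Coalg_inv_coalgmap (f : Coalg n) V :
  @is_coalgmap R (CVpow V n) (TVwedge V) (conv_inv (f V)).
Proof.
by apply: (conv_inv_coalgmap (@CVpow_cocommutative V n)); exact: coalg_coalgmap.
Qed.

Fact Coalg_inv_natural (f : Coalg n) V W (phi : {linear V -> W}) x :
  conv_inv (f W) (CVpow_map phi n x) = TVwedge_map phi (conv_inv (f V) x).
Proof. by rewrite /= coalg_natural; exact: antipode_natural. Qed.

Definition Coalg_inv (f : Coalg n) : Coalg n :=
  @MkCoalg n (fun V => conv_inv (f V))
    (Coalg_inv_coalgmap f) (Coalg_inv_natural f).

Let ev V x (h : {linear CVpow V n -> tens_algebra (tens_pow V k)}) := h x.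

Lemma Coalg_mulA : associative Coalg_mul.
Proof.
move=> f g h; apply: Coalg_ext => V x.
exact: (congr1 (ev x) (@convA R _ (tens_algebra _) (f V) (g V) (h V))).
Qed.

Lemma Coalg_mul1 : left_id Coalg_one Coalg_mul.
Proof.
move=> f; apply: Coalg_ext => V x.
exact: (congr1 (ev x) (@conv1l R _ (tens_algebra _) (f V))).
Qed.

Lemma Coalg_mulV : left_inverse Coalg_one Coalg_inv Coalg_mul.
Proof.
move=> f; apply: Coalg_ext => V x.
exact: (congr1 (ev x) (conv_invl (coalg_coalgmap f V))).
Qed.

Definition CoalgGroup : abstractGroup :=
  AbstractGroup Coalg_mulA Coalg_mul1 Coalg_mulV.

End FixedN.

Section Restriction.
Variable n : nat.

(* The inclusion of C(V)^{(x) n} as C(V)^{(x) n} (x) R in C(V)^{(x) n+1} *)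
Definition CVpow_incl (V : lmodType R) :
  {linear CVpow V n -> CVpow V n.+1} :=
  mklin (tpure_linl (M := CVpow V n) (N := prim_coalg V) (pone V)).

Lemma CVpow_inclE (V : lmodType R) x : CVpow_incl V x = tpure x (pone V).
Proof. exact: mklinE. Qed.

Lemma CVpow_incl_coalgmap (V : lmodType R) : is_coalgmap (CVpow_incl V).
Proof.
split=> x; rewrite CVpow_inclE; last first.
  by rewrite [LHS]cotens_counitE [counit (prim_coalg V) _]prim_counit1 mulr1.
rewrite [LHS]cotens_comulE [comul (prim_coalg V) _]prim_comul1.
elim/tensW: (comul _ x) => [|y z hy hz|a b]; first by rewrite tpure0l !linear0.
  by rewrite tpureDl !linearD /= hy hz.
by rewrite tmapE !CVpow_inclE tinterE.
Qed.

Fact Coalg_restr_coalgmap (f : Coalg n.+1) V :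
  is_coalgmap (f V \o CVpow_incl V : {linear CVpow V n -> TVwedge V}).
Proof.
have [hM h1] := CVpow_incl_coalgmap V.
have [fM f1] := coalg_coalgmap f V; split=> x /=; last by rewrite f1 h1.
by rewrite fM hM tmap_comp.
Qed.

Fact Coalg_restr_natural (f : Coalg n.+1) V W (phi : {linear V -> W}) x :
  f W (CVpow_incl W (CVpow_map phi n x)) =
  TVwedge_map phi (f V (CVpow_incl V x)).
Proof.
transitivity (f W (CVpow_map phi n.+1 (CVpow_incl V x))).
  by congr (f W _); rewrite !CVpow_inclE [RHS]tmapE prim_map1.
exact: coalg_natural.
Qed.

Definition Coalg_restr (f : Coalg n.+1) : Coalg n :=
  @MkCoalg n
    (fun V => f V \o CVpow_incl V : {linear CVpow V n -> TVwedge V})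
    (Coalg_restr_coalgmap f) (Coalg_restr_natural f).

Lemma Coalg_restrM (f g : Coalg n.+1) :
  Coalg_restr (Coalg_mul f g) = Coalg_mul (Coalg_restr f) (Coalg_restr g).
Proof.
apply: Coalg_ext => V x.
pose A := tens_algebra (tens_pow V k).
exact: (congr1 (fun h : {linear CVpow V n -> A} => h x)
  (@conv_precomp R _ _ A _ (f V) (g V) (CVpow_incl_coalgmap V))).
Qed.

Lemma Coalg_restr1 : Coalg_restr (Coalg_one n.+1) = Coalg_one n.
Proof.
apply: Coalg_ext => V x; have [_ h1] := CVpow_incl_coalgmap V.
by rewrite /= !conv_oneE h1.
Qed.

Lemma Coalg_restrV (f : Coalg n.+1) :
  Coalg_restr (Coalg_inv f) = Coalg_inv (Coalg_restr f).
Proof. by apply: Coalg_ext. Qed.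

End Restriction.

Record CoalgInf := MkCoalgInf {
  coalginf_val :> forall n, Coalg n;
  coalginf_compat : forall n, Coalg_restr (coalginf_val n.+1) = coalginf_val n }.

Lemma coalginf_ext (x y : CoalgInf) : (forall n, x n = y n) -> x = y.
Proof.
case: x y => [x hx] [y hy] /= h.
have e : x = y by apply: functional_extensionality_dep.
by subst y; congr MkCoalgInf; exact: Prop_irrelevance.
Qed.

Fact coalginf_mul_compat (x y : CoalgInf) n :
  Coalg_restr (Coalg_mul (x n.+1) (y n.+1)) = Coalg_mul (x n) (y n).
Proof. by rewrite Coalg_restrM !coalginf_compat. Qed.

Fact coalginf_inv_compat (x : CoalgInf) n :
  Coalg_restr (Coalg_inv (x n.+1)) = Coalg_inv (x n).
Proof. by rewrite Coalg_restrV coalginf_compat. Qed.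

Definition coalginf_mul (x y : CoalgInf) : CoalgInf :=
  @MkCoalgInf (fun n => Coalg_mul (x n) (y n)) (coalginf_mul_compat x y).
Definition coalginf_one : CoalgInf := MkCoalgInf Coalg_restr1.
Definition coalginf_inv (x : CoalgInf) : CoalgInf :=
  @MkCoalgInf (fun n => Coalg_inv (x n)) (coalginf_inv_compat x).

Lemma coalginf_mulA : associative coalginf_mul.
Proof. by move=> x y z; apply: coalginf_ext => n; exact: Coalg_mulA. Qed.
Lemma coalginf_mul1 : left_id coalginf_one coalginf_mul.
Proof. by move=> x; apply: coalginf_ext => n; exact: Coalg_mul1. Qed.
Lemma coalginf_mulV : left_inverse coalginf_one coalginf_inv coalginf_mul.
Proof. by move=> x; apply: coalginf_ext => n; exact: Coalg_mulV. Qed.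

Definition CoalgInfGroup : abstractGroup :=
  AbstractGroup coalginf_mulA coalginf_mul1 coalginf_mulV.

End NaturalCoalgebraMaps.

(* Main.v *)
Require Import Defs.
From mathcomp Require Import all_boot ssralg zmodp matrix boolp.

(** A natural family is determined by numbers.  Let V be free on x_1, ..., x_n,
    and let u be a sequence of words whose letters are pairwise distinct.  The
    coefficient of f at u, [coef f u], is the coefficient of the monomial u in
    the value of f_V at the pure tensor that has x_i in the slots i occurring in
    u and 1 in the others.  Naturality under the maps that kill basis vectors
    and under x_i |-> x_i + y leaves only the monomials in which each of these
    letters occurs exactly once, and every pure tensor over every module is the
    image of such a tensor, so that f is determined by its coefficients
    ([coef_inj]).  The convolution product becomes a sum over deconcatenations
    ([coefM]), and compatibility with the comultiplications becomes the shuffle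
    identity ([coef_shuffle]).  The iterated comultiplication of C(V)^(x)n is
    never expanded: killing complementary sets of variables on its two sides
    leaves a single pure tensor ([comul_split]).

    The generator w^r is sent to the coalgebra map with coefficients 1 + r w.
    Fix a letter j and consider the maps whose coefficients vanish at the
    nonempty sequences that avoid j.  The shuffle identity moves the word that
    contains j to the front, so that such a map is determined by its leading
    coefficients, those at w :: s with j in w ([leading_inj]).  Conjugation acts
    on leading coefficients by right multiplication ([coef_conj]), hence an
    iterated commutator [[w^r, s_1^(r_1), ..., s_l^(r_l)] has one leading
    coefficient, r r_1 ... r_l at w :: s, or none when a letter is repeated
    ([coef_gencomm]).  The relations of K follow ([gvalueK_rel]).

    For bijectivity, the commutators [[w^r, s_1^1, ..., s_l^1] with j in w
    generate a normal subgroup of K.  It is abelian because a commutator in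
    which j occurs twice is trivial, and its generators are additive in r, so
    its elements are the products [letter_prod j c], and the scalars c are the
    leading coefficients of the image.  An element of K generated by the words
    in the letters below j + 1 is such a product times an element generated by
    the words in the letters below j ([letter_factor]); injectivity follows by
    induction on j ([realize_inj_below]).  Conversely, let f involve only the
    letters below j + 1.  Its restriction to the letters below j is the image of
    some g by induction, and f times the inverse of that image is determined by
    leading coefficients, which are those of some [letter_prod j c]
    ([realize_surj_below]).  The isomorphisms commute with the projections
    ([restr_realize]), and so induce an isomorphism of the limits. *)

Set Implicit Arguments.
Unset Strict Implicit.
Unset Printing Implicit Defensive.

Import GRing.Theory.
Local Open Scope ring_scope.

(** * The tensor algebra: Fox derivatives and shuffles *)

Section FoxAlgebra.
Variables (R : comPzRingType) (A : algebra R) (eps : {linear A -> R^o}).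
Hypothesis eps1 : eps (aone A) = 1 :> R.
Hypothesis epsM : forall x y, eps (amul A x y) = (eps x : R) * eps y.

(** The pair (d, x) stands for the triangular matrix with rows (eps x, d) and
    (0, x); an algebra map x |-> (d x, x) is then the same as a map d with
    d (x y) = d x * y + eps x * d y. *)
Definition fox_bilin : bilin (A * A)%type (A * A)%type (A * A)%type.
Proof.
exists (fun x y => (amul A x.1 y.2 + (eps x.2 : R) *: y.1, amul A x.2 y.2)).
- move=> y r x x'; apply/pair_equal_spec; split; rewrite /= bilinDl bilinZl //.
  by rewrite linearP scalerDl -scalerA scalerDr addrACA.
- move=> x r y y'; apply/pair_equal_spec; split; rewrite /= bilinDr bilinZr //.
  by rewrite !scalerDr !scalerA [_ * r]mulrC addrACA.
Defined.

Fact fox_mulA : associative fox_bilin.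
Proof.
move=> x y z; apply/pair_equal_spec; rewrite /= !amulA; split=> //.
by rewrite bilinDl bilinZl epsM scalerDr scalerA addrA.
Qed.

Fact fox_mul1l : left_id (0, aone A) fox_bilin.
Proof.
by case=> x y; apply/pair_equal_spec;
  rewrite /= bilin0l eps1 scale1r add0r amul1l.
Qed.

Fact fox_mul1r : right_id (0, aone A) fox_bilin.
Proof.
by case=> x y; apply/pair_equal_spec; rewrite /= scaler0 addr0 !amul1r.
Qed.

Definition fox_algebra : algebra R := MkAlgebra fox_mulA fox_mul1l fox_mul1r.

End FoxAlgebra.

Section Fox.
Variables (R : comPzRingType) (W : lmodType R).
Local Notation T := (tens_algebra W).
Local Notation form := {linear W -> R^o}.

(** T(W) is spanned by words, so that left multiplication by generators is the
    only product to be considered in an induction. *)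
Lemma tens_algebra_ind (P : T -> Prop) :
  P 0 -> (forall x y, P x -> P y -> P (x + y)) ->
  P (aone T) -> (forall r x, P x -> P (r *: x)) ->
  (forall a y, P y -> P (amul T (agen W a) y)) -> forall x, P x.
Proof.
move=> P0 PD P1 PZ Pg x; rewrite -[x](@amul1r R T); move: (aone T) P1.
elim/tens_algebraW: x => [a|||x y hx hy|r x hx|x y hx hy] z Pz.
- exact: Pg.
- by rewrite amul1l.
- by rewrite bilin0l.
- by rewrite bilinDl; apply: PD; [apply: hx|apply: hy].
- by rewrite bilinZl; apply: PZ; apply: hx.
- by rewrite -amulA; apply/hx/hy.
Qed.

Definition fox_alg : algebra R := @fox_algebra R T (acounit W) (acounit1 W)
  (@acounitM R W).

Fact fox_gen_linear (l : form) :
  linear (fun a => ((l a : R) *: aone T, agen W a) : fox_alg).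
Proof. by move=> r a b; congr pair; rewrite ?linearP //= scalerDl scalerA. Qed.

Definition fox_pair (l : form) : {linear T -> fox_alg} :=
  @alift _ _ fox_alg (mklin (fox_gen_linear l)).

Lemma fox_pair2 l x : (fox_pair l x).2 = x.
Proof.
have [h1 hM] := alift_algmap (A := fox_alg) (mklin (fox_gen_linear l)).
elim/tens_algebraW: x => [a|||x y hx hy|r x hx|x y hx hy].
- by rewrite alift_gen mklinE.
- by rewrite /fox_pair h1.
- by rewrite linear0.
- by rewrite linearD /= hx hy.
- by rewrite linearZ /= hx.
- by rewrite /fox_pair hM /= -!/(fox_pair l _) hx hy.
Qed.

Fact fox_linear l : linear (fun x => (fox_pair l x).1).
Proof. by move=> r x y; rewrite linearP. Qed.

(** The left Fox derivative in the direction of the linear form [l], which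
    strips the first letter a of a word and multiplies the rest by [l a]. *)
Definition fox l : {linear T -> T} := mklin (fox_linear l).

Lemma foxE l x : fox l x = (fox_pair l x).1.
Proof. exact: mklinE. Qed.

Lemma fox1 l : fox l (aone T) = 0.
Proof.
have [h1 _] := alift_algmap (A := fox_alg) (mklin (fox_gen_linear l)).
by rewrite foxE /fox_pair h1.
Qed.

Lemma foxM l x y :
  fox l (amul T x y) = amul T (fox l x) y + (acounit W x : R) *: fox l y.
Proof.
have [_ hM] := alift_algmap (A := fox_alg) (mklin (fox_gen_linear l)).
by rewrite !foxE /fox_pair hM /= -!/(fox_pair l _) !fox_pair2.
Qed.

Lemma fox_gen l a : fox l (agen W a) = (l a : R) *: aone T.
Proof. by rewrite foxE /fox_pair alift_gen mklinE. Qed.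

Lemma fox_genM l a y : fox l (amul T (agen W a) y) = (l a : R) *: y.
Proof. by rewrite foxM fox_gen acounit_gen scale0r addr0 bilinZl amul1l. Qed.

Lemma fox0 (l : form) : l =1 (fun=> 0) -> fox l =1 (fun=> 0).
Proof.
move=> l0; elim/tens_algebra_ind => [|x y hx hy||r x hx|a y hy].
- by rewrite linear0.
- by rewrite linearD hx hy addr0.
- exact: fox1.
- by rewrite linearZ hx /= scaler0.
- by rewrite fox_genM l0 scale0r.
Qed.

(** The linear form on T(W) that sends a_1 ... a_m to l_1(a_1) ... l_m(a_m)
    when m is the length of [s], and kills the other degrees. *)
Fixpoint wordform (s : seq form) : {linear T -> R^o} :=
  if s is l :: s' then wordform s' \o fox l else acounit W.

Lemma wordform_genM (l : form) (s : seq form) a y :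
  wordform (l :: s) (amul T (agen W a) y) = (l a : R) * wordform s y.
Proof. by rewrite /= fox_genM linearZ. Qed.

Lemma wordform_aone s : wordform s (aone T) = (size s == 0)%:R.
Proof.
by case: s => [|l s] /=; rewrite ?acounit1 // fox1 linear0.
Qed.

Lemma wordform_gen (l : form) (s : seq form) a :
  wordform (l :: s) (agen W a) = (l a : R) * (size s == 0)%:R.
Proof. by rewrite -[agen W a](@amul1r R T) wordform_genM wordform_aone. Qed.

(** The Leibniz rule [foxM], iterated: from the moment a derivative falls on the
    second factor, only the constant term of the first factor is left. *)
Lemma wordformM s x y :
  wordform s (amul T x y) =
  \sum_(i < (size s).+1) (wordform (take i s) x : R) * wordform (drop i s) y.
Proof.
elim: s x y => [|l s IH] x y; first by rewrite big_ord1 /= acounitM.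
rewrite big_ord_recl /= foxM linearD linearZ /= addrC; congr (_ + _).
by rewrite IH; apply: eq_bigr.
Qed.

Lemma wordform_eq0 (s : seq form) (l0 : form) i :
  (i < size s)%N -> nth l0 s i =1 (fun=> 0) -> wordform s =1 (fun=> 0).
Proof.
elim: s i => [//|l s IH] [_ l_0|i /IH h /h l_0] y /=; last exact: l_0.
by rewrite fox0 // linear0.
Qed.

Definition pairing (f g : {linear T -> R^o}) : {linear tens T T -> R^o} :=
  tunitl R^o \o tmap f g.
#[global] Arguments pairing : simpl never.

Lemma pairingE f g x y : pairing f g (tpure x y) = (f x : R) * g y.
Proof. by rewrite /= tmapE tunitlE. Qed.

End Fox.

Section Shuffle.
Variable (X : Type).

Fixpoint shuffles (s t : seq X) : seq (seq X) :=
  if s is a :: s' then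
    (fix shuf_a (t : seq X) := if t is b :: t' then
       map (cons a) (shuffles s' t) ++ map (cons b) (shuf_a t') else [:: s]) t
  else [:: t].

Lemma shuffless0 s : shuffles s [::] = [:: s]. Proof. by case: s. Qed.
Lemma shufflesE a s b t : shuffles (a :: s) (b :: t) =
  map (cons a) (shuffles s (b :: t)) ++ map (cons b) (shuffles (a :: s) t).
Proof. by []. Qed.

End Shuffle.

Lemma shuffles_map X Y (f : X -> Y) s t :
  shuffles (map f s) (map f t) = map (map f) (shuffles s t).
Proof.
elim: s t => [//|a s IHs]; elim=> [|b t IHt]; first by rewrite !shuffless0.
rewrite [map f (a :: s)]/= [map f (b :: t)]/= !shufflesE map_cat.
rewrite -[f b :: _]/(map f (b :: t)) IHs -[f a :: _]/(map f (a :: s)) IHt.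
by rewrite -!map_comp.
Qed.

Section WordForms.
Variables (R : comPzRingType) (W : lmodType R).
Local Notation T := (tens_algebra W).
Local Notation form := {linear W -> R^o}.
Implicit Types s t : seq form.

(** The comultiplication for which W is primitive is dual to the shuffle
    product: its recursion on the first letter, a ⊗ 1 + 1 ⊗ a, is that of
    [shuffles]. *)
Lemma pairing_acomul s t (x : T) :
  pairing (wordform s) (wordform t) (acomul W x) = \sum_(w <- shuffles s t)
    wordform w x.
Proof.
elim/tens_algebra_ind: x s t => [|x y hx hy||r x hx|a y hy] s t.
- by rewrite !linear0 big1 // => w _; rewrite linear0.
- rewrite !linearD hx hy -big_split; apply: eq_bigr => w _; by rewrite linearD.
- rewrite acomul1 pairingE !wordform_aone.
  case: s => [|l s]; first by rewrite big_seq1 wordform_aone mul1r.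
  rewrite mul0r; case: t => [|m t]; first by rewrite big_seq1 wordform_aone.
  rewrite shufflesE big_cat !big_map /= !big1 /= ?addr0 // => w _;
    exact: (wordform_aone (_ :: w)).
- rewrite !linearZ -[X in X = _]/(r *: _) hx scaler_sumr;
  apply: eq_bigr => w _; by rewrite linearZ.
have hZ (Z : tens T T) :
    pairing (wordform s) (wordform t) (tmul T T (acomul W (agen W a)) Z) =
    (if s is l :: s' then (l a : R) * pairing (wordform s') (wordform t) Z else
      0) +
    (if t is l :: t' then (l a : R) * pairing (wordform s) (wordform t') Z else
      0).
  elim/tensW: Z => [|Z Z' hZ hZ'|b c].
  - rewrite bilin0r !linear0; case: s => [|l s]; case: t => [|m t];
      by rewrite ?linear0 ?mulr0 ?addr0.
  - rewrite bilinDr !linearD hZ hZ'; case: s {hZ hZ'} => [|l s];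
      case: t => [|m t]; by rewrite ?linearD ?mulrDr ?addr0 ?add0r // addrACA.
  rewrite acomul_gen bilinDl linearD !tmulE !amul1l !pairingE; congr (_ + _).
    case: s => [|l s]; last by rewrite wordform_genM pairingE mulrA.
    by rewrite /= acounitM acounit_gen mul0r mul0r.
  case: t => [|m t]; last by rewrite wordform_genM pairingE mulrCA.
  by rewrite /= acounitM acounit_gen mul0r mulr0.
rewrite acomulM hZ; case: s {hZ} => [|l s]; case: t => [|m t].
- by rewrite addr0 big_seq1 /= acounitM acounit_gen mul0r.
- by rewrite add0r hy !big_seq1 wordform_genM.
- by rewrite addr0 hy !shuffless0 !big_seq1 wordform_genM.
rewrite shufflesE big_cat !big_map !hy !mulr_sumr.
by congr (_ + _); apply: eq_bigr => w _; rewrite wordform_genM.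
Qed.

(** An element is recovered from its constant term and its first derivatives
    by a Taylor formula, and it has finitely many nonzero higher derivatives, so
    that an induction on their order applies. *)
Lemma wordform_separation (I : finType) (e : I -> W) (l : I -> form) :
  (forall a, a = \sum_i (l i a : R) *: e i) ->
  forall x : T, (forall u : seq I, wordform (map l u) x = 0) -> x = 0.
Proof.
move=> el.
have taylor (x : T) : x = (acounit W x : R) *: aone T +
    \sum_i amul T (agen W (e i)) (fox (l i) x).
  elim/tens_algebra_ind: x => [|x y hx hy||r x hx|a y hy].
  - by rewrite linear0 scale0r add0r big1 // => i _; rewrite linear0 bilin0r.
  - rewrite {1}hx {1}hy linearD scalerDl addrACA -big_split; congr (_ + _).
    by apply: eq_bigr => i _; rewrite linearD bilinDr.
  - by rewrite acounit1 scale1r big1 ?addr0 // => i _; rewrite fox1 bilin0r.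
  - rewrite {1}hx scalerDr scalerA linearZ; congr (_ + _).
    by rewrite scaler_sumr; apply: eq_bigr => i _; rewrite linearZ bilinZr.
  rewrite acounitM acounit_gen mul0r scale0r add0r {1}(el a).
  rewrite linear_sum -[amul T (\sum_i _) y]/(amul T^~ y _).
  have := big_morph (amul T^~ y) (fun b c => bilinDl (amul T) b c y) (bilin0l _
    y).
  move=> ->; apply: eq_bigr => i _.
  by rewrite fox_genM linearZ bilinZl bilinZr.
(* the derivatives of order larger than the degree vanish *)
have nilp (x : T) : exists d, forall u : seq I, size u >= d ->
    foldl (fun z i => fox (l i) z) x u = 0.
  pose F u z := foldl (fun z i => fox (l i) z) z u.
  have FS i u z : F (i :: u) z = F u (fox (l i) z) by [].
  have F0 u : F u 0 = 0 by elim: u => // i u IH; rewrite FS linear0.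
  have FD u z z' : F u (z + z') = F u z + F u z'.
    by elim: u z z' => // i u IH z z'; rewrite !FS linearD IH.
  have FZ u r z : F u (r *: z) = r *: F u z.
    by elim: u z => // i u IH z; rewrite !FS linearZ IH.
  elim/tens_algebra_ind: x => [|x y [d hd] [d' hd']||r x [d hd]|a y [d hd]].
  - by exists 0%N => u _; apply: F0.
  - exists (maxn d d') => u; rewrite geq_max => /andP[h h'].
    by rewrite -/(F u _) FD [F u x]hd ?[F u y]hd' ?addr0.
  - by exists 1%N => -[//|i u] _; rewrite -/(F _ _) FS fox1 F0.
  - by exists d => u h; rewrite -/(F u _) FZ [F u x]hd ?scaler0.
  exists d.+1 => -[//|i u] h.
  by rewrite -/(F _ _) FS fox_genM FZ [F u y]hd ?scaler0.
move=> x; case: (nilp x) => d; elim: d x => [|d IH] x hx h.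
  exact: (hx [::]).
rewrite (taylor x) [acounit W x](h [::]) scale0r add0r big1 // => i _.
rewrite (IH (fox (l i) x)) ?bilin0r // => u; first by move=> hu;
  apply: (hx (i :: u)).
exact: (h (i :: u)).
Qed.

End WordForms.

Lemma fox_natural (R : comPzRingType) (V W : lmodType R)
    (phi : {linear V -> W}) (l : {linear W -> R^o}) x :
  fox l (tens_algebra_map phi x) =
  tens_algebra_map phi (fox (l \o phi : {linear V -> R^o}) x).
Proof.
have [p1 pM] := tens_algebra_map_algmap phi.
elim/tens_algebra_ind: x => [|x y hx hy||r x hx|a y hy].
- by rewrite !linear0.
- by rewrite !linearD hx hy.
- by rewrite p1 !fox1 linear0.
- by rewrite !linearZ /= hx.
by rewrite pM tens_algebra_map_gen !fox_genM linearZ.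
Qed.

Lemma wordform_natural (R : comPzRingType) (V W : lmodType R)
    (phi : {linear V -> W}) (s : seq {linear W -> R^o}) x :
  wordform s (tens_algebra_map phi x) =
  wordform [seq (l \o phi : {linear V -> R^o}) | l : {linear W -> R^o} <- s] x.
Proof.
elim: s x => [|l s IH] x /=; last by rewrite fox_natural IH.
have [p1 pM] := tens_algebra_map_algmap phi.
elim/tens_algebra_ind: x => [|x y hx hy||r x hx|a y hy].
- by rewrite !linear0.
- by rewrite !linearD hx hy.
- by rewrite p1 !acounit1.
- by rewrite !linearZ /= hx.
by rewrite pM tens_algebra_map_gen !acounitM !acounit_gen !mul0r.
Qed.

(** * Tensor powers of a free module *)

Section TensorPowers.
Variable R : comPzRingType.

Definition tpurel (M N : lmodType R) (n : N) : {linear M -> tens M N} :=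
  mklin (tpure_linl n).

Lemma tpurelE (M N : lmodType R) (n : N) m : tpurel M n m = tpure m n.
Proof. exact: mklinE. Qed.

Implicit Types V W : lmodType R.

Fixpoint tpow V (v : nat -> V) k : tens_pow V k :=
  if k is k'.+1 then tpure (tpow v k') (v k') else (1 : R^o).

(** The tensor product of the forms l_0, ..., l_(k-1); [tpow] is the
    corresponding product of vectors. *)
Fixpoint tform V (l : nat -> {linear V -> R^o}) k : {linear tens_pow V k ->
  R^o} :=
  if k is k'.+1 then tunitl R^o \o tmap (tform l k') (l k') else idfun.

Lemma tformS V (l : nat -> {linear V -> R^o}) k x y :
  tform l k.+1 (tpure x y) = (tform l k x : R) * l k y.
Proof. by rewrite /= tmapE tunitlE. Qed.

Lemma tform_tpow V (l : nat -> {linear V -> R^o}) v k :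
  tform l k (tpow v k) = \prod_(i < k) (l i (v i) : R).
Proof.
by elim: k => [|k IH]; rewrite ?big_ord0 // big_ord_recr /= -IH -tformS.
Qed.

Lemma tform_map V W (phi : {linear V -> W}) (l : nat -> {linear W -> R^o}) k x :
  tform l k (tens_pow_map phi k x) =
  tform (fun i => l i \o phi : {linear V -> R^o}) k x.
Proof.
elim: k x => [//|k IH]; elim/tensW => [|y z hy hz|y v].
- by rewrite !linear0.
- by rewrite !linearD hy hz.
by rewrite /= !tmapE !tunitlE IH.
Qed.

Lemma eq_tform V (l l' : nat -> {linear V -> R^o}) k :
  (forall i, (i < k)%N -> l i =1 l' i) -> tform l k = tform l' k.
Proof.
elim: k => [//|k IH] h /=; rewrite IH; last by move=> i ik; apply/h/ltnW.
by have /linear_ext -> := h k (ltnSn k).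
Qed.

Lemma eq_tpow V (v v' : nat -> V) k :
  (forall i, (i < k)%N -> v i = v' i) -> tpow v k = tpow v' k.
Proof.
elim: k => [//|k IH] h /=; rewrite IH ?h // => i ik; exact/h/ltnW.
Qed.

Lemma tform_eq0 V (l : nat -> {linear V -> R^o}) k i :
  (i < k)%N -> l i =1 (fun=> 0) -> tform l k =1 (fun=> 0).
Proof.
elim: k => [//|k IH] ik l0; elim/tensW => [|x y hx hy|x v].
- by rewrite linear0.
- by rewrite linearD hx hy addr0.
rewrite tformS; move: ik; rewrite ltnS leq_eqVlt => /predU1P[e|ik].
  by subst i; rewrite l0 mulr0.
by rewrite IH // mul0r.
Qed.

End TensorPowers.

Section RowModule.
Variables (R : comPzRingType) (n : nat).
Local Notation V := 'rV[R]_n.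

(** A letter is a plain natural number: [xvec i] and [xform i] vanish when [i]
    is out of range. *)
Definition xvec (i : nat) : V := \row_j (i == j :> nat)%:R.

Fact xform_linear (i : nat) :
  linear (fun y : V => \sum_(j < n) (i == j :> nat)%:R * y 0 j : R^o).
Proof.
move=> r y z; rewrite scaler_sumr -big_split; apply: eq_bigr => j _ /=.
by rewrite !mxE mulrDr [in RHS]/GRing.scale /= mulrCA.
Qed.

Definition xform (i : nat) : {linear V -> R^o} := mklin (xform_linear i).

Lemma xform_xvec i j : (j < n)%N -> xform i (xvec j) = (i == j)%:R.
Proof.
move=> jn; rewrite mklinE (bigD1 (Ordinal jn)) //= big1 => [|l lj].
  by rewrite mxE eqxx mulr1 addr0.
by rewrite mxE [j == l](_ : _ = false) ?mulr0 //; apply: contraNF lj => /eqP jl;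
   apply/eqP/val_inj.
Qed.

Lemma row_decomp (y : V) : y = \sum_(j < n) y 0 j *: xvec j.
Proof.
apply/rowP => i; rewrite summxE (bigD1 i) //= !mxE eqxx mulr1 big1 ?addr0 //.
by move=> j ji; rewrite !mxE (inj_eq val_inj) (negPf ji) mulr0.
Qed.

Definition row_comb (W : lmodType R) (v : nat -> W) (y : V) : W :=
  \sum_(j < n) y 0 j *: v j.

Fact row_comb_linear (W : lmodType R) v : linear (@row_comb W v).
Proof.
move=> r y z; rewrite scaler_sumr -big_split; apply: eq_bigr => j _ /=.
by rewrite !mxE scalerDl scalerA.
Qed.

Definition xsubst (W : lmodType R) (v : nat -> W) : {linear V -> W} :=
  mklin (row_comb_linear v).

Lemma xsubst_xvec (W : lmodType R) (v : nat -> W) i :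
  (i < n)%N -> xsubst v (xvec i) = v i.
Proof.
move=> iN; rewrite mklinE /row_comb (bigD1 (Ordinal iN)) //= big1 => [|j ji].
  by rewrite mxE eqxx scale1r addr0.
by rewrite mxE [i == j](_ : _ = false) ?scale0r //;
  apply: contraNF ji => /eqP jl;
   apply/eqP/val_inj.
Qed.

Lemma row_is_basis : is_basis (fun y : V => [exists i : 'I_n, y == xvec i]).
Proof.
split=> [v|s c us /allP sB s0 b bs].
  exists (map (fun i : 'I_n => xvec i) (enum 'I_n)).
  exists (fun b => if [pick i : 'I_n | b == xvec i] is Some i then v 0 i else
    0).
  split.
    by apply/allP => _ /mapP[i _ ->]; apply/existsP; exists i.
  rewrite big_map big_enum /= {1}(row_decomp v); apply: eq_bigr => i _.
  case: pickP => [j /eqP /rowP /(_ i)|/(_ i)]; last by rewrite eqxx.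
  rewrite !mxE eqxx => h; case: (eqVneq (j : nat) i) h => [/val_inj->//|_ /= h].
  have h0 : (1 : R) = 0 by [].
  by apply/rowP => l; rewrite !mxE -[v 0 i]mulr1 -[v 0 j]mulr1 h0 !mulr0 !mul0r.
have /existsP[i /eqP bE] := sB _ bs.
have := congr1 (fun y : V => y 0 i) s0; rewrite summxE (bigD1_seq b) //= mxE.
rewrite bE !mxE eqxx mulr1 big_seq_cond big1 ?addr0 // => b'
  /andP[/sB/existsP[j /eqP->] ji].
by rewrite !mxE; case: (eqVneq (j : nat) i) ji => [->|_ _];
  rewrite ?bE ?eqxx ?mulr0.
Qed.

Definition Vrow : freeModType R := @FreeMod R V (ex_intro _ _ row_is_basis).

(** The products of basis vectors span the tensor power. *)
Lemma row_pow_ext k (M : lmodType R) (f g : {linear tens_pow V k -> M}) :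
  (forall l : nat -> nat, (forall i, (i < k)%N -> (l i < n)%N) ->
     f (tpow (xvec \o l) k) = g (tpow (xvec \o l) k)) -> f =1 g.
Proof.
elim: k M f g => [|k IH] M f g fg.
  move=> x; rewrite -[x](mulr1 (x : R)) -/(GRing.scale (x : R) (1 : R^o))
    !linearZ.
  by congr (_ *: _); apply: (fg id).
apply: tens_ext => y v; rewrite (row_decomp v) -[tpure y _]/(tpureb _ _ y _).
rewrite !(big_morph _ (fun a b => bilinDr (tpureb _ _) y a b) (bilin0r _ y))
  !linear_sum.
apply: eq_bigr => j _; rewrite bilinZr !linearZ; congr (_ *: _).
have e (h : {linear tens_pow V k.+1 -> M}) z : h (tpureb _ _ z (xvec j)) =
    (h \o tpurel _ (xvec j) : {linear tens_pow V k -> M}) z.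
  by rewrite /= tpurelE.
rewrite !e; apply: IH => l hl; rewrite /= !tpurelE.
have := fg (fun i => if i == k then val j else l i); rewrite /= eqxx.
have -> : tpow (xvec \o (fun i => if i == k then val j else l i)) k = tpow
  (xvec \o l) k.
  by apply: eq_tpow => i ik /=; rewrite ltn_eqF.
apply=> i; rewrite ltnS leq_eqVlt => /predU1P[->|ik];
  first by rewrite eqxx ltn_ord.
by rewrite ltn_eqF // hl.
Qed.

End RowModule.

(** * Pure tensors in a power of the primitive coalgebra *)

Section CoalgebraPowers.
Variable R : comPzRingType.
Implicit Types V W : lmodType R.

(** The pure tensor with [v i] in the slots i of [I] and 1 in the others.  Such
    tensors span C(V)^(x)n ([CVpow_ext]). *)
Fixpoint cpoint V (v : nat -> V) (I : pred nat) n : CVpow V n :=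
  if n is n'.+1 then
    tpure (cpoint v I n') (if I n' then pinj (v n') else pone V)
  else (1 : R^o).

Lemma eq_cpoint V (v v' : nat -> V) (I I' : pred nat) n :
  (forall i, (i < n)%N -> I i = I' i) ->
  (forall i, (i < n)%N -> I i -> v i = v' i) -> cpoint v I n = cpoint v' I' n.
Proof.
elim: n => [//|n IH] hI hv /=.
rewrite -hI // IH; last 2 first.
- by move=> i h; apply/hI/ltnW.
- by move=> i h; apply/hv/ltnW.
by case: ifP => // /hv->.
Qed.

Lemma cpoint_map V W (phi : {linear V -> W}) v I n :
  CVpow_map phi n (cpoint v I n) = cpoint (phi \o v) I n.
Proof.
elim: n => [//|n IH]; rewrite [LHS]tmapE -/(CVpow_map phi n) IH /=.
by case: (I n); rewrite ?prim_map_inj ?prim_map1.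
Qed.

Lemma cpoint0 V (v : nat -> V) (I : pred nat) n i :
  (i < n)%N -> I i -> v i = 0 -> cpoint v I n = 0.
Proof.
elim: n => [//|n IH]; rewrite ltnS leq_eqVlt => /predU1P[-> Ii v0|h Ii v0] /=.
  by rewrite Ii v0 [pinj 0](_ : _ = 0) // tpure0r.
by rewrite IH // tpure0l.
Qed.

Lemma cpointD V (v v1 v2 : nat -> V) (I : pred nat) n i :
  (i < n)%N -> I i -> v i = v1 i + v2 i ->
  (forall j, j != i -> v1 j = v j) -> (forall j, j != i -> v2 j = v j) ->
  cpoint v I n = cpoint v1 I n + cpoint v2 I n.
Proof.
move=> + Ii vi h1 h2; elim: n => [//|n IH].
rewrite ltnS leq_eqVlt => /predU1P[e|h] /=.
  subst n; rewrite Ii vi.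
  have -> : cpoint v1 I i = cpoint v I i.
    by apply: eq_cpoint => // j ji _; rewrite h1 // ltn_eqF.
  have -> : cpoint v2 I i = cpoint v I i.
    by apply: eq_cpoint => // j ji _; rewrite h2 // ltn_eqF.
  rewrite -tpureDr; congr tpure; congr pair; by rewrite /= ?addr0.
by rewrite IH // tpureDl h1 ?h2 // gtn_eqF.
Qed.

Lemma CVpow_ext V n (M : lmodType R) (f g : {linear CVpow V n -> M}) :
  (forall v I, f (cpoint v I n) = g (cpoint v I n)) -> f =1 g.
Proof.
elim: n M f g => [|n IH] M f g fg.
  move=> x; rewrite -[x](mulr1 (x : R)) -/(GRing.scale (x : R) (1 : R^o))
    !linearZ.
  by congr (_ *: _); apply: (fg (fun=> 0) pred0).
have e (h : {linear CVpow V n.+1 -> M}) y z : h (tpure y z) =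
    (h \o tpurel _ z : {linear CVpow V n -> M}) y.
  by rewrite /= tpurelE.
apply: tens_ext => y c; rewrite (prim_split c) !tpureDr !tpureZr !linearP.
congr (_ *: _ + _); rewrite !e; apply: IH => v I; rewrite /= !tpurelE.
  have := fg v (fun i => (i != n) && I i); rewrite /= eqxx /=.
  by rewrite (@eq_cpoint _ v v _ I) // => i /ltn_eqF->.
have := fg (fun i => if i == n then c.2 else v i) (fun i => (i == n) || I i).
rewrite /= eqxx /= (@eq_cpoint _ _ v _ I) // => i /ltn_eqF-> //.
Qed.

Lemma tmap_tinter (M M' N N' P P' Q Q' : lmodType R)
    (f : {linear M -> M'}) (g : {linear N -> N'})
    (h : {linear P -> P'}) (k : {linear Q -> Q'}) x y :
  tmap (tmap f h) (tmap g k) (tinter M N P Q (tpure x y)) =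
  tinter M' N' P' Q' (tpure (tmap f g x) (tmap h k y)).
Proof.
elim/tensW: x => [|x x' hx hx'|m n]; first by rewrite !(tpure0l, linear0).
  by rewrite !(tpureDl, linearD) /= hx hx'.
elim/tensW: y => [|y y' hy hy'|p q]; first by rewrite !(tpure0r, linear0).
  by rewrite !(tpureDr, linearD) /= hy hy'.
by rewrite !tinterE !tmapE tinterE.
Qed.

Lemma comul_cpointS V (v : nat -> V) (I : pred nat) n :
  comul (CVpow V n.+1) (cpoint v I n.+1) =
  tinter _ _ _ _ (tpure (comul (CVpow V n) (cpoint v I n))
    (if I n then tpure (pinj (v n)) (pone V) + tpure (pone V) (pinj (v n))
     else tpure (pone V) (pone V))).
Proof.
rewrite [LHS](@cotens_comulE R (CVpow V n) (prim_coalg V)).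
by case: (I n); rewrite [comul (prim_coalg V) _](prim_comul_inj, prim_comul1).
Qed.

(** The comultiplication sends [v i] to either side of the tensor product.
    If on one of the two sides [v i] is killed afterwards, only one choice is
    left for each i, and the result is a single pure tensor. *)
Lemma comul_split V V0 V1 (f0 : {linear V -> V0}) (f1 : {linear V -> V1})
    (v : nat -> V) (I I0 I1 : pred nat) n :
  (forall i, (i < n)%N -> I i = I0 i || I1 i) ->
  (forall i, (i < n)%N -> I0 i -> ~~ I1 i) ->
  (forall i, (i < n)%N -> I0 i -> f1 (v i) = 0) ->
  (forall i, (i < n)%N -> I1 i -> f0 (v i) = 0) ->
  tmap (CVpow_map f0 n) (CVpow_map f1 n) (comul (CVpow V n) (cpoint v I n)) =
  tpure (cpoint (f0 \o v) I0 n) (cpoint (f1 \o v) I1 n).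
Proof.
elim: n => [|n IH] hI h01 h1 h0;
  first by rewrite [comul _ _]base_comulE scale1r tmapE.
rewrite comul_cpointS [tmap _ _ _]tmap_tinter -!/(CVpow_map _ _) IH;
  last 4 first.
- by move=> i /ltnW; apply: hI.
- by move=> i /ltnW; apply: h01.
- by move=> i /ltnW; apply: h1.
- by move=> i /ltnW; apply: h0.
have := hI _ (ltnSn n); have := h01 _ (ltnSn n); have := h1 _ (ltnSn n).
have := h0 _ (ltnSn n) => /=.
have z (W : lmodType R) : pinj (0 : W) = 0 by [].
case: (I0 n); case: (I1 n) => /=.
- by move=> _ _ /(_ isT).
- move=> _ /(_ isT) e _ ->.
  by rewrite linearD /= !tmapE !prim_map1 !prim_map_inj e z tpure0r addr0
    tinterE.
- move=> /(_ isT) e _ _ ->.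
  by rewrite linearD /= !tmapE !prim_map1 !prim_map_inj e z tpure0l add0r
    tinterE.
by move=> _ _ _ ->; rewrite tmapE !prim_map1 tinterE.
Qed.

(** The comultiplication of a pure tensor is a sum of tensors with disjoint
    supports; testing it on a linear map [h] avoids writing the sum. *)
Lemma comul_disjoint V n (M : lmodType R)
    (h : {linear tens (CVpow V n) (CVpow V n) -> M}) v (I : pred nat) :
  (forall I0 I1 : pred nat, (forall i, I0 i -> I i) -> (forall i, I1 i -> I i)
    ->
     (forall i, I0 i -> ~~ I1 i) -> h (tpure (cpoint v I0 n) (cpoint v I1 n)) =
       0) ->
  h (comul (CVpow V n) (cpoint v I n)) = 0.
Proof.
elim: n M h I => [|n IH] M h I h0.
  rewrite [comul _ _]base_comulE scale1r.
  by apply: (h0 pred0 pred0).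
have ext (b : bool) (J : pred nat) : (forall i, J i -> I i && (i != n)) ->
   tpure (cpoint v J n) (if b then pinj (v n) else pone V) =
   cpoint v (fun i => if i == n then b else J i) n.+1.
  move=> hJ; rewrite /= eqxx; congr tpure;
    apply: eq_cpoint => // i /ltn_eqF-> //.
have IHb (b0 b1 : bool) : (b0 -> I n) -> (b1 -> I n) -> ~~ (b0 && b1) ->
    h (tinter _ _ _ _ (tpure (comul (CVpow V n) (cpoint v I n))
       (tpure (if b0 then pinj (v n) else pone V)
              (if b1 then pinj (v n) else pone V)))) = 0.
  move=> hb0 hb1 hb.
  have -> : cpoint v I n = cpoint v (fun i => I i && (i != n)) n.
    by apply: eq_cpoint => // i /ltn_eqF->; rewrite andbT.
  set c := tpure (if b0 then _ else _) _.
  have -> Z : h (tinter (CVpow V n) (CVpow V n) (prim_coalg V) (prim_coalg V)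
    (tpure Z c)) =
    ((h \o tinter _ _ _ _) \o tpurel _ c : {linear _ -> _}) Z.
    by rewrite /= tpurelE.
  apply: IH => I0 I1 hI0 hI1 h01; rewrite /= tpurelE tinterE !ext //.
  apply: h0 => i; first by case: eqP => [->|_ /hI0/andP[]].
    by case: eqP => [->|_ /hI1/andP[]].
  by case: eqP => [_ b0T|_ /h01//]; move: hb; rewrite b0T.
rewrite comul_cpointS; case: ifP => In; last first.
  exact: (IHb false false).
rewrite tpureDr !linearD /=.
have /= -> := IHb true false (fun=> In) (fun _ => In) isT.
by have /= -> := IHb false true (fun=> In) (fun=> In) isT; rewrite addr0.
Qed.

Fact pproj_linear V : linear (fun x : prim_coalg V => x.2).
Proof. by []. Qed.
Definition pproj V : {linear prim_coalg V -> V} := mklin (@pproj_linear V).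

(** The projection of C(V)^(x)n to the copy of V in the slot [i], by counits in
    the other slots. *)
Fixpoint slot V (i n : nat) : {linear CVpow V n -> V} :=
  match n with
  | 0 => \0
  | n'.+1 =>
    if i == n' then
      (tunitl V \o tmap (counit (CVpow V n')) (pproj V)
        : {linear CVpow V n'.+1 -> V})
    else
      (tunitr V \o tmap (slot V i n') (prim_counit V)
        : {linear CVpow V n'.+1 -> V})
  end.

Lemma counit_cpoint V (v : nat -> V) (I : pred nat) n :
  counit (CVpow V n) (cpoint v I n) = (~~ has I (iota 0 n))%:R :> R.
Proof.
elim: n => [//|n IH];
  rewrite [LHS]cotens_counitE IH -addn1 iotaD has_cat /= orbF.
case: (I n); rewrite ?prim_counit_inj ?prim_counit1 ?mulr0 ?mulr1 ?orbT ?orbF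
  //.
Qed.

Lemma slot_cpoint V (v : nat -> V) (I : pred nat) i n :
  slot V i n (cpoint v I n) =
  if (i < n)%N && all (fun j => I j == (j == i)) (iota 0 n) then v i else 0.
Proof.
elim: n => [//|n IH]; rewrite -addn1 iotaD all_cat /= add0n andbT addn1 ltnS.
rewrite leq_eqVlt; case: eqP => [->|/eqP ni] /=;
  rewrite ?eqxx ?(negPf ni) /= tmapE.
  rewrite tunitlE counit_cpoint.
  have -> : all (fun j => I j == (j == n)) (iota 0 n) = ~~ has I (iota 0 n).
    rewrite -all_predC; apply: eq_in_all => j;
      rewrite mem_iota /= => /ltn_eqF->.
    by rewrite eqbF_neg.
  case: has => /=; first by rewrite scale0r.
  by case: (I n); rewrite mklinE /= ?scaler0 // scale1r.
rewrite tunitrE IH [n == i]eq_sym (negPf ni); case: (I n) => /=.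
  by rewrite andbF andbF prim_counit_inj scale0r.
by rewrite andbT prim_counit1 scale1r.
Qed.

Lemma slot_natural V W (phi : {linear V -> W}) i n x :
  slot W i n (CVpow_map phi n x) = phi (slot V i n x).
Proof.
apply: (@CVpow_ext V n W (slot W i n \o CVpow_map phi n) (phi \o slot V i n))
  => v I.
by rewrite /= cpoint_map !slot_cpoint; case: ifP; rewrite ?linear0.
Qed.

(** The map C(V)^(x)n -> V^(x)k that picks the slots l_0, ..., l_(k-1), built
    with iterated comultiplications so that no reordering of tensor factors is
    needed. *)
Fixpoint pickmap V (l : nat -> nat) n k : {linear CVpow V n -> tens_pow V k} :=
  match k with
  | 0 => counit (CVpow V n)
  | k'.+1 => tmap (pickmap V l n k') (slot V (l k') n) \o comul (CVpow V n)
  end.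

Lemma pickmap_natural V W (phi : {linear V -> W}) l n k x :
  pickmap W l n k (CVpow_map phi n x) = tens_pow_map phi k (pickmap V l n k x).
Proof.
have [hM h1] := cotens_pow_map_coalgmap n (prim_map_coalgmap phi).
elim: k x => [|k IH] x; first exact: h1.
rewrite /= [comul _ _]hM !tmap_comp; apply: eq_tmap => y; first exact: IH.
exact: slot_natural.
Qed.

Lemma pickmap_eq0 V l n k v (I : pred nat) : ~~ I (l k) ->
  pickmap V l n k.+1 (cpoint v I n) = 0.
Proof.
move=> Il; apply: (@comul_disjoint V n _ (tmap (pickmap V l n k) (slot V (l k)
  n))).
move=> I0 I1 _ hI1 _; rewrite tmapE slot_cpoint.
suff -> : (l k < n)%N && all (fun j => I1 j == (j == l k)) (iota 0 n) = false.
  by rewrite tpure0r.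
apply/negP => /andP[ln /allP/(_ (l k))]; rewrite mem_iota ln eqxx => /(_ isT).
by move=> /eqP/hI1; rewrite (negPf Il).
Qed.

(** Both factors would need the slot [l k], which the comultiplication gives
    to only one of them.  This makes the image of the reduced comultiplication
    vanish in the smash product, so that its elements are primitive. *)
Lemma pickmap_square V l n k x :
  tmap (pickmap V l n k.+1) (pickmap V l n k.+1) (comul (CVpow V n) x) = 0.
Proof.
apply: (@CVpow_ext V n _ (tmap (pickmap V l n k.+1) (pickmap V l n k.+1) \o
  comul (CVpow V n)) \0) => v I.
apply: (@comul_disjoint V n _ (tmap (pickmap V l n k.+1) (pickmap V l n k.+1))).
move=> I0 I1 _ _ h01; rewrite tmapE.
have [/h01 h|h] := boolP (I0 (l k));
  last by rewrite (pickmap_eq0 _ _ h) tpure0l.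
by rewrite [X in tpure _ X](pickmap_eq0 _ _ h) tpure0r.
Qed.

End CoalgebraPowers.

(** * Coefficients of a natural family *)

Section MultiForms.
Variables (R : comPzRingType) (k : nat).
Implicit Types V W : lmodType R.

(** A word of [m] forms on V^(x)k is given by [m * k] forms on V, indexed by
    their position in the concatenation; polarization modifies a single
    position. *)
Definition flatform V (F : nat -> {linear V -> R^o}) (m : nat) :
    {linear tens_algebra (tens_pow V k) -> R^o} :=
  wordform (mkseq (fun a => tform (fun p => F (a * k + p)%N) k) m).

Let bound a m p : (a < m)%N -> (p < k)%N -> (a * k + p < m * k)%N.
Proof.
move=> am pk; apply: (@leq_trans (a.+1 * k)); last by rewrite leq_mul2r am orbT.
by rewrite mulSn addnC ltn_add2r.
Qed.

Lemma eq_flatform V (F G : nat -> {linear V -> R^o}) m :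
  (forall t, (t < m * k)%N -> F t =1 G t) -> flatform F m = flatform G m.
Proof.
move=> FG; congr wordform; apply/eq_in_map => a;
  rewrite mem_iota add0n => /andP[_ am].
by apply: eq_tform => p pk; apply/FG/bound.
Qed.

Lemma flatform_natural V W (phi : {linear V -> W}) (F : nat -> {linear W ->
  R^o}) m x :
  flatform F m (tens_algebra_map (tens_pow_map phi k) x) =
  flatform (fun t => F t \o phi : {linear V -> R^o}) m x.
Proof.
rewrite [LHS]wordform_natural; congr (wordform _ x); rewrite -map_comp;
  apply: eq_map => a /=.
by apply: linear_ext => y /=; rewrite tform_map.
Qed.

Lemma flatform_eq0 V (F : nat -> {linear V -> R^o}) m t :
  (t < m * k)%N -> F t =1 (fun=> 0) -> flatform F m =1 (fun=> 0).
Proof.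
move=> tmk Ft; have k0 : (0 < k)%N by case: k tmk; rewrite ?muln0.
have am : (t %/ k < m)%N by rewrite ltn_divLR.
apply: (@wordform_eq0 _ _ _ \0 (t %/ k)); rewrite ?size_mkseq // nth_mkseq //.
by apply: (@tform_eq0 _ _ _ _ (t %% k)); rewrite ?ltn_mod // -divn_eq.
Qed.

End MultiForms.

Section Coefficients.
Variables (R : comPzRingType) (k : nat).

Section FixedN.
Variable n : nat.
Local Notation V := 'rV[R]_n.
Local Notation x := (@xvec R n).
Local Notation word := (Kword k n).

Definition letters (w : word) : seq nat := map val w.
Definition flat (u : seq word) : seq nat := flatten (map letters u).

Lemma flat_cat u v : flat (u ++ v) = flat u ++ flat v.
Proof. by rewrite /flat map_cat flatten_cat. Qed.

Lemma size_letters w : size (letters w) = k.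
Proof. by rewrite size_map size_tuple. Qed.

Lemma letters_inj : injective letters.
Proof. by move=> v w /(inj_map val_inj) /val_inj. Qed.

Lemma size_flat u : size (flat u) = (size u * k)%N.
Proof. by elim: u => //= w u IH; rewrite size_cat size_letters IH mulSn. Qed.

Lemma flat_ltn u i : i \in flat u -> (i < n)%N.
Proof.
case/flattenP => s /mapP[w _ ->] /mapP[j _ ->]; exact: ltn_ord.
Qed.

Definition wform (w : seq nat) : {linear tens_pow V k -> R^o} :=
  tform (fun p => xform R n (nth 0%N w p)) k.

Definition monform (u : seq word) := wordform [seq wform (letters w) | w <- u].

Lemma nth_flat u a p : (a < size u)%N -> (p < k)%N ->
  nth 0%N (nth [::] (map letters u) a) p = nth 0%N (flat u) (a * k + p).
Proof.
elim: u a => [//|w u IH] [|a] /= au pk; rewrite nth_cat size_letters.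
  by rewrite mul0n add0n pk.
by rewrite mulSn -addnA ltnNge leq_addr /= addKn IH.
Qed.

Lemma monform_flatform u :
  monform u = flatform k (fun t => xform R n (nth 0%N (flat u) t)) (size u).
Proof.
rewrite /monform (map_comp wform letters) -[map letters u](@mkseq_nth _ [::])
  size_map.
rewrite -map_comp; congr wordform; apply/eq_in_map => a;
  rewrite mem_iota => /andP[_ au] /=.
by apply: eq_tform => p pk; rewrite nth_flat.
Qed.

Definition keep (b : pred nat) : {linear V -> V} :=
  @xsubst R n _ (fun i => if b i then x i else 0).

Lemma keep_xvec (b : pred nat) i : (i < n)%N -> keep b (x i) = if b i then x i
  else 0.
Proof. exact: xsubst_xvec. Qed.

Lemma row_ext (M : lmodType R) (f g : {linear V -> M}) :
  (forall i, (i < n)%N -> f (x i) = g (x i)) -> f =1 g.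
Proof.
move=> fg y; rewrite (row_decomp y) !linear_sum; apply: eq_bigr => j _.
by rewrite !linearZ /= fg.
Qed.

Lemma xform_keep (b : pred nat) i y : xform R n i (keep b y) = if b i then
  xform R n i y else 0.
Proof.
have e : xform R n i \o keep b =1 (if b i then xform R n i else \0 : {linear V
  -> R^o}).
  apply: row_ext => j jn; rewrite /= keep_xvec //.
  case: (eqVneq j i) => [->|ji]; first by case: ifP; rewrite ?linear0.
  have z : xform R n i (x j) = 0 by rewrite xform_xvec // eq_sym (negPf ji).
  by case: (b j); case: (b i); rewrite ?linear0 ?z.
by rewrite [LHS]e; case: (b i).
Qed.

Lemma nth_flat_mem u t : (t < size u * k)%N -> nth 0%N (flat u) t \in flat u.
Proof. by rewrite -size_flat => /(mem_nth 0%N). Qed.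

Lemma monform_keep (b : pred nat) u y : {subset flat u <= b} ->
  monform u (tens_algebra_map (tens_pow_map (keep b) k) y) = monform u y.
Proof.
move=> ub; rewrite monform_flatform flatform_natural.
rewrite (eq_flatform (G := fun t => xform R n (nth 0%N (flat u) t))) // => t tm
  z /=.
by rewrite xform_keep [b _](ub _ (nth_flat_mem tm)).
Qed.

Lemma monform_kill (b : pred nat) u y j : j \in flat u -> ~~ b j ->
  monform u (tens_algebra_map (tens_pow_map (keep b) k) y) = 0.
Proof.
move=> ju bj; rewrite monform_flatform flatform_natural.
apply: (@flatform_eq0 _ _ _ _ _ (index j (flat u)));
  rewrite -?size_flat ?index_mem //.
by move=> z /=; rewrite xform_keep nth_index // (negPf bj).
Qed.

Section Fun.
Variable f : Coalg R k n.

Definition xpoint (I : pred nat) : CVpow V n := cpoint x I n.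

Lemma eq_xpoint (I I' : pred nat) : (forall i, (i < n)%N -> I i = I' i) ->
  xpoint I = xpoint I'.
Proof. by move=> h; apply: eq_cpoint. Qed.

Definition coef (u : seq word) : R := monform u (f (Vrow R n) (xpoint (mem
  (flat u)))).

Lemma coef_nil : coef [::] = 1.
Proof.
have [_ h] := coalg_coalgmap f (Vrow R n).
rewrite /coef [LHS](h (xpoint _)) [LHS]counit_cpoint has_pred0 //.
Qed.

Lemma coalg_keep (b : pred nat) y :
  f (Vrow R n) (CVpow_map (keep b) n y) =
  tens_algebra_map (tens_pow_map (keep b) k) (f (Vrow R n) y).
Proof. exact: (@coalg_natural R k n f (Vrow R n) (Vrow R n)). Qed.

(** Killing the variable [j] does not change the tensor, but it kills the
    monomial. *)
Lemma monform_extra u I j : j \in flat u -> ~~ I j -> monform u (f (Vrow R n)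
  (xpoint I)) = 0.
Proof.
move=> ju Ij; have -> : xpoint I = CVpow_map (keep (predC1 j)) n (xpoint I).
  rewrite cpoint_map; apply: eq_cpoint => // i iN Ii; rewrite /= keep_xvec //=.
  by case: eqP => // ij; rewrite -ij Ii in Ij.
by rewrite coalg_keep (monform_kill _ ju) //= eqxx.
Qed.

(** Killing the variable [j] does not change the monomial, but it kills the
    tensor. *)
Lemma monform_missing u (I : pred nat) j : (j < n)%N -> I j -> j \notin flat u
  ->
  monform u (f (Vrow R n) (xpoint I)) = 0.
Proof.
move=> jn Ij ju; rewrite -(@monform_keep (predC1 j)); last first.
  by move=> i iu; rewrite inE /=; apply: contraNneq ju => <-.
rewrite -coalg_keep cpoint_map (@cpoint0 _ _ _ _ _ j) ?linear0 //.
by rewrite /= keep_xvec //= eqxx.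
Qed.

End Fun.

End FixedN.
End Coefficients.

(** * The laws satisfied by coefficients *)

Lemma shuffles_perm (T : eqType) (u v w : seq T) :
  w \in shuffles u v -> perm_eq w (u ++ v).
Proof.
elim: u v w => [|a u IHu] v w; first by rewrite inE => /eqP->.
elim: v w => [|b v IHv] w; first by rewrite shuffless0 inE cats0 => /eqP->.
rewrite shufflesE mem_cat => /orP[] /mapP[t h ->].
  by rewrite /= perm_cons; apply: IHu.
rewrite perm_sym -cat1s (perm_catCA (a :: u) [:: b] v) /= perm_cons perm_sym.
exact: IHv.
Qed.

Section CoefficientLaws.
Variables (R : comPzRingType) (k n : nat).
Local Notation V := 'rV[R]_n.
Local Notation V' := 'rV[R]_(n.+1).
Local Notation x := (@xvec R n).
Local Notation x' := (@xvec R n.+1).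
Local Notation word := (Kword k n).
Implicit Types (f g : Coalg R k n) (u v : seq word) (I : pred nat).

(** Polarization.  Replace x_i by x_i + x_n, where x_n is a new variable, and
    look at the monomial in which one occurrence of x_i has become x_n.  The
    value at the sum is the sum of the values at x_i and at x_n, and neither of
    these involves both variables. *)
Lemma monform_repeat f u I :
  ~~ uniq (flat u) -> monform R u (f (Vrow R n) (xpoint R n I)) = 0.
Proof.
case/(uniqPn 0%N) => p [q [pq qu]]; set i := nth 0%N (flat u) q => ip.
have iN : (i < n)%N by apply: flat_ltn (mem_nth _ qu).
have [Ii|] := boolP (I i); last by apply: monform_extra; exact: mem_nth.
(* the new variable is marked at the position q, the other occurrence of the
   letter i is at the position p *)
pose F t := if t == q then xform R n.+1 n else xform R n.+1 (nth 0%N (flat u)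
  t).
pose vsum j := if j == i then x' i + x' n else x' j.
pose vnew j := if j == i then x' n else x' j.
pose sub (z : nat -> V') := @xsubst R n V' z.
have natE z : flatform k (fun t => F t \o sub z : {linear V -> R^o}) (size u)
      (f (Vrow R n) (xpoint R n I)) =
    flatform k F (size u) (f (Vrow R n.+1) (cpoint z I n)).
  rewrite -flatform_natural -[tens_algebra_map _ _](@coalg_natural _ _ _ f
    (Vrow R n) (Vrow R n.+1) (sub z)).
  by rewrite cpoint_map; congr (flatform k F _ (f (Vrow R n.+1) _));
    apply: eq_cpoint => // j jn _;
     rewrite /= xsubst_xvec.
have Fx t j : (j < n)%N -> t != q -> F t (x' j) = (nth 0%N (flat u) t == j)%:R.
  by move=> jn /negPf tq; rewrite /F tq xform_xvec // ltnW.
have Fn t : (t < size (flat u))%N -> t != q -> F t (x' n) = 0.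
  move=> tu /negPf tq; rewrite /F tq xform_xvec //.
  by rewrite ltn_eqF // (flat_ltn (mem_nth 0%N tu)).
have Fq j : (j < n)%N -> F q (x' j) = 0.
  by move=> jn; rewrite /F eqxx xform_xvec ?(gtn_eqF jn) // ltnW.
have Fqn : F q (x' n) = 1 by rewrite /F eqxx xform_xvec // eqxx.
rewrite monform_flatform.
rewrite (eq_flatform (G := fun t => F t \o sub vsum : {linear V -> R^o}));
  last first.
  move=> t; rewrite -size_flat => tu; apply: row_ext => j jn.
  rewrite xform_xvec //= xsubst_xvec // /vsum.
  have [->|tq] := eqVneq t q.
    rewrite -/i [i == j]eq_sym; case: eqP => ji; last by rewrite Fq.
    by rewrite linearD /= Fq // Fqn add0r.
  have [->|ji] := eqVneq j i; last by rewrite Fx.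
  by rewrite linearD /= Fx // Fn // addr0.
rewrite natE (cpointD (i := i) (v1 := x') (v2 := vnew)) //; last first.
- by move=> j /negPf ji; rewrite /vnew /vsum ji.
- by move=> j /negPf ji; rewrite /vsum ji.
- by rewrite /vsum /vnew eqxx.
rewrite !linearD /= -!natE.
rewrite (@flatform_eq0 _ _ _ _ _ q) -?size_flat // => [|y]; last first.
  by rewrite (@row_ext _ _ _ (F q \o sub x') \0) // => j jn /=;
    rewrite xsubst_xvec // Fq.
rewrite (@flatform_eq0 _ _ _ _ _ p) -?size_flat ?(ltn_trans pq) ?addr0 // => y.
rewrite (@row_ext _ _ _ (F p \o sub vnew) \0) // => j jn /=;
  rewrite xsubst_xvec // /vnew.
have pq' : p != q by rewrite ltn_eqF.
case: eqP => [_|/eqP ji]; first by rewrite Fn // (ltn_trans pq).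
by rewrite Fx // ip eq_sym (negPf ji).
Qed.

Lemma coef_repeat f u : ~~ uniq (flat u) -> coef f u = 0.
Proof. exact: monform_repeat. Qed.

(** Killing the letters outside [u] on the left, and outside [v] on the right,
    does not change the left hand side, and then [comul_split] applies. *)
Lemma pairing_coef f g u v I :
  (forall i, (i < n)%N -> I i = (i \in flat u) || (i \in flat v)) ->
  (forall i, i \in flat u -> i \notin flat v) ->
  pairing (monform R u) (monform R v)
    (tmap (f (Vrow R n)) (g (Vrow R n)) (comul (CVpow V n) (xpoint R n I))) =
  coef f u * coef g v.
Proof.
move=> hI uv; have e Z : pairing (monform R u) (monform R v)
    (tmap (f (Vrow R n)) (g (Vrow R n)) Z) =
    pairing (monform R u) (monform R v) (tmap (f (Vrow R n)) (g (Vrow R n))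
      (tmap (CVpow_map (keep R n (mem (flat u))) n)
            (CVpow_map (keep R n (mem (flat v))) n) Z)).
  elim/tensW: Z => [|y z hy hz|c d]; first by rewrite !linear0.
    by rewrite !linearD hy hz.
  by rewrite !tmapE !pairingE !coalg_keep !monform_keep.
rewrite e /xpoint (@comul_split _ _ _ _ _ _ _ _ (mem (flat u)) (mem (flat v)))
  //.
- have keepx (w : seq word) :
      cpoint (keep R n (mem (flat w)) \o x) (mem (flat w)) n = xpoint R n (mem
        (flat w)).
    by apply: eq_cpoint => // i iN h; rewrite /= keep_xvec // h.
  by rewrite tmapE pairingE !keepx.
- by move=> i iN; apply: uv.
- by move=> i iN iu; rewrite keep_xvec // ifN // inE; exact: uv.
- move=> i iN iv; rewrite keep_xvec // ifN // inE.
  by apply: contraL iv => /uv.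
Qed.

Lemma coefM f g u : uniq (flat u) ->
  coef (Coalg_mul f g) u =
  \sum_(i < (size u).+1) coef f (take i u) * coef g (drop i u).
Proof.
move=> uu; pose A := tens_algebra (tens_pow V k).
have e Z : monform R u (mulmap A Z) = \sum_(i < (size u).+1)
    pairing (monform R (take i u)) (monform R (drop i u)) Z.
  elim/tensW: Z => [|y z hy hz|c d].
  - by rewrite !linear0 big1 // => i _; rewrite linear0.
  - by rewrite !linearD hy hz -big_split; apply: eq_bigr => i _;
    rewrite linearD.
  rewrite mulmapE /monform wordformM size_map; apply: eq_bigr => i _.
  by rewrite pairingE map_take map_drop.
rewrite {1}/coef [LHS]e; apply: eq_bigr => i _; apply: pairing_coef => j.
  by move=> _; rewrite -mem_cat -flat_cat cat_take_drop.
move=> ju; move: uu; rewrite -{1}(cat_take_drop i u) flat_cat cat_uniq.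
by case/and3P=> _ /hasPn h _; apply: contraTN ju => /h.
Qed.

Lemma coef_shuffle f u v : uniq (flat (u ++ v)) ->
  coef f u * coef f v = \sum_(w <- shuffles u v) coef f w.
Proof.
rewrite flat_cat cat_uniq => /and3P[_ /hasPn uv _].
rewrite -(@pairing_coef f f u v (mem (flat (u ++ v)))) //; last 2 first.
- by move=> i _; rewrite inE flat_cat mem_cat.
- by move=> i; apply: contraTN => /uv.
have [fM _] := coalg_coalgmap f (Vrow R n).
rewrite -[tmap _ _ _]fM [LHS]pairing_acomul shuffles_map big_map.
rewrite [RHS]big_seq [LHS]big_seq; apply: eq_bigr => w /shuffles_perm wuv.
rewrite /coef /monform; congr (wordform _ (f _ _)); apply: eq_xpoint => i _.
by rewrite !inE; apply/esym/perm_mem; rewrite /flat;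
  apply/perm_flatten/perm_map.
Qed.

Lemma tens_pow_row_decomp (a : tens_pow V k) :
  a = \sum_(w : word) (wform R k n (letters w) a : R) *: tpow (fun p => x (nth
    0%N (letters w) p)) k.
Proof.
pose G a := \sum_(w : word) (wform R k n (letters w) a : R) *: tpow (fun p => x
  (nth 0%N (letters w) p)) k.
have Glin : linear G.
  move=> r b c; rewrite /G scaler_sumr -big_split; apply: eq_bigr => w _.
  by rewrite linearP scalerDl scalerA.
have -> : a = (idfun : {linear tens_pow V k -> tens_pow V k}) a by [].
rewrite -/(G a) -(mklinE Glin); apply: row_pow_ext => l hl.
rewrite mklinE /G /=.
pose w0 : word := [tuple Ordinal (hl i (ltn_ord i)) | i < k].
have w0E p : (p < k)%N -> nth 0%N (letters w0) p = l p.
  move=> pk; rewrite (nth_map (Ordinal (hl p pk))) ?size_tuple //.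
  by rewrite -[p in LHS]/(val (Ordinal pk)) -tnth_nth tnth_mktuple.
rewrite (bigD1 w0) //= big1 => [|w ww0].
  rewrite addr0 {1}/wform tform_tpow big1 => [|p _]; first rewrite scale1r.
    by apply: eq_tpow => p pk /=; rewrite w0E.
  by rewrite /= xform_xvec ?hl // w0E // eqxx.
have [p pP] : exists p : 'I_k, nth 0%N (letters w) p != l p.
  apply/existsP; apply: contraNT ww0 => /existsPn h; apply/eqP/letters_inj.
  apply: (@eq_from_nth _ 0%N); rewrite ?size_letters // => p pk.
  by have := h (Ordinal pk); rewrite negbK w0E // => /eqP.
by rewrite /wform tform_tpow (bigD1 p) //= xform_xvec ?hl // (negPf pP) mul0r
  scale0r.
Qed.

(** Every pure tensor over a module W is the image of a tensor of basis
    vectors under a map from the free module on n generators, so that naturality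
    reduces the statement to that module. *)
Lemma coef_inj f g : (forall u, coef f u = coef g u) -> f = g.
Proof.
move=> fg; apply: Coalg_ext => W; apply: CVpow_ext => z J.
have -> : cpoint z J n = CVpow_map (@xsubst R n W z : {linear Vrow R n -> W}) n
  (xpoint R n J).
  by rewrite cpoint_map; apply: eq_cpoint => // i iN _; rewrite /= xsubst_xvec.
rewrite !coalg_natural; congr (TVwedge_map k _ _).
apply/eqP; rewrite -subr_eq0; apply/eqP.
apply: (wordform_separation (l := fun w : word => wform R k n (letters w))
  tens_pow_row_decomp).
move=> u; rewrite linearB /= -/(monform R u); apply/eqP; rewrite subr_eq0;
  apply/eqP.
have [uu|uu] := boolP (uniq (flat u)); last by rewrite !monform_repeat.
have [/existsP[i]|/existsPn h] := boolP [exists i : 'I_n, J i != (val i \in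
  flat u)]; last first.
  rewrite (_ : xpoint R n J = xpoint R n (mem (flat u))); first exact: fg.
  by apply: eq_xpoint => i iN; have := h (Ordinal iN); rewrite negbK => /eqP.
case: (boolP (val i \in flat u)) => iu Ji.
  by rewrite !(monform_extra _ iu) //; move: Ji; case: (J i).
by rewrite !(monform_missing _ (ltn_ord i) _ iu) //; move: Ji; case: (J i).
Qed.

End CoefficientLaws.

(** * Generators and restriction to a set of letters *)

Section Generators.
Variables (R : comPzRingType) (k n : nat).
Hypothesis k_gt0 : (0 < k)%N.
Local Notation word := (Kword k n).

Section GenMap.
Variables (l : nat -> nat) (r : R).

Fact gen_fun_linear (V : lmodType R) : linear (fun y : CVpow V n =>
  (counit (CVpow V n) y : R) *: aone (tens_algebra (tens_pow V k)) +
  r *: agen _ (pickmap V l n k y)).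
Proof.
move=> s y z; rewrite !linearP /= scalerDl addrACA; congr (_ + _).
by rewrite [in RHS]scalerA mulrC.
Qed.

(** The map of C(V)^(x)n to T(V^(x)k) with components the counit and [r] times
    the projection that picks the slots [l]; it represents 1 + r w. *)
Definition gen_fun (V : lmodType R) : {linear CVpow V n -> TVwedge k V} :=
  mklin (@gen_fun_linear V).

Lemma gen_funE V y : gen_fun V y =
  (counit (CVpow V n) y : R) *: aone (tens_algebra (tens_pow V k)) +
  r *: agen _ (pickmap V l n k y).
Proof. exact: mklinE. Qed.

(** For f = u + r q with u the unit and q valued in primitive elements, the
    two sides differ by r^2 (q ⊗ q) after the comultiplication, which is zero by
    [pickmap_square]. *)
Fact gen_fun_coalgmap (V : lmodType R) : is_coalgmap (gen_fun V).
Proof.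
split=> y; rewrite gen_funE; last first.
  rewrite linearD !linearZ /= acounit1 acounit_gen scaler0 addr0.
  exact: mulr1.
set C := CVpow V n; set T := tens_algebra (tens_pow V k).
pose u : {linear C -> T} := conv_one C T.
pose q : {linear C -> T} := agen _ \o pickmap V l n k.
have e Z : tmap (gen_fun V) (gen_fun V) Z =
    tmap u u Z + r *: tmap q u Z + r *: tmap u q Z + (r * r) *: tmap q q Z.
  elim/tensW: Z => [|y1 y2 h1 h2|c d].
  - by rewrite !linear0 !addr0.
  - rewrite !linearD h1 h2.
    by do 3! (rewrite addrACA; congr (_ + _)).
  rewrite !tmapE !gen_funE -!conv_oneE !(tpureDl, tpureDr, tpureZl, tpureZr).
  by rewrite scalerA addrACA addrA.
have uu Z : tmap u u Z = (counit C (tunitl _ (tmap (counit C) idfun Z)) : R) *: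
  tpure (aone T) (aone T).
  elim/tensW: Z => [|y1 y2 h1 h2|c d]; first by rewrite !linear0 scale0r.
    by rewrite !linearD h1 h2 scalerDl.
  by rewrite !tmapE tunitlE linearZ /= !mklinE tpureZl tpureZr scalerA.
have qu Z : tmap q u Z = tpure (q (tunitr _ (tmap idfun (counit C) Z))) (aone
  T).
  elim/tensW: Z => [|y1 y2 h1 h2|c d]; first by rewrite !linear0 tpure0l.
    by rewrite !linearD h1 h2 tpureDl.
  by rewrite !tmapE tunitrE linearZ tpureZl [u d]conv_oneE tpureZr.
have uq Z : tmap u q Z = tpure (aone T) (q (tunitl _ (tmap (counit C) idfun
  Z))).
  elim/tensW: Z => [|y1 y2 h1 h2|c d]; first by rewrite !linear0 tpure0r.
    by rewrite !linearD h1 h2 tpureDr.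
  by rewrite !tmapE tunitlE linearZ tpureZr [u c]conv_oneE tpureZl.
have [k' ek] : exists k', k = k'.+1 by case: (k) k_gt0 => // k' _; exists k'.
have qq : tmap q q (comul C y) = 0.
  transitivity (tmap (agen _) (agen _)
      (tmap (pickmap V l n k) (pickmap V l n k) (comul C y))).
    by rewrite tmap_comp.
  by rewrite [X in tmap _ _ X](_ : _ = 0) ?linear0 // ek; exact: pickmap_square.
rewrite e uu qu uq comul1r comul1l qq scaler0 addr0 linearD !linearZ.
by rewrite -addrA -scalerDr; congr (_ *: _ + _ *: _);
  [exact: acomul1|exact: acomul_gen].
Qed.

Fact gen_fun_natural (V W : freeModType R) (phi : {linear V -> W}) y :
  gen_fun W (CVpow_map phi n y) = TVwedge_map k phi (gen_fun V y).
Proof.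
have [p1 pM] := tens_algebra_map_algmap (tens_pow_map phi k).
have [_ h1] := CVpow_map_coalgmap phi n.
rewrite !gen_funE linearD !linearZ /= /TVwedge_map p1 tens_algebra_map_gen.
by rewrite h1 pickmap_natural.
Qed.

Definition gen_of : Coalg R k n :=
  @MkCoalg R k n (fun V => gen_fun V) (fun V => gen_fun_coalgmap V)
    gen_fun_natural.

End GenMap.

Definition gen (w : word) (r : R) : Coalg R k n := gen_of (fun p => nth 0%N
  (letters w) p) r.

(** Only the monomial made of the picked slots survives. *)
Lemma pickmap_coef (l : nat -> nat) (s : seq nat) m :
  (m <= size s)%N -> uniq s -> (forall i, i \in s -> (i < n)%N) ->
  tform (fun p => xform R n (nth 0%N s p)) m
    (pickmap _ l n m (xpoint R n (mem (take m s)))) =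
  [forall p : 'I_m, l p == nth 0%N s p]%:R.
Proof.
move=> + us sn; elim: m => [_|m IH ms].
  rewrite take0 [LHS]counit_cpoint has_pred0; apply/esym/eqP.
  by rewrite (_ : [forall _, _] = true) //; apply/forallP => -[].
set sm := nth 0%N s m; set kp := keep R n (mem (take m s)).
set k1 := keep R n (pred1 sm).
have smn : (sm < n)%N by apply/sn/mem_nth.
have e Z : tform (fun p => xform R n (nth 0%N s p)) m.+1
      (tmap (pickmap _ l n m) (slot _ (l m) n) Z) =
    tform (fun p => xform R n (nth 0%N s p)) m.+1
      (tmap (pickmap _ l n m) (slot _ (l m) n)
        (tmap (CVpow_map kp n) (CVpow_map k1 n) Z)).
  elim/tensW: Z => [|y z hy hz|c d]; first by rewrite !linear0.
    by rewrite !linearD hy hz.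
  rewrite !tmapE !tformS slot_natural pickmap_natural tform_map; congr (_ * _).
    rewrite (eq_tform (l' := fun p => xform R n (nth 0%N s p) \o kp : {linear _
      -> _})) //.
    move=> p pm y /=; rewrite xform_keep ifT //.
    by rewrite -(nth_take 0%N pm); apply: mem_nth; rewrite size_takel // ltnW.
  by rewrite xform_keep /= eqxx.
rewrite [LHS]e /xpoint.
have smNt : sm \notin take m s.
  by have := take_uniq m.+1 us; rewrite (take_nth 0%N) // rcons_uniq => /andP[].
rewrite (@comul_split _ _ _ _ _ _ _ _ (mem (take m s)) (pred1 sm));
  last 4 first.
- by move=> i _; rewrite /= (take_nth 0%N) // mem_rcons inE orbC.
- by move=> i _ im; apply: contraNneq smNt => <-.
- move=> i iN im; rewrite keep_xvec // ifN //=.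
  by apply: contraNneq smNt => <-.
- by move=> i iN /= /eqP->; rewrite keep_xvec // ifN.
have -> : cpoint (kp \o xvec R n) (mem (take m s)) n = xpoint R n (mem (take m
  s)).
  by apply: eq_cpoint => // i iN h; rewrite /= keep_xvec // h.
have -> : cpoint (k1 \o xvec R n) (pred1 sm) n = xpoint R n (pred1 sm).
  by apply: eq_cpoint => // i iN h; rewrite /= keep_xvec // h.
rewrite tmapE tformS IH; last exact: ltnW.
rewrite slot_cpoint -/sm.
have -> : (xform R n sm (if (l m < n)%N && all (fun j => pred1 sm j == (j == l
  m)) (iota 0 n)
    then xvec R n (l m) else 0) : R) = (l m == sm)%:R.
  have [->|ne] := eqVneq (l m) sm.
    rewrite smn ifT ?xform_xvec ?eqxx //.
    by apply/allP => j _; rewrite /= eqxx.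
  case: ifP => [/andP[lmn _]|_]; last by rewrite linear0.
  by rewrite xform_xvec // eq_sym (negPf ne).
rewrite -natrM mulnb; congr (_%:R); congr nat_of_bool.
apply/andP/forallP => [[/forallP h /eqP hm] p|h].
  have := ltn_ord p; rewrite ltnS leq_eqVlt => /predU1P[->|pm];
    first by rewrite hm.
  exact: (h (Ordinal pm)).
split; last exact: (h ord_max).
by apply/forallP => p; exact: (h (widen_ord (leqnSn m) p)).
Qed.

Lemma coef_gen w r u : uniq (flat u) ->
  coef (gen w r) u = (u == [::])%:R + r * (u == [:: w])%:R.
Proof.
case: u => [|v u] uu; first by rewrite coef_nil mulr0 addr0.
rewrite /coef [X in monform _ _ X]gen_funE /monform map_cons.
rewrite linearD !linearZ wordform_aone wordform_gen size_map.
rewrite [X in X + _](mulr0 (_ : R)); congr (0 + r * _).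
rewrite eqseq_cons; case: u uu => [|v' u] uu; last by rewrite andbF mulr0.
rewrite !andbT mulr1.
have fv : flat [:: v] = letters v by exact: cats0.
rewrite fv in uu *.
have e := @pickmap_coef (fun p => nth 0%N (letters w) p) (letters v) k.
rewrite size_letters take_oversize ?size_letters // in e.
rewrite [LHS]e //; last by move=> i; rewrite -fv => /flat_ltn.
congr (_%:R); congr nat_of_bool; apply/forallP/eqP => [h|-> //].
apply/esym/letters_inj/(@eq_from_nth _ 0%N); first by rewrite !size_letters.
by move=> p; rewrite size_letters => pk; have /eqP := h (Ordinal pk).
Qed.

End Generators.

Section SlotRestriction.
Variables (R : comPzRingType) (k n : nat) (b : pred nat).

(** The slots outside [b] are composed with the counit, which is the map
    induced by 0 : V -> V. *)
Fixpoint slotkeep (V : lmodType R) m : {linear CVpow V m -> CVpow V m} :=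
  match m with
  | 0 => idfun
  | m'.+1 => tmap (slotkeep V m')
      (if b m' then (idfun : {linear prim_coalg V -> prim_coalg V})
       else prim_map (\0 : {linear V -> V}))
  end.

Lemma slotkeep_cpoint (V : lmodType R) (v : nat -> V) (I : pred nat) m :
  slotkeep V m (cpoint v I m) = cpoint (fun i => if b i then v i else 0) I m.
Proof.
elim: m => [//|m IH] /=; rewrite tmapE IH; congr tpure.
by case: (b m); case: (I m) => //=; rewrite ?prim_map_inj ?prim_map1.
Qed.

Lemma slotkeep_coalgmap (V : lmodType R) m : is_coalgmap (slotkeep V m).
Proof.
elim: m => [|m IH]; first exact: (idfun_coalgmap (base_coalg R)).
apply: tmap_coalgmap => //; case: (b m); first exact: idfun_coalgmap.
exact: prim_map_coalgmap.
Qed.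

Lemma slotkeep_natural (V W : lmodType R) (phi : {linear V -> W}) m y :
  slotkeep W m (CVpow_map phi m y) = CVpow_map phi m (slotkeep V m y).
Proof.
apply: (@CVpow_ext _ V m _ (slotkeep W m \o CVpow_map phi m)
  (CVpow_map phi m \o slotkeep V m)) => v I /=.
rewrite cpoint_map !slotkeep_cpoint cpoint_map; apply: eq_cpoint => // i _ _ /=.
by case: (b i); rewrite ?linear0.
Qed.

Variable f : Coalg R k n.

Fact kept_coalgmap (V : freeModType R) :
  is_coalgmap (f V \o slotkeep V n : {linear CVpow V n -> TVwedge k V}).
Proof.
have [hM h1] := slotkeep_coalgmap V n.
have [fM f1] := coalg_coalgmap f V; split=> y /=; last by rewrite f1 h1.
by rewrite fM hM tmap_comp.
Qed.

Fact kept_natural (V W : freeModType R) (phi : {linear V -> W}) y :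
  f W (slotkeep W n (CVpow_map phi n y)) =
  TVwedge_map k phi (f V (slotkeep V n y)).
Proof. by rewrite slotkeep_natural coalg_natural. Qed.

(** The restriction of [f] to the letters in [b]. *)
Definition kept : Coalg R k n := @MkCoalg R k n
  (fun V => f V \o slotkeep V n : {linear CVpow V n -> TVwedge k V})
  kept_coalgmap kept_natural.

Lemma coef_kept u : coef kept u = if all b (flat u) then coef f u else 0.
Proof.
rewrite /coef /= slotkeep_cpoint; case: ifPn => [/allP h|/allPn[i iu bi]].
  by rewrite (@eq_cpoint _ _ _ (xvec R n) _ (mem (flat u))) // => i _ iu;
    rewrite h.
by rewrite (@cpoint0 _ _ _ _ _ i) ?linear0 ?(flat_ltn iu) // ifN.
Qed.

End SlotRestriction.

(** * Commutators and their leading coefficients *)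

Section AbstractGroups.
Variable G : abstractGroup.
Implicit Types x y : G.

Lemma gmulgV x : gmul x (ginv x) = gone G.
Proof.
rewrite -[gmul x _](@gmul1 G) -(@gmulV G (ginv x)) -gmulA; congr gmul.
by rewrite gmulA gmulV gmul1.
Qed.

Lemma gmulg1 x : gmul x (gone G) = x.
Proof. by rewrite -(gmulV x) gmulA gmulgV gmul1. Qed.

Definition gconj x y := gmul (ginv y) (gmul x y).
Definition gcomm x y := gmul (ginv x) (gconj x y).

Lemma gmul_eq1_inv x y : gmul x y = gone G -> y = ginv x.
Proof. by move=> h; rewrite -[ginv x]gmulg1 -h gmulA gmulV gmul1. Qed.

Variables (X : Type) (phi : X -> G).

Fixpoint gvalue (a : gterm X) : G :=
  match a with
  | GGen x => phi x
  | GOne => gone G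
  | GMul a b => gmul (gvalue a) (gvalue b)
  | GInv a => ginv (gvalue a)
  end.

Lemma gvalue_itercomm a s :
  gvalue (itercomm a s) = foldl gcomm (gvalue a) (map gvalue s).
Proof. by elim: s a => [//|b s IH] a; rewrite [LHS]IH. Qed.

Lemma gvalue_geq (rel : gterm X -> gterm X -> Prop) :
  (forall a b : gterm X, rel a b -> gvalue a = gvalue b) ->
  forall a b : gterm X, Defs.geq rel a b -> gvalue a = gvalue b.
Proof.
move=> hrel a b; elim=> //=.
- by move=> {}a {}b c _ -> _ ->.
- by move=> {}a a' {}b b' _ -> _ ->.
- by move=> {}a a' _ ->.
- by move=> {}a {}b c; rewrite gmulA.
- by move=> {}a; rewrite gmul1.
- by move=> {}a; rewrite gmulg1.
- by move=> {}a; rewrite gmulV.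
- by move=> {}a; rewrite gmulgV.
Qed.

End AbstractGroups.

(** In every shuffle but the one that starts with all of [a], the word [w]
    occurs earlier. *)
Lemma shuffles_head (T : eqType) (w : T) (a b : seq T) :
  exists2 rest, shuffles a (w :: b) = (a ++ w :: b) :: rest &
    forall t, t \in rest ->
      exists a1 b1, t = a1 ++ w :: b1 /\ (size a1 < size a)%N.
Proof.
elim: a => [|c a [rest e h]]; first by exists [::].
rewrite shufflesE e map_cons cat_cons; eexists; first by [].
move=> t; rewrite mem_cat => /orP[] /mapP[t' ht' ->].
  by have [a1 [b1 [-> lt]]] := h _ ht'; exists (c :: a1), b1.
by exists [::], t'.
Qed.

Section Leading.
Variables (R : comPzRingType) (k n : nat).
Local Notation word := (Kword k n).
Local Notation CG := (CoalgGroup R k n).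
Implicit Types (f g x y : Coalg R k n) (u v s : seq word) (w : word).
Local Notation one := (Coalg_one R k n).

Lemma coef_one u : coef one u = (u == [::])%:R.
Proof.
case: u => [|w u]; first exact: coef_nil.
have e (z : CVpow (Vrow R n) n) : monform R (w :: u)
    (conv_one (CVpow 'rV[R]_n n) (tens_algebra (tens_pow 'rV[R]_n k)) z) = 0.
  by rewrite conv_oneE linearZ /monform wordform_aone; exact: mulr0.
exact: e.
Qed.

(** Equality of the coefficients that do not involve the letter [j].  The maps
    equal to 1 in this sense form the normal subgroup associated with [j]. *)
Definition eq_avoid j f g := forall u, j \notin flat u -> coef f u = coef g u.

Lemma mem_flat_take j i u : j \in flat (take i u) -> j \in flat u.
Proof. by move=> h; rewrite -(cat_take_drop i u) flat_cat mem_cat h. Qed.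

Lemma mem_flat_drop j i u : j \in flat (drop i u) -> j \in flat u.
Proof. by move=> h; rewrite -(cat_take_drop i u) flat_cat mem_cat h orbT. Qed.

Lemma eq_avoidM j f f' g g' :
  eq_avoid j f f' -> eq_avoid j g g' -> eq_avoid j (Coalg_mul f g) (Coalg_mul
    f' g').
Proof.
move=> hf hg u ju; have [uu|uu] := boolP (uniq (flat u));
  last by rewrite !coef_repeat.
rewrite !coefM //; apply: eq_bigr => i _; congr (_ * _).
  by apply: hf; apply: contra ju; apply: mem_flat_take.
by apply: hg; apply: contra ju; apply: mem_flat_drop.
Qed.

Lemma eq_avoidV j f : eq_avoid j f one -> eq_avoid j (Coalg_inv f) one.
Proof.
move=> hf u ju.
have /(_ u ju) := @eq_avoidM j (Coalg_inv f) (Coalg_inv f) f one (fun _ _ =>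
  erefl) hf.
by rewrite [Coalg_mul _ f](@gmulV CG) [Coalg_mul _ one](@gmulg1 CG).
Qed.

Lemma eq_avoid_conj j x y : eq_avoid j x one -> eq_avoid j (@gconj CG x y) one.
Proof.
move=> hx u ju.
have hxy := @eq_avoidM j x one y y hx (fun _ _ => erefl).
have /(_ u ju) := @eq_avoidM j (Coalg_inv y) _ _ _ (fun _ _ => erefl) hxy.
by rewrite [Coalg_mul one _](@gmul1 CG) [Coalg_mul (Coalg_inv _) y](@gmulV CG).
Qed.

Lemma coefM_cons f g w s : uniq (flat (w :: s)) ->
  coef (Coalg_mul f g) (w :: s) = coef g (w :: s) +
  \sum_(i < (size s).+1) coef f (w :: take i s) * coef g (drop i s).
Proof.
by move=> us; rewrite coefM // big_ord_recl /= coef_nil mul1r.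
Qed.

Lemma drop_free j w s i : uniq (flat (w :: s)) -> j \in letters w -> j \notin
  flat (drop i s).
Proof.
rewrite [flat _]/= cat_uniq => /and3P[_ /hasPn h _] jw; apply: contraL jw => jd.
by apply: h; apply: mem_flat_drop jd.
Qed.

(** If [g] is trivial off [j], then a word with [j] at the front leaves [g] only
    the empty sequence. *)
Lemma coefM_free j f g w s : j \in letters w -> eq_avoid j g one ->
  coef (Coalg_mul f g) (w :: s) = coef f (w :: s) + coef g (w :: s).
Proof.
move=> jw hg; have [us|us] := boolP (uniq (flat (w :: s))); last first.
  by rewrite !coef_repeat ?addr0.
rewrite coefM_cons // addrC; congr (_ + _).
rewrite big_ord_recr /= drop_size take_size coef_nil mulr1 big1 ?add0r // => i
  _.
rewrite hg ?(drop_free _ us jw) // coef_one.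
by rewrite -size_eq0 size_drop subn_eq0 leqNgt ltn_ord mulr0.
Qed.

Lemma coef_inv_free j f w s : j \in letters w -> eq_avoid j f one ->
  coef (Coalg_inv f) (w :: s) = - coef f (w :: s).
Proof.
move=> jw hf; apply/eqP; rewrite -addr_eq0 -(coefM_free _ _ jw hf).
by rewrite [Coalg_mul _ _](@gmulV CG) coef_one.
Qed.

(** The factor inverse to [y] only contributes through the product of the
    inverse of [y] with [y], because [x y] and [y] agree off [j]. *)
Lemma coef_conj j x y w s : j \in letters w -> eq_avoid j x one -> uniq (flat
  (w :: s)) ->
  coef (@gconj CG x y) (w :: s) =
  \sum_(i < (size s).+1) coef x (w :: take i s) * coef y (drop i s).
Proof.
move=> jw hx us; rewrite [LHS]coefM_cons //.
have hxy := @eq_avoidM j x one y y hx (fun _ _ => erefl).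
rewrite [Coalg_mul one y](@gmul1 CG) in hxy.
have : coef (Coalg_mul (Coalg_inv y) y) (w :: s) = 0.
  by rewrite [Coalg_mul _ _](@gmulV CG) coef_one.
rewrite coefM_cons // => h; rewrite [X in X + _](coefM_cons x y us).
apply: etrans (addr0 _); rewrite -[X in _ = _ + X]h [RHS]addrCA addrA;
  congr (_ + _).
by apply: eq_bigr => i _; rewrite hxy // (drop_free _ us jw).
Qed.

(** For a coefficient at a ++ w :: b with [j] in [w] and [a] nonempty, the
    shuffle identity for [a] and [w :: b] has a zero left hand side, and it
    expresses this coefficient by those in which [w] occurs earlier. *)
Lemma leading_inj j f g : eq_avoid j f one -> eq_avoid j g one ->
  (forall w s, j \in letters w -> uniq (flat (w :: s)) -> coef f (w :: s) =
    coef g (w :: s)) ->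
  f = g.
Proof.
move=> hf hg fg; apply: coef_inj => u.
have [|ju] := boolP (j \in flat u); last by rewrite hf ?hg.
case/flattenP => _ /mapP[w wu ->] jw; case/splitPr: wu => a b.
have [m] := ubnP (size a); elim: m a b => // m IH a b am.
have [us|us] := boolP (uniq (flat (a ++ w :: b))); last by rewrite !coef_repeat.
case: a => [|c a] in am us *; first exact: fg.
have ja : j \notin flat (c :: a).
  move: us; rewrite flat_cat cat_uniq => /and3P[_ /hasPn h _].
  by apply: h; rewrite mem_cat jw.
have [rest e h] := shuffles_head w (c :: a) b.
have lead x : eq_avoid j x one -> coef x ((c :: a) ++ w :: b) = - \sum_(t <-
  rest) coef x t.
  move=> hx; apply/eqP; rewrite -addr_eq0.
  have := coef_shuffle x us; rewrite e big_cons => <-.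
  by rewrite hx // coef_one mul0r.
rewrite !lead //; congr (- _); rewrite big_seq [RHS]big_seq.
apply: eq_bigr => t /h[a1 [b1 [-> lt]]]; apply: IH.
exact: leq_trans lt _.
Qed.

Section Commutators.
Hypothesis k_gt0 : (0 < k)%N.
Local Notation gen w r := (@gen R k n k_gt0 w r).

Lemma gen_free j w r : j \in letters w -> eq_avoid j (gen w r) one.
Proof.
move=> jw u ju; have [uu|uu] := boolP (uniq (flat u)); last first.
  by rewrite !coef_repeat.
rewrite coef_gen // coef_one; case: (u =P [:: w]) => [eu|_];
  last by rewrite mulr0 addr0.
by move: ju; rewrite eu /flat /= cats0 jw.
Qed.

Definition gencomm (w : word) (r : R) (l : seq (word * R)) : CG :=
  foldl (@gcomm CG) (gen w r) [seq gen p.1 p.2 | p <- l].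

Lemma gencomm_free j w r l : j \in letters w -> eq_avoid j (gencomm w r l) one.
Proof.
move=> jw; elim/last_ind: l => [|l p IH]; first exact: gen_free.
rewrite /gencomm map_rcons foldl_rcons -/(gencomm w r l).
have := @eq_avoidM j _ _ _ _ (eq_avoidV IH) (@eq_avoid_conj j _ (gen p.1 p.2)
  IH).
by rewrite [Coalg_mul one _](@gmul1 CG).
Qed.

(** Commutation with a generator 1 + t b subtracts the identity from the right
    multiplication by 1 + t b: each leading coefficient is multiplied by t and
    moved from w :: s to w :: rcons s b. *)
Lemma coef_gencomm j w r l (v : word) s : j \in letters w -> j \in letters v ->
  uniq (flat (v :: s)) ->
  coef (gencomm w r l) (v :: s) =
  (r * \prod_(p <- l) p.2) * (v :: s == w :: map fst l)%:R.
Proof.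
move=> jw jv; elim/last_ind: l s => [|l [b t] IH] s us.
  by rewrite coef_gen // big_nil mulr1 add0r.
rewrite /gencomm map_rcons foldl_rcons -/(gencomm w r l) -[(b, t).1]/b -[(b,
  t).2]/t.
have hf := @gencomm_free j w r l jw.
rewrite [LHS](coefM_free _ _ jv (@eq_avoid_conj j _ _ hf)) (coef_inv_free _ jv
  hf).
rewrite (coef_conj _ jv hf us).
have usi i : uniq (flat (v :: take i s)).
  by move: us; rewrite -{1}(cat_take_drop i s) -cat_cons flat_cat cat_uniq =>
    /andP[].
have usd i : uniq (flat (drop i s)).
  move: us; rewrite -{1}(cat_take_drop i s) -cat_cons flat_cat cat_uniq.
  by case/and3P.
have -> : \sum_(i < (size s).+1) coef (gencomm w r l) (v :: take i s) *
      coef (gen b t) (drop i s) =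
    coef (gencomm w r l) (v :: s) + \sum_(i < (size s).+1)
      coef (gencomm w r l) (v :: take i s) * (t * (drop i s == [:: b])%:R).
  rewrite (eq_bigr (fun i : 'I_(size s).+1 =>
     coef (gencomm w r l) (v :: take i s) * (drop i s == [::])%:R +
     coef (gencomm w r l) (v :: take i s) * (t * (drop i s == [:: b])%:R)));
       last first.
    by move=> i _; rewrite coef_gen // mulrDr.
  rewrite big_split /=; congr (_ + _).
  rewrite big_ord_recr /= drop_size take_size mulr1 big1 ?add0r // => i _.
  by rewrite -size_eq0 size_drop subn_eq0 leqNgt ltn_ord mulr0.
rewrite addrA addNr add0r map_rcons -!cats1 big_cat big_seq1 -[(b, t).1]/b
  -[(b, t).2]/t.
have [e|ne] := eqVneq (v :: s) (w :: (map fst l ++ [:: b])).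
  case: e => vw es; subst v s; rewrite mulr1 {usi usd}.
  have lt : (size l < (size (map fst l ++ [:: b])).+1)%N.
    by rewrite size_cat size_map addn1 ltnS leqnSn.
  rewrite (bigD1 (Ordinal lt)) //= take_size_cat ?size_map // drop_size_cat
    ?size_map //.
  rewrite eqxx mulr1 IH ?eqxx ?mulr1; last first.
    by move: us; rewrite -cat_cons flat_cat cat_uniq => /andP[].
  rewrite -mulrA [X in _ + X]big1 ?addr0 // => -[i il] ne;
    rewrite [nat_of_ord _]/=.
  case: eqP => [e|_]; last by rewrite !mulr0.
  case/eqP: ne; apply: val_inj => /=.
  have h : ((size l).+1 - i = 1)%N.
    by have := congr1 size e;
      rewrite size_drop [size (_ ++ _)]size_cat size_map addn1.
  have : (i < (size l).+1)%N by rewrite -subn_gt0 h.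
  by move/ltnW/subnK; rewrite h add1n => -[].
rewrite mulr0 big1 // => i _; rewrite IH //.
have [e1|_] := eqVneq (v :: take i s) (w :: map fst l);
  last by rewrite !mulr0 mul0r.
have [e2|_] := eqVneq (drop i s) [:: b]; last by rewrite !mulr0.
by case/eqP: ne; rewrite -(cat_take_drop i s) e2 -cat_cons e1.
Qed.

Lemma word_letter (w : word) : nth 0%N (letters w) 0 \in letters w.
Proof. by apply: mem_nth; rewrite size_letters. Qed.

Lemma uniq_flat (u : seq word) : uniq (flat u) = uniq (flatten [seq tval w | w
  <- u]).
Proof.
rewrite /flat -(map_inj_uniq val_inj) map_flatten -map_comp //.
Qed.

Definition gvalueK : gterm (word * R) -> CG :=
  gvalue (fun p : word * R => gen p.1 p.2 : CG).

Lemma gvalueK_itercomm (p : word * R) (l : seq (word * R)) :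
  gvalueK (itercomm (Kgen p) (map (@Kgen R k n) l)) = gencomm p.1 p.2 l.
Proof. by rewrite /gvalueK gvalue_itercomm -map_comp. Qed.

(** Both sides of a relation are trivial off a letter of their first word,
    hence are determined by their leading coefficients. *)
Lemma gvalueK_rel a b : Krel a b -> gvalueK a = gvalueK b.
Proof.
case=> {a b}.
- move=> w r s; have jw := word_letter w; set j := nth _ _ _ in jw.
  apply: (@leading_inj j); first 1 last.
  + exact: gen_free.
  + move=> v t jv us;
    rewrite [LHS](coefM_free _ _ jv (gen_free _ jw)) !coef_gen //=.
    by rewrite !add0r mulrDl.
  have := @eq_avoidM j _ _ _ _ (@gen_free j w r jw) (@gen_free j w s jw).
  by rewrite [Coalg_mul one _](@gmul1 CG).
- move=> w r uw; have jw := word_letter w; set j := nth _ _ _ in jw.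
  apply: (@leading_inj j) => //; first exact: gen_free.
  move=> v s jv us; rewrite coef_one coef_gen //= add0r.
  have [[vw es]|_] := eqVneq (v :: s) [:: w]; last by rewrite mulr0.
  by move: us; rewrite uniq_flat /= vw es cats0 (negPf uw).
- move=> p s us; rewrite gvalueK_itercomm.
  have jw := word_letter p.1; set j := nth _ _ _ in jw.
  apply: (@leading_inj j) => //; first exact: gencomm_free.
  move=> v t jv ut; rewrite coef_one (coef_gencomm _ _ jw) //=.
  have [e|_] := eqVneq (v :: t) _; last by rewrite mulr0.
  by move: ut us; rewrite uniq_flat e /= -map_comp => ->.
- move=> p p' s s' /= [ew es]; rewrite !big_cons => er;
  rewrite !gvalueK_itercomm.
  have jw := word_letter p.1; set j := nth _ _ _ in jw.
  apply: (@leading_inj j); [exact: gencomm_free|by apply: gencomm_free;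
    rewrite -ew|].
  move=> v t jv ut; rewrite !(@coef_gencomm j) -?ew //.
  by rewrite er es.
Qed.

End Commutators.
End Leading.

(** * The isomorphism *)

Section Realization.
Variables (R : comPzRingType) (k n : nat).
Hypothesis k_gt0 : (0 < k)%N.
Local Notation word := (Kword k n).
Local Notation K := (Kgroup R k n).
Local Notation CG := (CoalgGroup R k n).
Local Notation one := (Coalg_one R k n).
Local Notation gen w r := (@gen R k n k_gt0 w r).
Implicit Types (w v : word) (s t u : seq word) (r : R) (g h : K).

(** The homomorphism e of the theorem. *)
Definition realize : K -> CG := qlift (gvalueK k_gt0).

Lemma realizeE a : realize (pgcls (@Krel R k n) a) = gvalueK k_gt0 a.
Proof.
by apply: qliftE; apply: gvalue_geq; exact: gvalueK_rel.
Qed.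

Lemma realizeM g h : realize (g * h)%g = Coalg_mul (realize g) (realize h).
Proof.
elim/Defs.quotW: g => a; elim/Defs.quotW: h => b; rewrite -!/(pgcls _ _).
by rewrite [(_ * _)%g]pgmulE !realizeE.
Qed.

Lemma realize1 : realize 1%g = one.
Proof. by rewrite [1%g]/(pgcls _ 1%g) realizeE. Qed.

Lemma realize_pow w r : realize (Kpow w r) = gen w r.
Proof. by rewrite [Kpow _ _]/(pgcls _ _) realizeE. Qed.

Definition Kcomm w r s : K := itercomm (Kpow w r) [seq Kpow a 1 | a <- s].

Lemma KcommE w r s : Kcomm w r s = pgcls (@Krel R k n)
  (itercomm (Kgen (w, r)) (map (@Kgen R k n) [seq (a, 1) | a <- s])).
Proof. by rewrite pgcls_itercomm -map_comp. Qed.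

Lemma realize_Kcomm w r s : realize (Kcomm w r s) = gencomm k_gt0 w r [seq (a,
  1) | a <- s].
Proof. by rewrite KcommE realizeE gvalueK_itercomm. Qed.

Lemma Kcomm_free j w r s : j \in letters w -> eq_avoid j (realize (Kcomm w r
  s)) one.
Proof. by move=> jw; rewrite realize_Kcomm; apply: gencomm_free. Qed.

Lemma coef_Kcomm j w r s v t : j \in letters w -> j \in letters v -> uniq (flat
  (v :: t)) ->
  coef (realize (Kcomm w r s)) (v :: t) = r * (v :: t == w :: s)%:R.
Proof.
move=> jw jv ut; rewrite realize_Kcomm (coef_gencomm _ _ _ jw) // -map_comp
  map_id.
by rewrite big_map big1 ?mulr1.
Qed.

Lemma KpowD w r r' : Kpow w (r + r') = (Kpow w r * Kpow w r')%g.
Proof. by apply/esym; rewrite [LHS]pgmulE; apply/clsP/geq_rel/Krel_add. Qed.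

Lemma Kpow0 w : Kpow w 0 = 1%g :> K.
Proof. by apply: (mulgI (Kpow w 0)); rewrite -KpowD addr0 mulg1. Qed.

Lemma KpowN w r : Kpow w (- r) = ((Kpow w r)^-1)%g.
Proof. by apply/esym/mulg1_eq; rewrite -KpowD addrN Kpow0. Qed.

Lemma Kcomm_repeat w r s : ~~ uniq (flat (w :: s)) -> Kcomm w r s = 1%g.
Proof.
rewrite uniq_flat => us; rewrite KcommE; apply/clsP/geq_rel/Krel_repeat.
by rewrite /= -map_comp.
Qed.

(** The scalar [r'] moves to the first word by the third relation. *)
Lemma Kcomm_rcons w r s v r' : [~ Kcomm w r s, Kpow v r']%g = Kcomm w (r * r')
  (rcons s v).
Proof.
have -> : [~ Kcomm w r s, Kpow v r']%g = pgcls (@Krel R k n)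
    (itercomm (Kgen (w, r)) (map (@Kgen R k n) (rcons [seq (a, 1) | a <- s] (v,
      r')))).
  rewrite pgcls_itercomm map_rcons -map_comp /itercomm foldl_rcons.
  by [].
rewrite KcommE; apply/clsP/geq_rel/Krel_coef => /=.
  by rewrite !map_rcons -!map_comp.
rewrite !big_cons map_rcons -!cats1 !big_cat !big_seq1 /= !big_map !big1 //.
by rewrite !mul1r mulr1.
Qed.

Lemma Kcomm_conj w r s v r' :
  (Kcomm w r s ^ Kpow v r')%g = (Kcomm w r s * Kcomm w (r * r') (rcons s v))%g.
Proof. by rewrite -Kcomm_rcons commgEl mulVKg. Qed.

(** Commutation with a generator whose word contains [j] is the second
    relation.  The general case follows by induction on [t], since commutators
    with letter [j] in their first word are stable under conjugation. *)
Lemma Kcomm_commute j w v r r' s t : j \in letters w -> j \in letters v ->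
  commute (Kcomm w r s) (Kcomm v r' t).
Proof.
move=> jw jv; elim/last_ind: t r' w r s jw => [|t a IH] r' w r s jw.
  apply/commgP/eqP; rewrite Kcomm_rcons; apply: Kcomm_repeat.
  rewrite -rcons_cons -cats1 flat_cat cat_uniq;
    apply/negP => /and3P[_ /hasPn h _].
  have /h : j \in flat [:: v] by rewrite /flat /= cats0.
  by rewrite /flat /= mem_cat jw.
rewrite -[r']mulr1 -Kcomm_rcons commgEl; apply: commuteM.
  by apply: commuteV; exact: IH.
have e : Kcomm w r s = ((Kcomm w r s ^ (Kpow a 1)^-1) ^ Kpow a 1)%g by rewrite
  conjgKV.
rewrite e /commute -!conjMg; congr (_ ^ _)%g.
rewrite -KpowN Kcomm_conj; apply: commute_sym; apply: commuteM;
  apply: commute_sym;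
  exact: IH.
Qed.

Lemma KcommD w r r' s : Kcomm w (r + r') s = (Kcomm w r s * Kcomm w r' s)%g.
Proof.
have jw := word_letter k_gt0 w; set j := nth _ _ _ in jw.
elim/last_ind: s => [|s a IH]; first exact: KpowD.
rewrite -[r + r']mulr1 -Kcomm_rcons IH commgEl conjMg !Kcomm_conj.
have c := @Kcomm_commute j w w _ _ _ _ jw jw.
rewrite !mulr1; apply: (canLR (mulKg _)); rewrite -!mulgA; congr (_ * _)%g.
by rewrite !mulgA; congr (_ * _)%g; exact: c.
Qed.

Lemma Kcomm0 w s : Kcomm w 0 s = 1%g.
Proof. by apply: (mulgI (Kcomm w 0 s)); rewrite -KcommD addr0 mulg1. Qed.

Local Notation key := (word * n.-bseq word)%type.

(** Sequences longer than n repeat a letter, so that a product over a finite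
    type of indices is enough.  The factors commute, and the scalars [c] are
    coordinates on the subgroup. *)
Definition letter_prod j (c : key -> R) : K :=
  (\big[*%g/1]_(p : key | j \in letters p.1) Kcomm p.1 (c p) p.2)%g.

Definition is_letter_prod j g := exists c, g = letter_prod j c.

Lemma is_letter_prodM j g h : is_letter_prod j g -> is_letter_prod j h ->
  is_letter_prod j (g * h)%g.
Proof.
move=> [c ->] [d ->]; exists (fun p => c p + d p).
rewrite /letter_prod -(@prodgM_commute _ _ _ (fun p : key => j \in letters
  p.1)).
  by apply: eq_bigr => p _; rewrite KcommD.
  by move=> p q jp jq; apply: Kcomm_commute jp jq.
Qed.

Lemma size_uniq_flat u : uniq (flat u) -> (size u <= n)%N.
Proof.
move=> uu; have : (size (flat u) <= size (iota 0 n))%N.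
  by apply: uniq_leq_size => // i /flat_ltn; rewrite mem_iota.
by rewrite size_flat size_iota; apply: leq_trans; rewrite leq_pmulr.
Qed.

Lemma is_letter_prod_Kcomm j w r s : j \in letters w -> is_letter_prod j (Kcomm
  w r s).
Proof.
move=> jw; have [us|/Kcomm_repeat->] := boolP (uniq (flat (w :: s)));
  last first.
  by exists (fun=> 0); rewrite /letter_prod big1 // => p _; rewrite Kcomm0.
have sn : (size s <= n)%N by have /= := size_uniq_flat us => /ltnW.
exists (fun p => if p == (w, Bseq sn) then r else 0).
rewrite /letter_prod big_mkcond (eq_bigr (fun p : key => if p == (w, Bseq sn)
  then Kcomm w r s else 1%g)).
  by rewrite -big_mkcond big_pred1_eq.
by move=> p _; case: eqP => [->|_]; rewrite ?jw // Kcomm0; case: ifP.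
Qed.

Lemma is_letter_prod_conj j g v r : is_letter_prod j g -> is_letter_prod j (g ^
  Kpow v r)%g.
Proof.
move=> [c ->]; rewrite /letter_prod conjg_prod; apply: big_ind.
- by exists (fun=> 0); rewrite /letter_prod big1 // => p _; rewrite Kcomm0.
- exact: is_letter_prodM.
by move=> p jp; rewrite Kcomm_conj; apply: is_letter_prodM;
  exact: is_letter_prod_Kcomm.
Qed.

(** The subgroup generated by the words in the letters below [j]. *)
Definition gen_below j g := exists2 l : seq (word * R),
  all (fun p => all (gtn j) (letters p.1)) l &
  g = (\big[*%g/1]_(p <- l) Kpow p.1 p.2)%g.

Lemma gen_below1 j : gen_below j 1%g.
Proof. by exists [::]; rewrite ?big_nil. Qed.

Lemma gen_belowM j g h : gen_below j g -> gen_below j h -> gen_below j (g *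
  h)%g.
Proof.
move=> [l hl ->] [l' hl' ->]; exists (l ++ l'); first by rewrite all_cat hl.
by rewrite big_cat.
Qed.

Lemma gen_below_pow j w r : all (gtn j) (letters w) -> gen_below j (Kpow w r).
Proof. by move=> hw; exists [:: (w, r)]; rewrite ?big_seq1 //= hw. Qed.

Lemma gen_below_top g : gen_below n g.
Proof.
have hw w : all (gtn n) (letters w) by apply/allP => _ /mapP[i _ ->];
  exact: ltn_ord.
elim/Defs.quotW: g => a;
  rewrite -[cls _ a]/(pgcls (@Krel R k n) a) -geval_pggen.
elim: a => [[w r]||a IHa b IHb|a [l _ e]] /=; first exact: gen_below_pow.
- exact: gen_below1.
- exact: gen_belowM.
rewrite e; exists (rev [seq (p.1, - p.2) | p <- l]).
  by rewrite all_rev all_map; apply/allP => p _ /=; exact: hw.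
rewrite -{1}[l]revK -prodgV -map_rev big_map; apply: eq_bigr => p _.
by rewrite KpowN.
Qed.

(** The products for the letter [j] are stable under conjugation, which moves
    them to the left of the generators. *)
Lemma letter_factor j g : gen_below j.+1 g -> exists m h, [/\ is_letter_prod j
  m, gen_below j h & g = (m * h)%g].
Proof.
case=> l; elim: l g => [|[w r] l IH] g /=.
  move=> _ ->; exists 1%g, 1%g; split;
    [|exact: gen_below1|by rewrite big_nil mulg1].
  by exists (fun=> 0); rewrite /letter_prod big1 // => p _; rewrite Kcomm0.
case/andP=> hw hl ->; have [m [h [hm hh e]]] := IH _ hl erefl.
rewrite big_cons e; have [jw|jw] := boolP (j \in letters w).
  exists (Kpow w r * m)%g, h; split; rewrite ?mulgA //.
  by apply: is_letter_prodM => //; exact: (is_letter_prod_Kcomm r [::] jw).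
exists (m ^ (Kpow w r)^-1)%g, (Kpow w r * h)%g; split.
- by rewrite -KpowN; apply: is_letter_prod_conj.
- apply: gen_belowM => //; apply: gen_below_pow; apply/allP => i iw.
  have := allP hw i iw; rewrite /= ltnS leq_eqVlt => /predU1P[ij|//].
  by rewrite -ij iw in jw.
by rewrite !mulgA -conjgCV.
Qed.

Lemma letter_prod_free j c : eq_avoid j (realize (letter_prod j c)) one.
Proof.
rewrite /letter_prod; apply: (big_ind (fun g => eq_avoid j (realize g) one)).
- by rewrite realize1.
- move=> g h hg hh; rewrite realizeM.
  have := eq_avoidM hg hh; by rewrite [Coalg_mul one _](@gmul1 CG).
by move=> p jp; apply: Kcomm_free.
Qed.

Lemma coef_letter_prod j c v s (sn : (size s <= n)%N) : j \in letters v -> uniq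
  (flat (v :: s)) ->
  coef (realize (letter_prod j c)) (v :: s) = c (v, Bseq sn).
Proof.
move=> jv us.
have [_ ->] : eq_avoid j (realize (letter_prod j c)) one /\ coef (realize
  (letter_prod j c)) (v :: s) =
    \sum_(p : key | j \in letters p.1) c p * (v :: s == p.1 :: p.2)%:R.
  apply: (big_ind2 (fun g (a : R) => eq_avoid j (realize g) one /\ coef
    (realize g) (v :: s) = a)).
  - by rewrite realize1 coef_one.
  - move=> g a h b [hg <-] [hh <-]; rewrite realizeM; split.
      have := eq_avoidM hg hh; by rewrite [Coalg_mul one _](@gmul1 CG).
    exact: (coefM_free _ _ jv).
  - by move=> p jp; split; [exact: Kcomm_free|rewrite (coef_Kcomm _ _ jp)].
rewrite (bigD1 (v, Bseq sn)) //= eqxx mulr1 big1 ?addr0 // => -[w t] /andP[_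
  ne].
rewrite [_ == _](_ : _ = false) ?mulr0 //; apply: contraNF ne => /eqP[-> e].
by apply/eqP; congr pair; apply: val_inj.
Qed.

Lemma supp_one (b : pred nat) u : ~~ all b (flat u) -> coef one u = 0.
Proof. by rewrite coef_one; case: u. Qed.

Lemma gen_below_supp j h u : gen_below j h -> ~~ all (gtn j) (flat u) -> coef
  (realize h) u = 0.
Proof.
case=> l + ->; elim: l u => [|[w r] l IH] u /=.
  by move=> _; rewrite big_nil realize1; exact: supp_one.
case/andP=> hw hl hu; rewrite big_cons realizeM realize_pow.
have [uu|uu] := boolP (uniq (flat u)); last by rewrite coef_repeat.
rewrite coefM // big1 // => i _.
move: hu; rewrite -{1}(cat_take_drop i u) flat_cat all_cat negb_and =>
  /orP[hu|hu].
  rewrite coef_gen; last first.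
    by move: uu; rewrite -{1}(cat_take_drop i u) flat_cat cat_uniq => /andP[].
  case: eqP hu => [->//|_]; case: eqP => [->|_];
    first by rewrite /flat /= cats0 hw.
  by rewrite mulr0 addr0 mul0r.
by rewrite (IH _ hl hu) mulr0.
Qed.

(** In the factorization m * h of [g], the image of m is trivial off [j] and
    that of h only has coefficients off [j].  Hence the image of h is trivial,
    then that of m is trivial, and the coefficients of the latter are the
    coordinates of m. *)
Lemma realize_inj_below j g : gen_below j g -> realize g = one -> g = 1%g.
Proof.
elim: j g => [|j IH] g hg e.
  case: hg => -[|[w r] l]; first by rewrite big_nil.
  rewrite /= => /andP[]; case: (letters w) (size_letters w) => [|i s] /= h;
    last by [].
  suff : (0 < 0)%N by []; by rewrite [X in (_ < X)%N]h.
have [m [h [[c em] hh eg]]] := letter_factor hg; subst g.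
rewrite realizeM in e.
have hm : eq_avoid j (realize m) one by rewrite em; exact: letter_prod_free.
have h1 : realize h = one.
  apply: coef_inj => u; have [ju|ju] := boolP (j \in flat u).
    have bad : ~~ all (gtn j) (flat u) by apply/allPn; exists j => //=;
      rewrite ltnn.
    by rewrite (gen_below_supp hh bad) (supp_one bad).
  have := @eq_avoidM _ _ _ j _ _ _ _ hm (fun u _ => erefl (coef (realize h) u)).
  by move=> /(_ _ ju); rewrite e [Coalg_mul one _](@gmul1 CG) => <-.
rewrite (IH h hh h1) mulg1.
move: e; rewrite h1 [Coalg_mul _ one](@gmulg1 CG) => e.
rewrite em /letter_prod big1 // => p jp.
have [us|/Kcomm_repeat//] := boolP (uniq (flat (p.1 :: p.2))).
suff -> : c p = 0 by rewrite Kcomm0.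
have := coef_letter_prod c (size_bseq p.2) jp us;
  rewrite -em e coef_one => e0; apply: etrans (esym e0).
by congr c; case: (p) => w t; congr pair; apply: val_inj.
Qed.

Lemma realize_inj : injective realize.
Proof.
move=> g h e; apply/eqP; rewrite -divg_eq1; apply/eqP.
apply: (realize_inj_below (gen_below_top _));
  rewrite realizeM e -realizeM mulgV; exact: realize1.
Qed.

Lemma realizeV g : realize g^-1%g = Coalg_inv (realize g).
Proof.
apply: (@gmul_eq1_inv CG); apply: etrans (esym (realizeM _ _)) _.
by rewrite mulgV realize1.
Qed.

(** The quotient of [f] by its restriction to the letters below [j] is trivial
    off [j], and any family of leading coefficients is that of some
    [letter_prod j c]. *)
Lemma realize_surj_below j (f : CG) :
  (forall u, ~~ all (gtn j) (flat u) -> coef f u = 0) -> exists g, realize g =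
    f.
Proof.
elim: j f => [|j IH] f hf.
  exists 1%g; rewrite realize1; apply: coef_inj => u.
  have [|hu] := boolP (all (gtn 0) (flat u)); last by rewrite hf ?(supp_one hu).
  case: u => [|w u]; first by rewrite !coef_nil.
  by rewrite /flat /= all_cat; case: (letters w) (size_letters w) => [h|//];
    suff : (0 < 0)%N by []; rewrite [X in (_ < X)%N]h.
have [g eg] : exists g, realize g = kept (gtn j) f.
  by apply: IH => u /negPf hu; rewrite coef_kept hu.
pose p := Coalg_mul f (Coalg_inv (realize g)).
have fg : eq_avoid j f (realize g).
  move=> u ju; rewrite eg coef_kept; case: ifPn => // /allPn[i iu ij].
  have ji : (j <= i)%N by rewrite leqNgt.
  apply: hf; apply/allPn; exists i => //;
    rewrite /= -leqNgt ltn_neqAle ji andbT.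
  by apply: contraNneq ju => ->.
have hp : eq_avoid j p one.
  have := @eq_avoidM _ _ _ j f (realize g) _ _ fg (fun u _ => erefl (coef
    (Coalg_inv (realize g)) u)).
  by rewrite [Coalg_mul (realize g) _](@gmulgV CG).
pose c (q : key) := coef p (q.1 :: q.2).
exists (letter_prod j c * g)%g; rewrite realizeM.
have -> : realize (letter_prod j c) = p.
  apply: (leading_inj (@letter_prod_free j c) hp) => w s jw us.
  have sn : (size s <= n)%N by have /= := size_uniq_flat us => /ltnW.
  by rewrite (coef_letter_prod _ sn).
rewrite /p -[Coalg_mul (Coalg_mul _ _) _](@gmulA CG).
by rewrite [gmul (ginv _) _](@gmulV CG); exact: (@gmulg1 CG).
Qed.

Lemma realize_surj (f : CG) : exists g, realize g = f.
Proof.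
apply: (@realize_surj_below n) => u /allPn[i /flat_ltn iN]; by rewrite /= iN.
Qed.

End Realization.

Lemma inj_surj_bij (A B : Type) (f : A -> B) :
  injective f -> (forall b, exists a, f a = b) -> bijective f.
Proof.
move=> fI fS; have [g gK] := choice fS.
by exists g => // a; apply: fI.
Qed.

Section Restriction.
Variables (R : comPzRingType) (k n : nat).
Hypothesis k_gt0 : (0 < k)%N.

Lemma letters_widen (w : Kword k n) : letters (widen_word w) = letters w.
Proof. by rewrite /letters /= -map_comp; apply: eq_map. Qed.

Lemma flat_widen (u : seq (Kword k n)) : flat (map (@widen_word k n) u) = flat
  u.
Proof. by rewrite /flat -map_comp; congr flatten; apply: eq_map => w /=;
  rewrite letters_widen. Qed.

(** The inclusion of the free module on n generators in that on n + 1
    generators does not change coefficients. *)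
Lemma coef_restr (f : Coalg R k n.+1) (u : seq (Kword k n)) :
  coef (Coalg_restr f) u = coef f (map (@widen_word k n) u).
Proof.
pose incl : {linear 'rV[R]_n -> 'rV[R]_(n.+1)} := @xsubst R n _ (@xvec R n.+1).
have e y : monform R (map (@widen_word k n) u) (TVwedge_map k incl y) = monform
  R u y.
  rewrite !monform_flatform [LHS]flatform_natural size_map flat_widen.
  rewrite (eq_flatform (G := fun t => xform R n (nth 0%N (flat u) t))) // => t
    _.
  apply: row_ext => i iN /=.
  by rewrite xsubst_xvec // !xform_xvec // ltnW.
rewrite /coef -e.
rewrite -[TVwedge_map k incl _](@coalg_natural _ _ _ (Coalg_restr f) (Vrow R n)
  (Vrow R n.+1) incl).
rewrite /= CVpow_inclE flat_widen; congr (monform R _ (f (Vrow R n.+1) _)).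
rewrite cpoint_map /xpoint /= ifN.
  by congr tpure; apply: eq_cpoint => // i iN _; rewrite /= xsubst_xvec.
by apply/negP => /flat_ltn; rewrite ltnn.
Qed.

(** Both sides are homomorphisms, and a generator whose word contains the last
    letter has no coefficient, other than 1, on the sequences that avoid it. *)
Lemma restr_realize (g : Kgroup R k n.+1) :
  Coalg_restr (realize k_gt0 g) = realize k_gt0 (Kproj g).
Proof.
elim/Defs.quotW: g => a; rewrite -[cls _ a]/(pgcls (@Krel R k n.+1) a).
rewrite -geval_pggen; elim: a => [[w r]||a IHa b IHb|a IHa] /=.
- rewrite [pggen _ _]/(Kpow w r) Kproj_pow realize_pow; apply: coef_inj => u.
  have [uu|uu] := boolP (uniq (flat u)); last by rewrite !coef_repeat.
  rewrite coef_restr coef_gen ?flat_widen // -[map _ u == [::]]size_eq0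
    size_map size_eq0.
  rewrite /Kproj_gen; case: pickP => [v /eqP /= vw|none].
    rewrite realize_pow coef_gen // -vw.
    by rewrite (inj_eq (inj_map (@widen_word_inj k n)) u [:: v]).
  rewrite realize1 coef_one; case: (_ =P [:: w]) => [e|_];
    last by rewrite mulr0 addr0.
  by case: u e {uu} => [//|v [|//]] [e]; have := none v; rewrite /= e eqxx.
- by rewrite realize1 Kproj1 realize1; exact: Coalg_restr1.
- by rewrite realizeM [LHS]Coalg_restrM KprojM realizeM IHa IHb.
rewrite realizeV [LHS]Coalg_restrV IHa -realizeV; congr (realize k_gt0 _).
by apply: (mulgI (Kproj (geval (pggen (@Krel R k n.+1)) a)));
  rewrite -KprojM !mulgV Kproj1.
Qed.

End Restriction.

Theorem theorem5p8 (R : comPzRingType) (k : nat) (k_ge1 : (1 <= k)%N) :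
  (forall n : nat, (1 <= n)%N ->
     group_isomorphic (Kgroup R k n) (CoalgGroup R k n)) /\
  group_isomorphic (KinfGroup R k) (CoalgInfGroup R k).
Proof.
split=> [n _|].
  exists (@realize R k n k_ge1); split; last exact: realizeM.
  by apply: inj_surj_bij; [exact: realize_inj|exact: realize_surj].
have compat (x : Kinf R k) n :
    Coalg_restr (realize k_ge1 (x n.+1)) = realize k_ge1 (x n).
  by rewrite restr_realize kinf_compat.
exists (fun x : Kinf R k => @MkCoalgInf R k (fun n => realize k_ge1 (x n))
  (compat x)).
split; last by move=> x y; apply: coalginf_ext => n; exact: realizeM.
apply: inj_surj_bij => [x y exy|y].
  apply: kinf_ext => n; apply: (@realize_inj _ _ _ k_ge1).
  exact: (congr1 (fun z : CoalgInf R k => z n) exy).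
pose x n := projT1 (cid (realize_surj k_ge1 (y n))).
have xE n : realize k_ge1 (x n) = y n := projT2 (cid (realize_surj k_ge1 (y
  n))).
have xc n : Kproj (x n.+1) = x n.
  by apply: (@realize_inj _ _ _ k_ge1); rewrite -restr_realize !xE;
    exact: coalginf_compat.
by exists (KInf xc); apply: coalginf_ext.
Qed.
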